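(* The Fourier transform $\mathcal{F}:\mathcal{D}(\mathbb{A})\to\mathcal{D}(\mathbb{A})$, $\mathcal{F}[\varphi](\xi)=\widehat\varphi(\xi)=\int_{\mathbb{A}}\varphi(x)\chi(\xi x)\,dx$ ($\xi\in\mathbb{A}$), is a linear and continuous isomorphism. The inversion formula on $\mathcal{D}(\mathbb{A})$ holds: $$\varphi(x)=\int_{\mathbb{A}}\widehat\varphi(-\xi)\,\chi(\xi x)\,d\xi\qquad(\varphi\in\mathcal{D}(\mathbb{A}),\ x\in\mathbb{A}),$$ and the Parseval–Steklov equality holds: for all $\varphi,\psi\in\mathcal{D}(\mathbb{A})$, $$\int_{\mathbb{A}}\varphi(x)\overline{\psi(x)}\,dx=\int_{\mathbb{A}}\widehat\varphi(\xi)\overline{\widehat\psi(\xi)}\,d\xi.$$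
   Context: $\mathbb{A}_f$ is the ring of finite adèles of $\mathbb{Q}$, $\widehat{\mathbb{Z}}=\prod_p\mathbb{Z}_p\subset\mathbb{A}_f$ its maximal compact open subring, and $\mathbb{A}=\mathbb{R}\times\mathbb{A}_f$ the adèle ring. For $x_f\in\mathbb{A}_f$, the fractional part $\{x_f\}_{\mathbb{A}_f}$ is the unique rational number in $[0,1)$ with $x_f-\{x_f\}_{\mathbb{A}_f}\in\widehat{\mathbb{Z}}$. The canonical character of $\mathbb{A}$ is $\chi(x)=\exp\big(2\pi i(-x_\infty+\{x_f\}_{\mathbb{A}_f})\big)$ for $x=(x_\infty,x_f)$. The Haar measure is $dx=dx_\infty\,dx_f$, with $dx_\infty$ Lebesgue measure and $dx_f$ the Haar measure on $\mathbb{A}_f$ giving $\widehat{\mathbb{Z}}$ mass one. $\mathcal{D}(\mathbb{R})$ denotes the Schwartz space of $\mathbb{R}$ with its usual Fréchet topology. The Bruhat–Schwartz space of $\mathbb{A}$ is $\mathcal{D}(\mathbb{A})=\varinjlim_{K\subset H}\mathcal{D}\big((\mathbb{R}\times H)/(\{0\}\times K)\big)$, a locally convex inductive limit over compact open subgroups $K\subset H$ of $\mathbb{A}_f$, where $\mathcal{D}\big((\mathbb{R}\times H)/(\{0\}\times K)\big)$ is the space of functions $\varphi:\mathbb{A}\to\mathbb{C}$ supported in $\mathbb{R}\times H$, invariant under translation by $\{0\}\times K$, and such that $\varphi(\cdot,a)\in\mathcal{D}(\mathbb{R})$ for every $a\in H$; since $H/K$ is finite, it is a finite direct sum of copies of $\mathcal{D}(\mathbb{R})$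 and has the corresponding Fréchet topology. As a vector space, $\mathcal{D}(\mathbb{A})$ is the linear span of the functions $x\mapsto\varphi_\infty(x_\infty)\varphi_f(x_f)$ with $\varphi_\infty\in\mathcal{D}(\mathbb{R})$ and $\varphi_f:\mathbb{A}_f\to\mathbb{C}$ locally constant with compact support. *)

(* Defs.v *)
From HB Require Import structures.
From mathcomp Require Import all_boot all_order all_algebra fraction finmap.
From mathcomp Require Import all_classical all_reals all_analysis.
From mathcomp.real_closed Require Import complex.

Set Implicit Arguments.
Unset Strict Implicit.
Unset Printing Implicit Defensive.

Import Order.TTheory GRing.Theory Num.Theory.
Import numFieldNormedType.Exports.

Local Open Scope classical_set_scope.
Local Open Scope ring_scope.

Record primeN := PrimeN { prime_val :> nat ; primeP : prime prime_val }.

HB.instance Definition _ := [isSub for prime_val].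
HB.instance Definition _ := [Choice of primeN by <:].

Section PadicIntegers.
Variable p : primeN.
Implicit Types k : nat.

Lemma primeN_gt1 : (1 < p)%N. Proof. exact: prime_gt1 (primeP p). Qed.

Lemma modulus_gt1 k : (1 < p ^ k.+1)%N.
Proof. by rewrite -{1}(expn0 p) ltn_exp2l ?primeN_gt1. Qed.

(* Z_p is the inverse limit of the rings Z / p ^ k.+1; the exponents start at *)
(* 1 because 'Z_1 is not the trivial ring.                                    *)
Definition compatible (x : forall k, 'Z_(p ^ k.+1)) :=
  forall k, x k.+1 = x k %[mod p ^ k.+1].

Record zpadic := Zpadic {
  residue : forall k, 'Z_(p ^ k.+1) ;
  residueP : compatible residue }.

HB.instance Definition _ := gen_eqMixin zpadic.
HB.instance Definition _ := gen_choiceMixin zpadic.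

Implicit Types x y z : zpadic.

Lemma zpadicP x y : (forall k, residue x k = residue y k) -> x = y.
Proof.
case: x y => [x xP] [y yP] /= xy.
have {}xy : x = y by apply: functional_extensionality_dep.
by rewrite xy in xP *; congr Zpadic; exact: Prop_irrelevance.
Qed.

Lemma modulusE k : (Zp_trunc (p ^ k.+1)).+2 = (p ^ k.+1)%N.
Proof. exact: Zp_cast (modulus_gt1 k). Qed.

Lemma modulus_dvd k : (p ^ k.+1 %| p ^ k.+2)%N.
Proof. exact: dvdn_exp2l. Qed.

Lemma val_addZ k (a b : 'Z_(p ^ k.+1)) :
  val (a + b) = ((a + b) %% p ^ k.+1)%N.
Proof. by rewrite -[X in (_ %% X)%N](modulusE k). Qed.

Lemma val_mulZ k (a b : 'Z_(p ^ k.+1)) :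
  val (a * b) = ((a * b) %% p ^ k.+1)%N.
Proof. by rewrite -[X in (_ %% X)%N](modulusE k). Qed.

Lemma val_oneZ k : val (1 : 'Z_(p ^ k.+1)) = 1%N.
Proof. by rewrite /= modulusE modn_small// modulus_gt1. Qed.

Lemma ltn_modulus k (a : 'Z_(p ^ k.+1)) : (a < p ^ k.+1)%N.
Proof. by rewrite -[X in (_ < X)%N](modulusE k). Qed.

Lemma mod_addZ j k (a b : 'Z_(p ^ k.+1)) : (j <= k)%N ->
  (a + b)%R = (a + b)%N %[mod p ^ j.+1].
Proof.
move=> jk; rewrite -[X in (X %% _)%N = _]/(val _) val_addZ modn_dvdm//.
exact: dvdn_exp2l.
Qed.

Lemma mod_mulZ j k (a b : 'Z_(p ^ k.+1)) : (j <= k)%N ->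
  (a * b)%R = (a * b)%N %[mod p ^ j.+1].
Proof.
move=> jk; rewrite -[X in (X %% _)%N = _]/(val _) val_mulZ modn_dvdm//.
exact: dvdn_exp2l.
Qed.

Fact zpadic0_subproof : compatible (fun k => 0).
Proof. by []. Qed.
Definition zpadic0 : zpadic := Zpadic zpadic0_subproof.

Fact zpadic1_subproof : compatible (fun k => 1).
Proof.
by move=> k; congr (_ %% _)%N; exact: etrans (val_oneZ _) (esym (val_oneZ _)).
Qed.
Definition zpadic1 : zpadic := Zpadic zpadic1_subproof.

Fact zpadic_opp_subproof x : compatible (fun k => - residue x k).
Proof.
move=> k; apply/eqP; rewrite -(eqn_modDr (residue x k)); apply/eqP.
rewrite -mod_addZ// addNr -modnDmr -residueP modnDmr -mod_addZ//.
by rewrite addNr.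
Qed.
Definition zpadic_opp x : zpadic := Zpadic (zpadic_opp_subproof x).

Fact zpadic_add_subproof x y : compatible (fun k => residue x k + residue y k).
Proof. by move=> k; rewrite !mod_addZ// -modnDm !residueP modnDm. Qed.
Definition zpadic_add x y : zpadic := Zpadic (zpadic_add_subproof x y).

Fact zpadic_mul_subproof x y : compatible (fun k => residue x k * residue y k).
Proof. by move=> k; rewrite !mod_mulZ// -modnMm !residueP modnMm. Qed.
Definition zpadic_mul x y : zpadic := Zpadic (zpadic_mul_subproof x y).

Fact zpadic_addA : associative zpadic_add.
Proof. by move=> x y z; apply: zpadicP => k; exact: addrA. Qed.
Fact zpadic_addC : commutative zpadic_add.
Proof. by move=> x y; apply: zpadicP => k; exact: addrC. Qed.
Fact zpadic_add0 : left_id zpadic0 zpadic_add.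
Proof. by move=> x; apply: zpadicP => k; exact: add0r. Qed.
Fact zpadic_addN : left_inverse zpadic0 zpadic_opp zpadic_add.
Proof. by move=> x; apply: zpadicP => k; exact: addNr. Qed.
HB.instance Definition _ := GRing.isZmodule.Build zpadic
  zpadic_addA zpadic_addC zpadic_add0 zpadic_addN.

Fact zpadic_mulA : associative zpadic_mul.
Proof. by move=> x y z; apply: zpadicP => k; exact: mulrA. Qed.
Fact zpadic_mulC : commutative zpadic_mul.
Proof. by move=> x y; apply: zpadicP => k; exact: mulrC. Qed.
Fact zpadic_mul1 : left_id zpadic1 zpadic_mul.
Proof. by move=> x; apply: zpadicP => k; exact: mul1r. Qed.
Fact zpadic_mulD : left_distributive zpadic_mul +%R.
Proof. by move=> x y z; apply: zpadicP => k; exact: mulrDl. Qed.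
Fact zpadic1_neq0 : zpadic1 != 0.
Proof.
apply/eqP => /(congr1 (fun x => residue x 0)) /eqP.
by rewrite /residue /= oner_eq0.
Qed.
HB.instance Definition _ := GRing.Zmodule_isComNzRing.Build zpadic
  zpadic_mulA zpadic_mulC zpadic_mul1 zpadic_mulD zpadic1_neq0.

Lemma residue0 k : residue 0 k = 0. Proof. by []. Qed.
Lemma residueD x y k : residue (x + y) k = residue x k + residue y k.
Proof. by []. Qed.
Lemma residueN x k : residue (- x) k = - residue x k. Proof. by []. Qed.
Lemma residue1 k : residue 1 k = 1. Proof. by []. Qed.
Lemma residueM x y k : residue (x * y) k = residue x k * residue y k.
Proof. by []. Qed.

Lemma residue_le x j k : (j <= k)%N ->
  residue x k = residue x j %[mod p ^ j.+1].
Proof.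
elim: k => [|k IH]; first by rewrite leqn0 => /eqP ->.
rewrite leq_eqVlt => /orP [/eqP -> //|jk]; rewrite -IH//.
have := residueP x k => /(congr1 (fun n => n %% p ^ j.+1)%N).
by rewrite !modn_dvdm// dvdn_exp2l.
Qed.

Lemma residue_neq0 x k : residue x k != 0 -> ~~ (p ^ k.+1 %| residue x k)%N.
Proof.
apply: contraNN => /dvdn_leq h; apply/eqP/val_inj => /=; apply/eqP.
rewrite -leqn0 leqNgt; apply/negP => /h.
by rewrite leqNgt ltn_modulus.
Qed.

Fact zpadic_idomain x y : x * y = 0 -> (x == 0) || (y == 0).
Proof.
have nz z : z != 0 -> exists k, residue z k != 0.
  move=> z0; apply/not_existsP => h; move/negP: z0; apply.
  by apply/eqP/zpadicP => k; move: (h k) => /negP; rewrite negbK => /eqP.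
move=> xy; apply/norP; case=> /nz[i xi] /nz[j yj].
pose k := (i + j).+1.
have := congr1 (fun z => val (residue z k)) xy.
rewrite [LHS]val_mulZ => /eqP; rewrite -/(_ %| _)%N.
have xk : ~~ (p ^ i.+1 %| residue x k)%N.
  by rewrite /dvdn (@residue_le x i k) ?residue_neq0// /k -addnS leq_addr.
have yk : ~~ (p ^ j.+1 %| residue y k)%N.
  by rewrite /dvdn (@residue_le y j k) ?residue_neq0// /k -addSn leq_addl.
have gt0 m n : ~~ (n %| m)%N -> (0 < m)%N.
  by case: m => //; rewrite dvdn0.
have p_pr := primeP p.
have x0 := gt0 _ _ xk; have y0 := gt0 _ _ yk.
move: xk yk; rewrite !pfactor_dvdn ?muln_gt0 ?x0 ?y0// lognM// -!leqNgt.
move=> xk yk h; have := leq_trans h (leq_add xk yk).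
by rewrite /k ltnNge leqnSn.
Qed.

Definition zpadic_unit : {pred zpadic} := [pred x | `[< exists y, y * x = 1 >]].
Definition zpadic_inv x : zpadic :=
  if pselect (exists y, y * x = 1) is left h then projT1 (cid h) else x.

Fact zpadic_mulV : {in zpadic_unit, left_inverse 1 zpadic_inv *%R}.
Proof.
move=> x /asboolP; rewrite /zpadic_inv => h.
by case: pselect => // h'; exact: projT2 (cid h').
Qed.
Fact zpadic_unitP x y : y * x = 1 -> zpadic_unit x.
Proof. by move=> yx; apply/asboolP; exists y. Qed.
Fact zpadic_inv_out : {in [predC zpadic_unit], zpadic_inv =1 id}.
Proof. by move=> x /asboolP; rewrite /zpadic_inv; case: pselect. Qed.
HB.instance Definition _ := GRing.ComNzRing_hasMulInverse.Build zpadic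
  zpadic_mulV zpadic_unitP zpadic_inv_out.
HB.instance Definition _ := GRing.ComUnitRing_isIntegral.Build zpadic
  zpadic_idomain.

End PadicIntegers.

Section PadicNumbers.
Variable p : primeN.

Definition padic := {fraction zpadic p}.

HB.instance Definition _ := GRing.Field.on padic.

Definition padic_int : set padic := range (@tofrac (zpadic p)).

(* The coset x + p ^ k Z_p.                                                   *)
Definition padic_ball (x : padic) (k : nat) : set padic :=
  [set x + tofrac (p%:R ^+ k * z) | z in [set: zpadic p]].

Definition padic_open (U : set padic) :=
  forall x, U x -> exists k, padic_ball x k `<=` U.

Lemma sub_padic_ball x j k : (j <= k)%N -> padic_ball x k `<=` padic_ball x j.
Proof.
move=> jk _ [z _ <-]; exists (p%:R ^+ (k - j) * z) => //.
by rewrite mulrA -exprD subnKC.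
Qed.

Fact padic_openT : padic_open setT.
Proof. by move=> x _; exists 0%N. Qed.

Fact padic_openI : setI_closed padic_open.
Proof.
move=> U V oU oV x [/oU[j Uj] /oV[k Vk]]; exists (maxn j k).
move=> y xy; split; [apply: Uj|apply: Vk]; apply: sub_padic_ball xy.
  exact: leq_maxl.
exact: leq_maxr.
Qed.

Fact padic_open_bigcup (I : Type) (U : I -> set padic) :
  (forall i, padic_open (U i)) -> padic_open (\bigcup_i U i).
Proof.
move=> oU x [i _ /oU[k Uk]]; exists k => y /Uk Uy.
by exists i.
Qed.

HB.instance Definition _ := isOpenTopological.Build padic
  padic_openT padic_openI padic_open_bigcup.

Lemma padic_openE (U : set padic) : open U <-> padic_open U.
Proof. by []. Qed.

Lemma padic_ball_refl x k : padic_ball x k x.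
Proof. by exists 0 => //; rewrite mulr0 tofrac0 addr0. Qed.

Lemma padic_ball_trans x y k :
  padic_ball x k y -> padic_ball y k `<=` padic_ball x k.
Proof.
move=> [z _ <-] _ [t _ <-]; exists (z + t) => //.
by rewrite mulrDr tofracD addrA.
Qed.

Lemma padic_ball_open x k : open (padic_ball x k).
Proof. by apply/padic_openE => y xy; exists k; exact: padic_ball_trans. Qed.

Lemma padic_int0 : padic_int 0. Proof. by exists 0 => //; exact: tofrac0. Qed.
Lemma padic_int1 : padic_int 1. Proof. by exists 1 => //; exact: tofrac1. Qed.
Lemma padic_intD x y : padic_int x -> padic_int y -> padic_int (x + y).
Proof. by move=> [a _ <-] [b _ <-]; exists (a + b) => //; exact: tofracD. Qed.
Lemma padic_intN x : padic_int x -> padic_int (- x).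
Proof. by move=> [a _ <-]; exists (- a) => //; exact: tofracN. Qed.
Lemma padic_intM x y : padic_int x -> padic_int y -> padic_int (x * y).
Proof. by move=> [a _ <-] [b _ <-]; exists (a * b) => //; exact: tofracM. Qed.

Lemma padic_ball0 x : padic_int x -> padic_ball x 0 = padic_int.
Proof.
move=> Zx; apply/seteqP; split => [_ [z _ <-]|y Zy].
  by apply: padic_intD => //; eexists.
have [z _ zE] := padic_intD Zy (padic_intN Zx).
by exists z => //; rewrite expr0 mul1r zE addrC subrK.
Qed.

End PadicNumbers.

Section FiniteAdeles.

Record finadele := FinAdele {
  component :> forall p : primeN, padic p ;
  finadeleP : finite_set [set p | ~ padic_int (component p)] }.

HB.instance Definition _ := gen_eqMixin finadele.
HB.instance Definition _ := gen_choiceMixin finadele.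

Implicit Types x y z : finadele.

Lemma finadele_eq x y : (forall p, x p = y p) -> x = y.
Proof.
case: x y => [x xP] [y yP] /= xy.
have {}xy : x = y by apply: functional_extensionality_dep.
by rewrite xy in xP *; congr FinAdele; exact: Prop_irrelevance.
Qed.

Fact finadele_fin1 x (f : forall p, padic p) :
  (forall p, padic_int (x p) -> padic_int (f p)) ->
  finite_set [set p | ~ padic_int (f p)].
Proof.
move=> xf; apply: sub_finite_set (finadeleP x) => p /= nf xp.
by apply: nf; exact: xf.
Qed.

Fact finadele_fin2 x y (f : forall p, padic p) :
  (forall p, padic_int (x p) -> padic_int (y p) -> padic_int (f p)) ->
  finite_set [set p | ~ padic_int (f p)].
Proof.
move=> xyf.
have : finite_set ([set p | ~ padic_int (x p)] `|` [set p | ~ padic_int (y p)]).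
  by rewrite finite_setU; split; exact: finadeleP.
apply: sub_finite_set => p /= nf; apply/not_andP => -[xp yp].
by apply: nf; exact: xyf.
Qed.

Fact finadele_finZ (f : forall p, padic p) :
  (forall p, padic_int (f p)) -> finite_set [set p | ~ padic_int (f p)].
Proof.
move=> Zf; rewrite (_ : mkset _ = set0)//.
by apply/seteqP; split => p //= /(_ (Zf p)).
Qed.

Definition finadele0 := FinAdele (finadele_finZ (fun p => @padic_int0 p)).
Definition finadele1 := FinAdele (finadele_finZ (fun p => @padic_int1 p)).
Definition finadele_opp x :=
  FinAdele (@finadele_fin1 x (fun p => - x p) (fun p => @padic_intN p (x p))).
Definition finadele_add x y :=
  FinAdele
    (@finadele_fin2 x y (fun p => x p + y p) (fun p => @padic_intD p _ _)).
Definition finadele_mul x y :=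
  FinAdele
    (@finadele_fin2 x y (fun p => x p * y p) (fun p => @padic_intM p _ _)).

Fact finadele_addA : associative finadele_add.
Proof. by move=> x y z; apply: finadele_eq => p; exact: addrA. Qed.
Fact finadele_addC : commutative finadele_add.
Proof. by move=> x y; apply: finadele_eq => p; exact: addrC. Qed.
Fact finadele_add0 : left_id finadele0 finadele_add.
Proof. by move=> x; apply: finadele_eq => p; exact: add0r. Qed.
Fact finadele_addN : left_inverse finadele0 finadele_opp finadele_add.
Proof. by move=> x; apply: finadele_eq => p; exact: addNr. Qed.
HB.instance Definition _ := GRing.isZmodule.Build finadele
  finadele_addA finadele_addC finadele_add0 finadele_addN.

Fact finadele_mulA : associative finadele_mul.
Proof. by move=> x y z; apply: finadele_eq => p; exact: mulrA. Qed.
Fact finadele_mulC : commutative finadele_mul.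
Proof. by move=> x y; apply: finadele_eq => p; exact: mulrC. Qed.
Fact finadele_mul1 : left_id finadele1 finadele_mul.
Proof. by move=> x; apply: finadele_eq => p; exact: mul1r. Qed.
Fact finadele_mulD : left_distributive finadele_mul +%R.
Proof. by move=> x y z; apply: finadele_eq => p; exact: mulrDl. Qed.
Fact finadele1_neq0 : finadele1 != 0.
Proof.
apply/eqP => /(congr1 (fun x : finadele => x (@PrimeN 2 isT))) /eqP.
by rewrite /= oner_eq0.
Qed.
HB.instance Definition _ := GRing.Zmodule_isComNzRing.Build finadele
  finadele_mulA finadele_mulC finadele_mul1 finadele_mulD finadele1_neq0.

Lemma component0 p : (0 : finadele) p = 0. Proof. by []. Qed.
Lemma componentD x y p : (x + y) p = x p + y p. Proof. by []. Qed.
Lemma componentN x p : (- x) p = - x p. Proof. by []. Qed.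
Lemma component1 p : (1 : finadele) p = 1. Proof. by []. Qed.
Lemma componentM x y p : (x * y) p = x p * y p. Proof. by []. Qed.

(* The restricted product topology: the products of open sets U p, all but    *)
(* finitely many of which are Z_p, form a base.                               *)
Definition finadele_open (O : set finadele) :=
  forall x, O x -> exists U : forall p, set (padic p),
    [/\ forall p, open (U p),
        finite_set [set p | U p <> @padic_int p],
        forall p, U p (x p) &
        [set y : finadele | forall p, U p (y p)] `<=` O].

Fact finadele_openT : finadele_open setT.
Proof.
move=> x _.
exists (fun p => if pselect (padic_int (x p)) then @padic_int p else setT).
split => //.
- move=> p; case: pselect => h /=; last exact: openT.
  by rewrite -(padic_ball0 (@padic_int0 p)); exact: padic_ball_open.
- by apply: sub_finite_set (finadeleP x) => p /=; case: pselect.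
- by move=> p; case: pselect.
Qed.

Fact finadele_openI : setI_closed finadele_open.
Proof.
move=> A B oA oB x [/oA[U [oU fU Ux UA]] /oB[V [oV fV Vx VB]]].
exists (fun p => U p `&` V p); split.
- by move=> p; exact: openI.
- have : finite_set
      ([set p | U p <> @padic_int p] `|` [set p | V p <> @padic_int p]).
    by rewrite finite_setU.
  apply: sub_finite_set => p /= UV; apply/not_andP => -[UZ VZ].
  by apply: UV; rewrite UZ VZ setIid.
- by move=> p; split; [exact: Ux|exact: Vx].
- by move=> y UVy; split; [apply: UA|apply: VB] => p; have [] := UVy p.
Qed.

Fact finadele_open_bigcup (I : Type) (U : I -> set finadele) :
  (forall i, finadele_open (U i)) -> finadele_open (\bigcup_i U i).
Proof.
move=> oU x [i _ /oU[V [oV fV Vx VU]]]; exists V; split => // y /VU Uy.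
by exists i.
Qed.

HB.instance Definition _ := isOpenTopological.Build finadele
  finadele_openT finadele_openI finadele_open_bigcup.

Lemma finadele_openE (U : set finadele) : open U <-> finadele_open U.
Proof. by []. Qed.

HB.instance Definition _ := isPointed.Build finadele 0.

Definition finadele_display : measure_display := sigma_display (@open finadele).

HB.instance Definition _ := @isMeasurable.Build finadele_display finadele
  <<s (@open finadele) >> (@sigma_algebra0 _ setT (@open finadele))
  (@sigma_algebraC _ (@open finadele))
  (@sigma_algebra_bigcup _ setT (@open finadele)).

Definition Zhat : set finadele := [set x | forall p, padic_int (x p)].

Definition finadele_ball x (k : primeN -> nat) : set finadele :=
  [set y | forall p, padic_ball (x p) (k p) (y p)].

Lemma finadele_ball_refl x k : finadele_ball x k x.
Proof. by move=> p; exact: padic_ball_refl. Qed.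

Lemma finadele_ball_open x k :
  finite_set [set p | k p <> 0%N] -> open (finadele_ball x k).
Proof.
move=> fk; apply/finadele_openE => y xy.
exists (fun p => padic_ball (x p) (k p)); split => //.
- by move=> p; exact: padic_ball_open.
- have : finite_set ([set p | k p <> 0%N] `|` [set p | ~ padic_int (x p)]).
    by rewrite finite_setU; split => //; exact: finadeleP.
  apply: sub_finite_set => p /= h; apply/not_andP => -[k0 Zx].
  by apply: h; rewrite k0 padic_ball0.
Qed.

Lemma nbhs_finadele x (U : set finadele) : nbhs x U <->
  exists2 k, finite_set [set p | k p <> 0%N] & finadele_ball x k `<=` U.
Proof.
split => [|[k fk kU]]; last first.
  apply: filterS kU _; apply: open_nbhs_nbhs; split.
    exact: finadele_ball_open.
  exact: finadele_ball_refl.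
rewrite nbhsE => -[W [oW Wx] WU].
have [V [oV fV Vx VO]] := (finadele_openE W).1 oW x Wx.
have /choice[k kV] (p : primeN) : exists k, (V p = @padic_int p -> k = 0%N) /\
    padic_ball (x p) k `<=` V p.
  have [VZ|VZ] := pselect (V p = @padic_int p).
    by exists 0%N; split => //; rewrite padic_ball0 ?VZ// -VZ.
  by have [k kV] := oV p _ (Vx p); exists k; split.
exists k.
  apply: sub_finite_set fV => p /= k0 VZ; apply: k0.
  by have [->] := kV p.
by move=> y ky; apply/WU/VO => p; have [_] := kV p; apply; exact: ky.
Qed.

Lemma finadele_add_continuous :
  continuous (fun z : finadele * finadele => z.1 + z.2).
Proof.
move=> [x y] U /= /nbhs_finadele[k fk kU].
exists (finadele_ball x k, finadele_ball y k) => /=.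
  by split; apply/nbhs_finadele; exists k.
move=> [s t] /= [xs yt]; apply: kU => p.
have [a _ sE] := xs p; have [b _ tE] := yt p.
by exists (a + b) => //; rewrite !componentD -sE -tE mulrDr tofracD addrACA.
Qed.

Lemma finadele_opp_continuous : continuous (fun z : finadele => - z).
Proof.
move=> x U /= /nbhs_finadele[k fk kU].
apply/nbhs_finadele; exists k => // y xy; apply: kU => p.
have [a _ yE] := xy p.
by exists (- a) => //; rewrite /= -yE mulrN tofracN opprD.
Qed.

Lemma Zhat_ball : Zhat = finadele_ball 0 (fun=> 0%N).
Proof.
by apply/seteqP; split => x Zx p; have := Zx p; rewrite padic_ball0//;
  exact: padic_int0.
Qed.

Lemma Zhat_open : open Zhat.
Proof.
rewrite Zhat_ball; apply: finadele_ball_open.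
by rewrite (_ : mkset _ = set0)//; apply/seteqP; split.
Qed.

End FiniteAdeles.

Section PadicDivision.
Variable p : primeN.
Implicit Types x y z : zpadic p.

Lemma val_natZ n k : nat_of_ord (n%:R : 'Z_(p ^ k.+1)) = (n %% p ^ k.+1)%N.
Proof. exact (val_Zp_nat (modulus_gt1 p k) n). Qed.

Lemma residue_nat n k : residue (n%:R : zpadic p) k = n%:R.
Proof. by elim: n => [//|n IH]; rewrite -!natr1 residueD IH. Qed.

Lemma residue_eqmod k (a b : 'Z_(p ^ k.+1)) :
  a = b %[mod p ^ k.+1] -> a = b.
Proof. by rewrite !modn_small ?ltn_modulus// => /val_inj. Qed.

Lemma zpadic_divp x k :
  residue x k = 0 -> exists y, x = p%:R ^+ k.+1 * y.
Proof.
move=> xk.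
have q0 : (0 < p ^ k.+1)%N by rewrite expn_gt0 ltnW ?primeN_gt1.
have dx j : (p ^ k.+1 %| residue x (k.+1 + j))%N.
  by rewrite /dvdn (@residue_le p x k) ?xk ?mod0n// addSn ltnW// ltnS leq_addr.
pose q j := (residue x (k.+1 + j) %/ p ^ k.+1)%N.
have qE j : (p ^ k.+1 * q j)%N = residue x (k.+1 + j).
  by rewrite mulnC divnK.
have qP : compatible (fun j => (q j)%:R : 'Z_(p ^ j.+1)).
  move=> j; rewrite !val_natZ modn_dvdm ?modulus_dvd// modn_mod; apply/eqP.
  rewrite -(eqn_pmul2l q0) !muln_modr !qE -expnD addnS addSn.
  by apply/eqP; exact: residueP.
exists (Zpadic qP); apply: zpadicP => j; apply: residue_eqmod.
rewrite residueM mod_mulZ// -natrX residue_nat !val_natZ modnMm qE.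
by rewrite (@residue_le p x j)// leq_addl.
Qed.

Lemma tofrac_inj : injective (@tofrac (zpadic p)).
Proof. by move=> x y /eqP; rewrite tofrac_eq => /eqP. Qed.

Lemma padic_ball_residue x y k :
  residue x k = residue y k -> padic_ball (tofrac x) k (tofrac y).
Proof.
move=> xy; have : residue (y - x) k = 0 by rewrite residueD residueN xy subrr.
move=> /zpadic_divp[z zE]; exists (p%:R * z) => //.
by rewrite mulrA -exprSr -zE tofracB addrC subrK.
Qed.

End PadicDivision.

Section CompactOpenSubgroups.

Lemma Zhat_compact : compact Zhat.
Proof.
rewrite compact_ultra => F FU FZ.
have FP : ProperFilter F := @ultra_proper _ _ FU.
have FF : Filter F := @filter_filter _ _ FP.
pose B (p : primeN) k (r : 'Z_(p ^ k.+1)) : set finadele :=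
  [set x | exists2 z, x p = tofrac z & residue z k = r].
have FB (pk : {p : primeN & nat}) : exists r, F (B (tag pk) (tagged pk) r).
  case: pk => p k /=; apply: contrapT => /forallNP nF.
  have : F [set x | forall r, ~ B p k r x].
    apply: (@filter_forall _ _ (fun r => ~` B p k r)) => r.
    by have [|//] := in_ultra_setVsetC (B p k r) FU => /nF.
  move=> /(filterI FZ)/filter_ex[x [Zx]] /=.
  by have [z _ zE] := Zx p => /(_ (residue z k)); apply; exists z.
have {FB} FB p k : {r | F (B p k r)} by apply: cid; exact: (FB (Tagged _ k)).
pose r p k := projT1 (FB p k).
have rP p : compatible (r p).
  move=> k.
  have [x [[z xz zr] [t xt tr]]] :=
    filter_ex (filterI (projT2 (FB p k)) (projT2 (FB p k.+1))).
  have tz : t = z by apply: tofrac_inj; rewrite -xz -xt.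
  rewrite -/(r p k.+1) -/(r p k) in zr tr *.
  by rewrite -zr -tr tz; exact: residueP.
have xP p : padic_int (tofrac (Zpadic (rP p))) by eexists.
exists (FinAdele (finadele_finZ xP)); split => //.
move=> U /nbhs_finadele[k fk kU]; apply: filterS kU _.
have /finite_fsetP[D DE] := fk.
have : F (Zhat `&` \bigcap_(p in [set` D]) B p (k p) (r p (k p))).
  apply: filterI => //; apply: filter_bigI => p _.
  exact: projT2 (FB p (k p)).
apply: filterS => y [Zy By] p /=.
have [kp0|kp0] := pselect (k p = 0%N).
  by rewrite kp0 padic_ball0//; exact: xP.
have /By[z -> zr] : [set` D] p by rewrite -DE.
by apply: padic_ball_residue.
Qed.

Definition compact_open_subgroup (H : set finadele) :=
  [/\ compact H, open H, H 0 & forall x y, H x -> H y -> H (x - y)].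

Lemma Zhat_subgroup : compact_open_subgroup Zhat.
Proof.
split; [exact: Zhat_compact|exact: Zhat_open|by move=> p; exact: padic_int0|].
by move=> x y Zx Zy p; apply: padic_intD => //; exact: padic_intN.
Qed.

Lemma compact_open_subgroupN H x : compact_open_subgroup H -> H x -> H (- x).
Proof. by case=> _ _ H0 HB Hx; rewrite -sub0r; exact: HB. Qed.

Lemma compact_open_subgroupD H x y :
  compact_open_subgroup H -> H x -> H y -> H (x + y).
Proof.
move=> Hs Hx /(compact_open_subgroupN Hs) Hy; rewrite -[y]opprK.
by case: Hs => _ _ _; exact.
Qed.

Lemma finadele_shift_continuous y : continuous (fun x : finadele => x - y).
Proof.
move=> x U /= /nbhs_finadele[k fk kU].
apply/nbhs_finadele; exists k => // z xz; apply: kU => p.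
by have [a _ zE] := xz p; exists a => //; rewrite /= -zE addrAC.
Qed.

Lemma compact_open_subgroup_closed H : compact_open_subgroup H -> closed H.
Proof.
move=> [_ oH H0 HB] x xH.
have : nbhs x [set y | H (y - x)].
  by apply: finadele_shift_continuous; rewrite subrr; exact: open_nbhs_nbhs.
by move=> /xH[y [Hy Hyx]]; rewrite -(subKr y x); exact: HB.
Qed.

Lemma compact_open_subgroupI H K : compact_open_subgroup H ->
  compact_open_subgroup K -> compact_open_subgroup (H `&` K).
Proof.
move=> Hs Ks; have cK := compact_open_subgroup_closed Ks.
case: Hs Ks => cH oH H0 HB [_ oK K0 KB]; split.
- exact: compact_closedI.
- exact: openI.
- by [].
- by move=> x y [Hx Kx] [Hy Ky]; split; [exact: HB|exact: KB].
Qed.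

Lemma compact_open_subgroup_sum H K : compact_open_subgroup H ->
  compact_open_subgroup K ->
  compact_open_subgroup [set z.1 + z.2 | z in H `*` K].
Proof.
move=> [cH oH H0 HB] [cK oK K0 KB]; split.
- apply: continuous_compact; last exact: compact_setX.
  by apply: continuous_subspaceT; exact: finadele_add_continuous.
- rewrite openE => _ [[x y] [/= Hx Ky] <-].
  apply: (@filterS _ _ _ [set z | H (z - y)]).
    by move=> z /= Hz; exists (z - y, y); rewrite //= subrK.
  by apply: finadele_shift_continuous; rewrite addrK; exact: open_nbhs_nbhs.
- by exists (0, 0) => //=; rewrite addr0.
- move=> _ _ [[a b] [/= Ha Kb] <-] [[c d] [/= Hc Kd] <-].
  exists (a - c, b - d); first by split; [exact: HB|exact: KB].
  by rewrite /= opprD addrACA.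
Qed.

End CompactOpenSubgroups.

Section Adeles.
Variable R : realType.

Definition adele := (R * finadele)%type.

HB.instance Definition _ := GRing.ComNzRing.on adele.

(* The rational number picked by xget is unique: Q :&: Zhat is the ring of    *)
(* integers.                                                                  *)
Definition frac_part (x : finadele) : rat :=
  xget 0 [set q : rat | 0 <= q < 1 /\ forall p, padic_int (x p - ratr q)].

Definition chi (x : adele) : R[i] :=
  let t := 2 * pi * (- x.1 + ratr (frac_part x.2)) in (cos t +i* sin t)%C.

Definition normalized_haar (mu : set finadele -> \bar R) :=
  (forall (x : finadele) (A : set finadele), measurable A ->
     mu [set x + y | y in A] = mu A) /\
  mu Zhat = 1%E.

End Adeles.

Section ComplexIntegral.
Context d (T : measurableType d) (R : realType).
Variable mu : {measure set T -> \bar R}.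
Implicit Type f : T -> R[i].

Definition cintegrable f :=
  mu.-integrable setT (fun x => (complex.Re (f x))%:E) /\
  mu.-integrable setT (fun x => (complex.Im (f x))%:E).

Definition cintegral f : R[i] :=
  ((\int[mu]_x complex.Re (f x)) +i* (\int[mu]_x complex.Im (f x)))%C.

End ComplexIntegral.

(* A Haar measure on the finite adeles is sigma-finite, this group being      *)
(* sigma-compact, so that its product with the Lebesgue measure makes sense.  *)
Definition adele_haar (R : realType)
    (mu : {sigma_finite_measure set finadele -> \bar R}) :=
  (lebesgue_measure \x mu)%E.

HB.instance Definition _ (R : realType)
    (mu : {sigma_finite_measure set finadele -> \bar R}) :=
  Measure.on (adele_haar mu).

(* phi and its transform take values in R[i], the codomain R[i]^o used below  *)
(* being the same type seen as a module over itself.                          *)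
Definition fourier (R : realType)
    (mu : {sigma_finite_measure set finadele -> \bar R})
    (phi : adele R -> R[i]) (xi : adele R) : R[i] :=
  cintegral (adele_haar mu) (fun x : adele R => phi x * chi (xi * x)).

Section SchwartzFunctions.
Variable R : realType.
Implicit Types f g : R -> R[i].

Definition smooth f := forall n t,
  derivable (derive1n n (fun s => complex.Re (f s))) t 1 /\
  derivable (derive1n n (fun s => complex.Im (f s))) t 1.

Definition cderiven n f (t : R) : R[i] :=
  (derive1n n (fun s => complex.Re (f s)) t +i*
   derive1n n (fun s => complex.Im (f s)) t)%C.

Definition schwartz_values m n f : set R :=
  [set `|t| ^+ m * Normc.normc (cderiven n f t) | t in [set: R]].

Definition schwartz_seminorm m n f : R := sup (schwartz_values m n f).

Definition schwartz f :=
  smooth f /\ forall m n, has_ubound (schwartz_values m n f).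

Lemma derive1nD n (u v : R -> R) :
  (forall k t, derivable (derive1n k u) t 1) ->
  (forall k t, derivable (derive1n k v) t 1) ->
  derive1n n (u \+ v) = derive1n n u \+ derive1n n v.
Proof.
move=> du dv; elim: n => [//|n IH].
rewrite !derive1nS IH; apply/funext => t.
by rewrite /= derive1E deriveD ?derive1E.
Qed.

Lemma derive1nZ n (c : R) (u : R -> R) :
  (forall k t, derivable (derive1n k u) t 1) ->
  derive1n n (c \*: u) = c \*: derive1n n u.
Proof.
move=> du; elim: n => [//|n IH].
rewrite !derive1nS IH; apply/funext => t.
by rewrite /= derive1E deriveZ ?derive1E.
Qed.

Let ReZD (a : R[i]) f g : (fun s => complex.Re (a * f s + g s)) =
  (complex.Re a \*: (fun s => complex.Re (f s))) \+
  ((- complex.Im a) \*: (fun s => complex.Im (f s))) \+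
  (fun s => complex.Re (g s)).
Proof.
apply/funext => s /=; case: a (f s) (g s) => [a b] [c d] [e h] /=.
by rewrite -mulNr.
Qed.

Let ImZD (a : R[i]) f g : (fun s => complex.Im (a * f s + g s)) =
  (complex.Re a \*: (fun s => complex.Im (f s))) \+
  (complex.Im a \*: (fun s => complex.Re (f s))) \+
  (fun s => complex.Im (g s)).
Proof. by apply/funext => s /=; case: a (f s) (g s) => [a b] [c d] [e h]. Qed.

Lemma smoothZD (a : R[i]) f g : smooth f -> smooth g ->
  smooth (fun t => a * f t + g t) /\
  forall n t, cderiven n (fun t => a * f t + g t) t =
    a * cderiven n f t + cderiven n g t.
Proof.
move=> sf sg.
have dfR k t := (sf k t).1; have dfI k t := (sf k t).2.
have dgR k t := (sg k t).1; have dgI k t := (sg k t).2.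
have dZ c (u : R -> R) : (forall k t, derivable (derive1n k u) t 1) ->
    forall k t, derivable (derive1n k (c \*: u)) t 1.
  by move=> du k t; rewrite derive1nZ//; exact: derivableZ.
have dD (u v : R -> R) : (forall k t, derivable (derive1n k u) t 1) ->
    (forall k t, derivable (derive1n k v) t 1) ->
    forall k t, derivable (derive1n k (u \+ v)) t 1.
  by move=> du dv k t; rewrite derive1nD//; exact: derivableD.
have sR1 := dZ (complex.Re a) _ dfR; have sR2 := dZ (- complex.Im a) _ dfI.
have sI1 := dZ (complex.Re a) _ dfI; have sI2 := dZ (complex.Im a) _ dfR.
have sR := dD _ _ sR1 sR2; have sI := dD _ _ sI1 sI2.
split=> n t.
  rewrite ReZD ImZD; split; first exact: (dD _ _ sR dgR).
  exact: (dD _ _ sI dgI).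
rewrite /cderiven ReZD ImZD (derive1nD n sR dgR) (derive1nD n sI dgI).
rewrite (derive1nD n sR1 sR2) (derive1nD n sI1 sI2).
rewrite (derive1nZ n _ dfR) (derive1nZ n _ dfI) (derive1nZ n _ dfR).
rewrite (derive1nZ n _ dfI) /= scaleNr.
by case: a {sR1 sR2 sI1 sI2 sR sI}.
Qed.

Lemma schwartzZD (a : R[i]) f g : schwartz f -> schwartz g ->
  schwartz (fun t => a * f t + g t).
Proof.
move=> [sf bf] [sg bg]; have [sm dE] := smoothZD a sf sg; split => // m n.
have [M /ubP MP] := bf m n; have [N /ubP NP] := bg m n.
exists (Normc.normc a * M + N) => _ [t _ <-]; rewrite dE.
have := @le_normcD R (a * cderiven n f t) (cderiven n g t).
move=> /(ler_wpM2l (exprn_ge0 m (normr_ge0 t))) /le_trans; apply.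
rewrite mulrDr lerD//; last by apply: NP; exists t.
rewrite Normc.normcM mulrCA ler_wpM2l ?sqrtr_ge0//.
  by case: (a) => ? ?; exact: sqrtr_ge0.
by apply: MP; exists t.
Qed.

Lemma schwartz0 : schwartz (fun=> 0).
Proof.
have d0 n : derive1n n (fun=> 0 : R) = (fun=> 0).
  elim: n => [//|n IH]; rewrite derive1nS IH; apply/funext => t.
  exact: derive1_cst.
split=> [n t|m n] /=; first by rewrite d0; split; exact: derivable_cst.
exists 0 => _ [t _ <-]; rewrite /cderiven /= d0.
by rewrite expr0n /= addr0 sqrtr0 mulr0.
Qed.

End SchwartzFunctions.

Section BruhatSchwartz.
Variable R : realType.
Implicit Types (phi psi : adele R -> R[i]^o) (H K : set finadele).

Definition bs_step H K : set (adele R -> R[i]^o) :=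
  [set phi | [/\ forall x, ~ H x.2 -> phi x = 0,
                 forall x k, K k -> phi (x + (0, k)) = phi x &
                 forall a, H a -> schwartz (fun t => phi (t, a))]].

Definition bs_index H K :=
  [/\ compact_open_subgroup H, compact_open_subgroup K & K `<=` H].

Definition bruhat_schwartz : {pred adele R -> R[i]^o} :=
  [pred phi | `[< exists H K, bs_index H K /\ bs_step H K phi >]].

Lemma bs_step_mono H K H' K' : H `<=` H' -> K' `<=` K ->
  bs_step H K `<=` bs_step H' K'.
Proof.
move=> HH' KK' phi [phi0 phiK phiS]; split.
- by move=> x H'x; apply: phi0 => /HH'.
- by move=> x k /KK'; exact: phiK.
- move=> a _; have [Ha|Ha] := pselect (H a); first exact: phiS.
  rewrite (_ : (fun t => _) = (fun=> 0)); first exact: schwartz0.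
  by apply/funext => t; exact: phi0.
Qed.

Lemma bs_step_lin H K a phi psi : bs_step H K phi -> bs_step H K psi ->
  bs_step H K (a *: phi + psi).
Proof.
move=> [phi0 phiK phiS] [psi0 psiK psiS]; split.
- move=> x Hx; rewrite -[LHS]/(a * phi x + psi x) phi0// psi0//.
  by rewrite mulr0 addr0.
- move=> x k Kk; rewrite -[LHS]/(a * phi (x + (0, k)) + psi (x + (0, k))).
  by rewrite phiK// psiK.
- by move=> b Hb; apply: schwartzZD; [exact: phiS|exact: psiS].
Qed.

Lemma bs_step0 H K : bs_step H K 0.
Proof. by split => // a _; exact: schwartz0. Qed.

Lemma bruhat_schwartz_submod : submod_closed bruhat_schwartz.
Proof.
split.
  apply/asboolP; exists Zhat, Zhat; split; last exact: bs_step0.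
  by split => //; exact: Zhat_subgroup.
move=> a phi psi /asboolP[H [K [[cH cK KH] phiP]]].
move=> /asboolP[H' [K' [[cH' cK' KH'] psiP]]]; apply/asboolP.
have HS : H `<=` [set z.1 + z.2 | z in H `*` H'].
  move=> x Hx; exists (x, 0); rewrite /= ?addr0//; split => //=.
  by case: cH'.
have H'S : H' `<=` [set z.1 + z.2 | z in H `*` H'].
  move=> x Hx; exists (0, x); rewrite /= ?add0r//; split => //=.
  by case: cH.
exists [set z.1 + z.2 | z in H `*` H'], (K `&` K'); split.
  split; first exact: compact_open_subgroup_sum.
    exact: compact_open_subgroupI.
  by move=> x [/KH /HS].
by apply: bs_step_lin; [apply: bs_step_mono phiP|apply: bs_step_mono psiP] =>
  // x [].
Qed.

HB.instance Definition _ :=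
  GRing.isSubmodClosed.Build R[i] (adele R -> R[i]^o) bruhat_schwartz
    bruhat_schwartz_submod.

Record bsfun := BSFun {
  bs_val :> adele R -> R[i]^o ; bs_valP : bs_val \in bruhat_schwartz }.

HB.instance Definition _ := [isSub for bs_val].
HB.instance Definition _ := [Choice of bsfun by <:].
HB.instance Definition _ := [SubChoice_isSubLmodule of bsfun by <:].

(* A fundamental system of neighbourhoods of zero in bs_step H K, which is    *)
(* the direct sum of copies of the Schwartz space indexed by the finite       *)
(* quotient H / K: only finitely many of the sections of phi are distinct.    *)
Definition bs_step_ball H K (N : nat) (e : R) : set bsfun :=
  [set phi : bsfun | bs_step H K phi /\
     forall a m n, H a -> (m <= N)%N -> (n <= N)%N ->
     schwartz_seminorm m n (fun t => phi (t, a)) < e].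

Definition absolutely_convex (U : set bsfun) :=
  forall (a b : R[i]) (phi psi : bsfun), Normc.normc a + Normc.normc b <= 1 ->
    U phi -> U psi -> U (a *: phi + b *: psi).

(* The inductive limit topology is the finest locally convex one for which    *)
(* the inclusions of the spaces bs_step H K are continuous: an absolutely     *)
(* convex set is a neighbourhood of zero when it contains a neighbourhood of  *)
(* zero of each of these spaces.                                              *)
Definition bs_nbhs0 (U : set bsfun) := absolutely_convex U /\
  forall H K, bs_index H K ->
    exists N e, 0 < e /\ bs_step_ball H K N e `<=` U.

Definition bs_open (W : set bsfun) := forall phi : bsfun, W phi ->
  exists2 U, bs_nbhs0 U & forall psi : bsfun, U psi -> W (phi + psi).

Fact bs_openT : bs_open setT.
Proof.
move=> phi _; exists setT => //; split => // H K _.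
by exists 0%N, 1; rewrite ltr01.
Qed.

Fact bs_openI : setI_closed bs_open.
Proof.
move=> V W oV oW phi [/oV[A [cA nA] AV] /oW[B [cB nB] BW]].
exists (A `&` B); last by move=> psi [/AV ? /BW].
split=> [a b f g ab [Af Bf] [Ag Bg]|H K HK].
  by split; [exact: cA|exact: cB].
have [N [e [e0 NA]]] := nA _ _ HK; have [M [h [h0 MB]]] := nB _ _ HK.
exists (maxn N M), (Num.min e h); split; first by rewrite lt_min e0.
move=> psi [psiHK psie]; split; [apply: NA|apply: MB]; split => // a m n Ha.
  move=> mN nN; have := psie a m n Ha.
  by rewrite !leq_max mN nN lt_min => /(_ isT isT)/andP[].
move=> mN nN; have := psie a m n Ha.
by rewrite !leq_max mN nN !orbT lt_min => /(_ isT isT)/andP[].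
Qed.

Fact bs_open_bigcup (I : Type) (W : I -> set bsfun) :
  (forall i, bs_open (W i)) -> bs_open (\bigcup_i W i).
Proof.
move=> oW phi [i _ /oW[U nU UW]]; exists U => // psi /UW Wpsi.
by exists i.
Qed.

HB.instance Definition _ := isOpenTopological.Build bsfun
  bs_openT bs_openI bs_open_bigcup.

End BruhatSchwartz.

(* Main.v *)
From HB Require Import structures.
Require Import Defs.
From mathcomp Require Import all_boot all_order all_algebra.
From mathcomp Require Import all_classical all_reals all_analysis.
From mathcomp.real_closed Require Import complex.
From mathcomp Require Import fraction.
From mathcomp Require generic_quotient.
From mathcomp Require Import measurable_realfun ring lra.
Import Order.TTheory GRing.Theory Num.Theory.
Import numFieldNormedType.Exports.
Local Open Scope classical_set_scope.
Local Open Scope ring_scope.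

(* The Fourier transform on the adeles reduces to the one on R and to the     *)
(* discrete Fourier transform. The subgroups n Zhat and n^-1 Zhat are cofinal *)
(* among the compact open subgroups of the finite adeles, so every function   *)
(* of the Bruhat-Schwartz space is supported in R x n^-1 Zhat and invariant   *)
(* under {0} x n Zhat for some n > 0. The quotient of n^-1 Zhat by n Zhat is  *)
(* represented by the rationals j / n with j < n^2, and integration over the  *)
(* adeles becomes n^-1 times the sum over j of integrals over R. These two    *)
(* subgroups being dual to each other, the transform preserves that level; it *)
(* is the transform on R combined with a discrete Fourier transform of length *)
(* n^2, so that inversion and Parseval's equality follow from their analogues *)
(* on R and from the orthogonality of the characters of Z / n^2.              *)
(* Over R, inversion is obtained by inserting the Gaussian                    *)
(* exp (- 2 pi^2 r^2 t^2), whose transform is the normal density of standard  *)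
(* deviation r: the two sides then differ by O(r), and r is arbitrary.        *)
(* Applying the transform twice reflects the argument, hence the cube of the  *)
(* transform is its inverse, and continuity is needed for the transform only. *)

Set Implicit Arguments.
Unset Strict Implicit.
Unset Printing Implicit Defensive.

(** The work is done at a fixed level [n], on functions supported in [VZ n] and invariant under
    [UZ n]. There [cintegral_adele] turns an adelic integral into a finite sum of real integrals.
    The character factors through [chif] on the finite adeles ([chiE]), and [chif] is an additive
    character whose kernel is exactly [Zhat] ([chifD], [chif_Zhat], [chif_eq1]). Hence
    [fourier_levelE] expresses the transform on [VZ n] by the real transforms [FT] of the sections,
    [fourier_eq0] shows that it vanishes elsewhere, and [fourier_bs_levelZ] concludes that the level
    is preserved.

    On the real line, Fubini's theorem gives the multiplication formula [FT_multiplication]. Applied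
    to Gaussians it yields [FT_inversion], and applied to a conjugate transform it then yields
    [FT_parseval]. The orthogonality relation [sum_chif] carries both results to the adeles, in
    [fourier_inversion_level] and [parseval_level].

    For continuity, [FT_sbound] controls the seminorms of [FT f] up to order [N] by those of [f] up
    to order [2 + 2 N], and [fourier_sbound] extends this to a whole level. Since the levels are
    cofinal ([bs_level]), [bs_continuous] makes this suffice for the inductive limit topology. *)

Local Notation Re := complex.Re.
Local Notation Im := complex.Im.
Local Notation normc := Normc.normc.
Local Notation leb := lebesgue_measure.

(** * Integration of complex functions *)

Section ComplexParts.
Variable R : realType.
Implicit Types z w : R[i].

Lemma ReD z w : Re (z + w) = Re z + Re w. Proof. by case: z w => [? ?] [? ?]. Qed.
Lemma ImD z w : Im (z + w) = Im z + Im w. Proof. by case: z w => [? ?] [? ?]. Qed.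
Lemma ReN z : Re (- z) = - Re z. Proof. by case: z. Qed.
Lemma ImN z : Im (- z) = - Im z. Proof. by case: z. Qed.
Lemma ReM z w : Re (z * w) = Re z * Re w - Im z * Im w.
Proof. by case: z w => [? ?] [? ?]. Qed.
Lemma ImM z w : Im (z * w) = Re z * Im w + Im z * Re w.
Proof. by case: z w => [? ?] [? ?]. Qed.
Lemma Re_conjc z : Re (conjc z) = Re z. Proof. by case: z. Qed.
Lemma Im_conjc z : Im (conjc z) = - Im z. Proof. by case: z. Qed.

Lemma conjcM z w : conjc (z * w) = conjc z * conjc w.
Proof. exact: rmorphM. Qed.

Lemma conjc_sum (I : Type) (r : seq I) (F : I -> R[i]) :
  conjc (\sum_(i <- r) F i) = \sum_(i <- r) conjc (F i).
Proof. exact: rmorph_sum. Qed.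

Lemma conjc_natV n : conjc (n%:R^-1) = n%:R^-1 :> R[i].
Proof.
have conjV : {morph (@conjc R) : z / z^-1} by exact: fmorphV.
have conj_nat : conjc n%:R = n%:R :> R[i] by exact: rmorph_nat.
by rewrite conjV conj_nat.
Qed.

Lemma complex_eq z w : Re z = Re w -> Im z = Im w -> z = w.
Proof. by case: z w => [? ?] [? ?] /= -> ->. Qed.

Lemma normc_ge0 z : 0 <= normc z.
Proof. by case: z => a b; exact: sqrtr_ge0. Qed.

Lemma normcN z : normc (- z) = normc z.
Proof. by case: z => a b /=; rewrite !sqrrN. Qed.

Lemma normc_conjc z : normc (conjc z) = normc z.
Proof. by case: z => a b /=; rewrite sqrrN. Qed.

Lemma normcR (x : R) : normc (x%:C)%C = `|x|.
Proof. by rewrite /= expr0n /= addr0 sqrtr_sqr. Qed.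

Lemma normcD z w : normc (z + w) <= normc z + normc w.
Proof. exact: le_normcD. Qed.

Lemma Re_le_normc z : `|Re z| <= normc z.
Proof. by case: z => a b /=; rewrite -sqrtr_sqr ler_wsqrtr// lerDl sqr_ge0. Qed.

Lemma Im_le_normc z : `|Im z| <= normc z.
Proof. by case: z => a b /=; rewrite -sqrtr_sqr ler_wsqrtr// lerDr sqr_ge0. Qed.

Lemma normc_le_ReIm z : normc z <= `|Re z| + `|Im z|.
Proof.
case: z => a b /=; rewrite -[leRHS]ger0_norm ?addr_ge0// -sqrtr_sqr ler_wsqrtr//.
by rewrite sqrrD !real_normK ?num_real// addrAC lerDl mulrn_wge0// mulr_ge0.
Qed.

End ComplexParts.

Section ComplexIntegral.
Context d (T : measurableType d) (R : realType).
Variable mu : {measure set T -> \bar R}.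
Implicit Types f g : T -> R[i].

Definition cmeasurable f :=
  measurable_fun setT (fun x => Re (f x)) /\
  measurable_fun setT (fun x => Im (f x)).

Lemma cintegrable_measurable f : cintegrable mu f -> cmeasurable f.
Proof.
by move=> [fR fI]; split; apply/measurable_EFinP;
  [exact: measurable_int fR|exact: measurable_int fI].
Qed.

Lemma cmeasurableM f g : cmeasurable f -> cmeasurable g ->
  cmeasurable (fun x => f x * g x).
Proof.
move=> [fR fI] [gR gI]; split.
  under eq_fun do rewrite ReM.
  by apply: measurable_funB; exact: measurable_funM.
under eq_fun do rewrite ImM.
by apply: measurable_funD; exact: measurable_funM.
Qed.

Lemma cintegrable_le f (G : T -> R) : cmeasurable f ->
  mu.-integrable setT (EFin \o G) -> (forall x, normc (f x) <= G x) ->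
  cintegrable mu f.
Proof.
move=> [fR fI] intG fG; split; apply: le_integrable intG => //.
- exact/measurable_EFinP.
- by move=> x _ /=; rewrite lee_fin (le_trans (Re_le_normc _))//
    (le_trans (fG _))// ler_norm.
- exact/measurable_EFinP.
- by move=> x _ /=; rewrite lee_fin (le_trans (Im_le_normc _))//
    (le_trans (fG _))// ler_norm.
Qed.

Lemma cintegrable0 : cintegrable mu (fun=> 0).
Proof. by split; exact: integrable0. Qed.

Lemma cintegral0 : cintegral mu (fun=> 0) = 0.
Proof. by rewrite /cintegral /= /Rintegral integral0. Qed.

Lemma cintegrableD f g : cintegrable mu f -> cintegrable mu g ->
  cintegrable mu (fun x => f x + g x).
Proof.
move=> [fR fI] [gR gI]; split.
  under eq_fun do rewrite ReD EFinD.
  exact: integrableD.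
under eq_fun do rewrite ImD EFinD.
exact: integrableD.
Qed.

Lemma cintegralD f g : cintegrable mu f -> cintegrable mu g ->
  cintegral mu (fun x => f x + g x) = cintegral mu f + cintegral mu g.
Proof.
move=> [fR fI] [gR gI]; apply: complex_eq; rewrite ?ReD ?ImD /=.
  by under eq_Rintegral do rewrite ReD; rewrite RintegralD.
by under eq_Rintegral do rewrite ImD; rewrite RintegralD.
Qed.

Lemma cintegrableZ a f : cintegrable mu f -> cintegrable mu (fun x => a * f x).
Proof.
move=> [fR fI]; split.
  under eq_fun do rewrite ReM EFinB !EFinM.
  by apply: integrableB => //; exact: integrableZl.
under eq_fun do rewrite ImM EFinD !EFinM.
by apply: integrableD => //; exact: integrableZl.
Qed.

Lemma cintegralZ a f : cintegrable mu f ->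
  cintegral mu (fun x => a * f x) = a * cintegral mu f.
Proof.
move=> [fR fI].
have iZ (c : R) (u : T -> R) : mu.-integrable setT (fun x => (u x)%:E) ->
    mu.-integrable setT (EFin \o (fun x => c * u x)).
  by move=> iu; exact: (integrableZl measurableT c iu).
apply: complex_eq; rewrite ?ReM ?ImM /=.
  under eq_Rintegral do rewrite ReM.
  by rewrite RintegralB ?RintegralZl//; exact: iZ.
under eq_Rintegral do rewrite ImM.
by rewrite RintegralD ?RintegralZl//; exact: iZ.
Qed.

Lemma cintegrableB f g : cintegrable mu f -> cintegrable mu g ->
  cintegrable mu (fun x => f x - g x).
Proof.
move=> fi /(cintegrableZ (-1)) gi; under eq_fun do rewrite -mulN1r.
exact: cintegrableD.
Qed.

Lemma cintegralB f g : cintegrable mu f -> cintegrable mu g ->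
  cintegral mu (fun x => f x - g x) = cintegral mu f - cintegral mu g.
Proof.
move=> fi gi; have ngi := cintegrableZ (-1) gi.
under [in LHS]eq_fun do rewrite -mulN1r.
by rewrite cintegralD// cintegralZ// mulN1r.
Qed.

Lemma cintegrable_sum (I : Type) (r : seq I) (F : I -> T -> R[i]) :
  (forall i, cintegrable mu (F i)) ->
  cintegrable mu (fun x => \sum_(i <- r) F i x).
Proof.
move=> Fi; elim: r => [|i r IH].
  by under eq_fun do rewrite big_nil; exact: cintegrable0.
by under eq_fun do rewrite big_cons; exact: cintegrableD.
Qed.

Lemma cintegral_sum (I : Type) (r : seq I) (F : I -> T -> R[i]) :
  (forall i, cintegrable mu (F i)) ->
  cintegral mu (fun x => \sum_(i <- r) F i x) =
  \sum_(i <- r) cintegral mu (F i).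
Proof.
move=> Fi; elim: r => [|i r IH].
  by under eq_fun do rewrite big_nil; rewrite big_nil cintegral0.
under eq_fun do rewrite big_cons.
by rewrite cintegralD ?big_cons ?IH//; exact: cintegrable_sum.
Qed.

Lemma cintegral_conjc f : cintegrable mu f ->
  cintegral mu (fun x => conjc (f x)) = conjc (cintegral mu f).
Proof.
move=> [fR fI]; apply: complex_eq; rewrite ?Re_conjc ?Im_conjc /=.
  by under eq_Rintegral do rewrite Re_conjc.
under eq_Rintegral do rewrite Im_conjc -mulN1r.
by rewrite RintegralZl// mulN1r.
Qed.

(* The factor 2 comes from bounding the real and imaginary parts separately. *)
Lemma normc_cintegral_le f (G : T -> R) : cintegrable mu f ->
  mu.-integrable setT (EFin \o G) -> (forall x, normc (f x) <= G x) ->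
  normc (cintegral mu f) <= 2 * \int[mu]_x G x.
Proof.
move=> [fR fI] intG fG.
rewrite (le_trans (normc_le_ReIm _))//= mulr_natl mulr2n lerD//.
  rewrite (le_trans (le_normr_Rintegral _ _))// le_Rintegral//.
    by apply: integrable_abse fR.
  by move=> x _; rewrite (le_trans (Re_le_normc _)).
rewrite (le_trans (le_normr_Rintegral _ _))// le_Rintegral//.
  by apply: integrable_abse fI.
by move=> x _; rewrite (le_trans (Im_le_normc _)).
Qed.

End ComplexIntegral.

(** * Derivatives of complex functions and Schwartz seminorms *)

Section ComplexDerivative.
Variable R : realType.
Implicit Types f g : R -> R[i].

Definition is_cderiv f g := forall t : R,
  is_derive t (1 : R) (fun s => Re (f s)) (Re (g t)) /\
  is_derive t (1 : R) (fun s => Im (f s)) (Im (g t)).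

Lemma is_cderiv_cst (a : R[i]) : is_cderiv (fun=> a) (fun=> 0).
Proof. by move=> t; split; exact: is_derive_cst. Qed.

Lemma is_cderivD f f' g g' : is_cderiv f f' -> is_cderiv g g' ->
  is_cderiv (fun t => f t + g t) (fun t => f' t + g' t).
Proof.
move=> df dg t; have [fR fI] := df t; have [gR gI] := dg t; split.
  under eq_fun do rewrite ReD; rewrite ReD.
  exact: (is_deriveD fR gR).
under eq_fun do rewrite ImD; rewrite ImD.
exact: (is_deriveD fI gI).
Qed.

Lemma is_cderivM f f' g g' : is_cderiv f f' -> is_cderiv g g' ->
  is_cderiv (fun t => f t * g t) (fun t => f' t * g t + f t * g' t).
Proof.
move=> df dg t; have [fR fI] := df t; have [gR gI] := dg t; split.
  under eq_fun do rewrite ReM.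
  apply: is_derive_eq (is_deriveB (is_deriveM fR gR) (is_deriveM fI gI)) _.
  by rewrite ReD !ReM /GRing.scale /=; ring.
under eq_fun do rewrite ImM.
apply: is_derive_eq (is_deriveD (is_deriveM fR gI) (is_deriveM fI gR)) _.
by rewrite ImD !ImM /GRing.scale /=; ring.
Qed.

Lemma is_cderivZ a f f' : is_cderiv f f' ->
  is_cderiv (fun t => a * f t) (fun t => a * f' t).
Proof.
move=> /(is_cderivM (is_cderiv_cst a)) h.
by rewrite (_ : (fun t => a * f' t) = (fun t => 0 * f t + a * f' t))//;
  apply/funext => t; rewrite mul0r add0r.
Qed.

Lemma is_cderiv_real (u u' : R -> R) :
  (forall t, is_derive t (1 : R) u (u' t)) ->
  is_cderiv (fun t => (u t)%:C%C) (fun t => (u' t)%:C%C).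
Proof. by move=> du t; split => //=; exact: is_derive_cst. Qed.

Lemma is_cderiv_id : is_cderiv (fun t => t%:C%C) (fun=> 1).
Proof. by apply: (@is_cderiv_real id (fun=> 1)) => t; exact: is_derive_id. Qed.

Lemma is_cderiv_continuous f g : is_cderiv f g ->
  continuous (fun s => Re (f s)) /\ continuous (fun s => Im (f s)).
Proof.
move=> df; split => t; apply: differentiable_continuous; apply/derivable1_diffP.
  by have [[]] := df t.
by have [_ []] := df t.
Qed.

Lemma cderiven0 f : cderiven 0 f = f.
Proof. by apply/funext => t; apply: complex_eq. Qed.

(** Once every [F n.+1] is known to differentiate [F n], induction identifies all iterated
    derivatives. Smoothness and a closed form for the derivatives are thus obtained together, for
    products with [t] as well as for Fourier transforms. *)
Lemma smooth_seq (F : nat -> R -> R[i]) :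
  (forall n, is_cderiv (F n) (F n.+1)) ->
  smooth (F 0) /\ forall n, cderiven n (F 0) = F n.
Proof.
move=> dF.
have E n : derive1n n (fun s => Re (F 0 s)) = (fun s => Re (F n s)) /\
    derive1n n (fun s => Im (F 0 s)) = (fun s => Im (F n s)).
  elim: n => [//|n [IHR IHI]]; rewrite !derive1nS IHR IHI; split; apply/funext.
    by move=> t; rewrite derive1E; have [[_ ->]] := dF n t.
  by move=> t; rewrite derive1E; have [_ [_ ->]] := dF n t.
split=> [n t|n]; have [ER EI] := E n.
  by rewrite ER EI; have [[? _] [? _]] := dF n t.
by apply/funext => t; apply: complex_eq; rewrite /= ?ER ?EI.
Qed.

Lemma smooth_is_cderiv f n : smooth f ->
  is_cderiv (cderiven n f) (cderiven n.+1 f).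
Proof.
move=> sf t; have [dR dI] := sf n t.
by split; rewrite /cderiven /= derive1E; exact: derivableP.
Qed.

Lemma smooth_deriv f : smooth f ->
  smooth (cderiven 1 f) /\
  forall n, cderiven n (cderiven 1 f) = cderiven n.+1 f.
Proof.
move=> sf; apply: (@smooth_seq (fun n => cderiven n.+1 f)) => n.
exact: smooth_is_cderiv.
Qed.

(** Leibniz's rule, where the second derivative of [t] vanishes. The truncated predecessor is
    harmless at [n = 0], its coefficient being zero. *)
Lemma smooth_mulX f : smooth f ->
  smooth (fun t => t%:C%C * f t) /\
  forall n, cderiven n (fun t => t%:C%C * f t) =
    (fun t => t%:C%C * cderiven n f t + n%:R * cderiven n.-1 f t).
Proof.
move=> sf.
pose F n t := t%:C%C * cderiven n f t + n%:R * cderiven n.-1 f t.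
have F0 : F 0 = (fun t => t%:C%C * f t).
  by apply/funext => t; rewrite /F mul0r addr0 cderiven0.
rewrite -F0; apply: smooth_seq => n.
have d1 := is_cderivM is_cderiv_id (smooth_is_cderiv n sf).
have d2 := is_cderivZ n%:R (smooth_is_cderiv n.-1 sf).
have := is_cderivD d1 d2; congr (is_cderiv _ _).
apply/funext => t; rewrite /F -[n.+1%:R]natr1.
have -> : n%:R * cderiven n.-1.+1 f t = n%:R * cderiven n f t.
  by case: n {d1 d2} => [|n]//; rewrite !mul0r.
by rewrite -[n.+1.-1]/n; ring.
Qed.

(** A pointwise form of a common bound on the seminorms of orders at most [N]: unlike a supremum, it
    passes through sums, products and derivatives without any prior boundedness. *)
Definition sbound N (B : R) f := forall m n t, (m <= N)%N -> (n <= N)%N ->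
  `|t| ^+ m * normc (cderiven n f t) <= B.

Lemma sbound_le M N B f : (N <= M)%N -> sbound M B f -> sbound N B f.
Proof.
by move=> NM h m n t mN nN; apply: h; apply: leq_trans NM.
Qed.

Lemma seminorm_ub m n f t : schwartz f ->
  `|t| ^+ m * normc (cderiven n f t) <= schwartz_seminorm m n f.
Proof.
move=> [_ bf]; apply: ub_le_sup => //; by exists t.
Qed.

Lemma seminorm_ge0 m n f : schwartz f -> 0 <= schwartz_seminorm m n f.
Proof.
move=> sf; apply: le_trans (seminorm_ub m n 0 sf).
by rewrite mulr_ge0 ?normc_ge0// exprn_ge0.
Qed.

Lemma seminorm_le N B f m n : sbound N B f -> (m <= N)%N -> (n <= N)%N ->
  schwartz_seminorm m n f <= B.
Proof.
move=> h mN nN; apply: ge_sup.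
  by exists (`|0 : R| ^+ m * normc (cderiven n f 0)); exists 0.
by move=> _ [t _ <-]; exact: h.
Qed.

Lemma schwartzP f : schwartz f <-> smooth f /\ forall N, exists B, sbound N B f.
Proof.
split=> [sf|[sf bf]]; last first.
  split => // m n; have [B h] := bf (maxn m n); exists B => _ [t _ <-].
  by apply: h; rewrite ?leq_maxl ?leq_maxr.
split; first by case: sf.
move=> N; exists (\sum_(m < N.+1) \sum_(n < N.+1) schwartz_seminorm m n f).
move=> m n t mN nN; apply: le_trans (seminorm_ub m n t sf) _.
rewrite -ltnS in mN; rewrite -ltnS in nN.
rewrite (bigD1 (Ordinal mN))//= (bigD1 (Ordinal nN))//= -addrA lerDl.
rewrite addr_ge0 ?sumr_ge0// => i _; rewrite ?sumr_ge0// => *.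
  exact: seminorm_ge0.
exact: seminorm_ge0.
Qed.

(** In Leibniz's rule the first term costs one more power of [t], and the second one carries the
    coefficient [n <= N]; hence the factor [1 + N]. *)
Lemma sbound_mulX N B f : smooth f -> sbound N.+1 B f ->
  sbound N (N.+1%:R * B) (fun t => t%:C%C * f t).
Proof.
move=> sf h m n t mN nN; rewrite (smooth_mulX sf).2.
have t0 : 0 <= `|t| ^+ m by rewrite exprn_ge0.
apply: le_trans (ler_wpM2l t0 (normcD _ _)) _.
rewrite !Normc.normcM normcR mulrDr mulrA -exprSr -nat1r mulrDl mul1r lerD//.
  by apply: h => //; exact: leqW.
rewrite (_ : n%:R = (n%:R)%:C%C); last by rewrite rmorph_nat.
rewrite normcR normr_nat mulrCA ler_pM ?mulr_ge0 ?normc_ge0 ?ler_nat//.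
by apply: h; [exact: leqW|rewrite (leq_trans (leq_pred _))// leqW].
Qed.

Lemma sbound_deriv N B f : smooth f -> sbound N.+1 B f ->
  sbound N B (cderiven 1 f).
Proof.
by move=> sf h m n t mN nN; rewrite (smooth_deriv sf).2; apply: h => //; exact: leqW.
Qed.

Lemma sbound_ge0 N B f : sbound N B f -> 0 <= B.
Proof.
move=> /(_ 0 0 0 isT isT); rewrite expr0 mul1r; apply: le_trans.
exact: normc_ge0.
Qed.

Lemma schwartz_mulX f : schwartz f -> schwartz (fun t => t%:C%C * f t).
Proof.
move=> /schwartzP[sf bf]; apply/schwartzP; split.
  exact: (smooth_mulX sf).1.
by move=> N; have [B h] := bf N.+1; eexists; exact: (sbound_mulX sf h).
Qed.

Lemma schwartz_deriv f : schwartz f -> schwartz (cderiven 1 f).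
Proof.
move=> /schwartzP[sf bf]; apply/schwartzP; split.
  exact: (smooth_deriv sf).1.
by move=> N; have [B h] := bf N.+1; eexists; exact: (sbound_deriv sf h).
Qed.

Lemma schwartzD f g : schwartz f -> schwartz g -> schwartz (fun t => f t + g t).
Proof.
by move=> sf /(schwartzZD 1 sf); under eq_fun do rewrite mul1r.
Qed.

Lemma schwartzZ a f : schwartz f -> schwartz (fun t => a * f t).
Proof.
move=> sf; have := schwartzZD a sf (schwartz0 R).
by under eq_fun do rewrite addr0.
Qed.

Lemma schwartz_sum (I : Type) (r : seq I) (F : I -> R -> R[i]) :
  (forall i, schwartz (F i)) -> schwartz (fun t => \sum_(i <- r) F i t).
Proof.
move=> sF; elim: r => [|i r IH].
  by under eq_fun do rewrite big_nil; exact: schwartz0.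
by under eq_fun do rewrite big_cons; exact: schwartzD.
Qed.

Lemma smoothZ a f : smooth f ->
  smooth (fun t => a * f t) /\
  forall n t, cderiven n (fun t => a * f t) t = a * cderiven n f t.
Proof.
move=> sf; have [s0 _] := schwartz0 R.
have [s1 s2] := smoothZD a sf s0; split.
  by move: s1; under eq_fun do rewrite addr0.
move=> n t; have := s2 n t; under [X in cderiven n X]eq_fun do rewrite addr0.
move=> ->; rewrite [X in _ + X](_ : _ = 0) ?addr0//.
have := (smooth_seq (fun n => is_cderiv_cst (0 : R[i]))).2 n.
by move=> /(congr1 (@^~ t)).
Qed.

Lemma smoothD f g : smooth f -> smooth g ->
  smooth (fun t => f t + g t) /\
  forall n t, cderiven n (fun t => f t + g t) t = cderiven n f t + cderiven n g t.
Proof.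
move=> sf sg; have [s1 s2] := smoothZD 1 sf sg.
move: s1 s2; under [X in smooth X]eq_fun do rewrite mul1r.
move=> s1 s2; split => // n t; have := s2 n t.
by under [X in cderiven n X]eq_fun do rewrite mul1r; rewrite mul1r.
Qed.

Lemma sboundZ N B a f : smooth f -> sbound N B f ->
  sbound N (normc a * B) (fun t => a * f t).
Proof.
move=> sf h m n t mN nN; rewrite (smoothZ a sf).2 Normc.normcM mulrCA.
by rewrite ler_wpM2l ?normc_ge0// h.
Qed.

Lemma sboundD N B C f g : smooth f -> smooth g -> sbound N B f -> sbound N C g ->
  sbound N (B + C) (fun t => f t + g t).
Proof.
move=> sf sg hf hg m n t mN nN; rewrite (smoothD sf sg).2.
rewrite (le_trans (ler_wpM2l _ (normcD _ _))) ?exprn_ge0//.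
by rewrite mulrDr lerD ?hf ?hg.
Qed.

Lemma sbound0 N B : 0 <= B -> sbound N B (fun=> 0).
Proof.
move=> B0 m n t _ _.
have := (smooth_seq (fun n => is_cderiv_cst (0 : R[i]))).2 n.
by move=> ->; rewrite Normc.normc0 mulr0.
Qed.

Lemma sbound_sum N (I : Type) (r : seq I) (F : I -> R -> R[i]) (B : I -> R) :
  (forall i, schwartz (F i)) -> (forall i, sbound N (B i) (F i)) ->
  sbound N (\sum_(i <- r) B i) (fun t => \sum_(i <- r) F i t).
Proof.
move=> sF hF; elim: r => [|i r IH].
  by under [X in sbound _ _ X]eq_fun do rewrite big_nil; rewrite big_nil; exact: sbound0.
under [X in sbound _ _ X]eq_fun do rewrite big_cons; rewrite big_cons; apply: sboundD => //.
  by case: (sF i).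
by case: (schwartz_sum r sF).
Qed.

End ComplexDerivative.

(** * Quadratic decay as a criterion of integrability *)

Section Decay.
Variable R : realType.
Implicit Types (f g : R -> R[i]) (C M : R).

(** The Cauchy weight [1 / (1 + t^2)], of integral [pi], is the dominating function of most
    integrals over the line below. *)
Definition weight (t : R) : R := (oneDsqr t)^-1.

Lemma oneDsqr_gt0 t : 0 < oneDsqr t :> R.
Proof. exact: lt_le_trans (oneDsqr_ge1 t). Qed.

Lemma weight_gt0 t : 0 < weight t.
Proof. by rewrite invr_gt0 oneDsqr_gt0. Qed.

Lemma integral_weight : (\int[leb]_t (weight t)%:E = pi%:E)%E.
Proof.
rewrite ge0_symfun_integralT.
- rewrite (_ : [set x | _] = `[0, +oo[%classic); last by rewrite set_itvcy.
  by rewrite integral0y_oneDsqr -EFinM mulrCA divff ?mulr1// pnatr_eq0.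
- by move=> x; exact/ltW/weight_gt0.
- exact: continuous_oneDsqrV.
- by move=> x; rewrite /weight /oneDsqr /= sqrrN.
Qed.

Lemma measurable_weight : measurable_fun setT weight.
Proof. by apply: continuous_measurable_fun; exact: continuous_oneDsqrV. Qed.

Lemma integrable_weight : leb.-integrable setT (fun t => (weight t)%:E).
Proof.
apply/integrableP; split; first by apply/measurable_EFinP; exact: measurable_weight.
under eq_integral do rewrite gee0_abs ?lee_fin ?(ltW (weight_gt0 _))//.
by rewrite integral_weight ltry.
Qed.

Lemma integrable_weightZ C : leb.-integrable setT (EFin \o (fun t => C * weight t)).
Proof. exact: (integrableZl measurableT C integrable_weight). Qed.

Lemma Rintegral_weightZ C : \int[leb]_t (C * weight t) = C * pi.
Proof.
rewrite RintegralZl//; last exact: integrable_weight.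
by rewrite /Rintegral integral_weight.
Qed.

(** Continuity provides measurability, and the bound provides domination by [weight]. The constant
    stays explicit because the estimates on seminorms depend on it. *)
Definition decay C f := [/\ continuous (fun t => Re (f t)),
  continuous (fun t => Im (f t)) & forall t, normc (f t) * oneDsqr t <= C].

Lemma decay_weight C f : decay C f -> forall t, normc (f t) <= C * weight t.
Proof. by move=> [_ _ h] t; rewrite /weight ler_pdivlMr// oneDsqr_gt0. Qed.

Lemma decay_cmeasurable C f : decay C f -> cmeasurable f.
Proof. by move=> [fR fI _]; split; exact: continuous_measurable_fun. Qed.

Lemma decay_cintegrable C f : decay C f -> cintegrable leb f.
Proof.
move=> df; apply: cintegrable_le (integrable_weightZ C) (decay_weight df).
exact: decay_cmeasurable df.
Qed.

Lemma decay_cintegral C f : decay C f -> normc (cintegral leb f) <= 2 * (C * pi).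
Proof.
move=> df; rewrite -Rintegral_weightZ; apply: normc_cintegral_le.
- exact: decay_cintegrable df.
- exact: integrable_weightZ.
- exact: decay_weight df.
Qed.

Lemma decay_ge0 C f : decay C f -> 0 <= C.
Proof.
by move=> [_ _ /(_ 0)]; apply: le_trans; rewrite mulr_ge0 ?normc_ge0// ltW// oneDsqr_gt0.
Qed.

Lemma decayM C M f g : decay C f -> continuous (fun t => Re (g t)) ->
  continuous (fun t => Im (g t)) -> (forall t, normc (g t) <= M) ->
  decay (C * M) (fun t => f t * g t).
Proof.
move=> df gR gI gM; have C0 := decay_ge0 df; case: df => fR fI fC; split.
- under eq_fun do rewrite ReM.
  move=> t; apply: cvgB; apply: cvgM.
  + exact: fR. + exact: gR. + exact: fI. + exact: gI.
- under eq_fun do rewrite ImM.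
  move=> t; apply: cvgD; apply: cvgM.
  + exact: fR. + exact: gI. + exact: fI. + exact: gR.
- move=> t; rewrite Normc.normcM mulrAC ler_pM ?mulr_ge0 ?normc_ge0//.
Qed.

Lemma decayZ C a f : decay C f -> decay (C * normc a) (fun t => a * f t).
Proof.
move=> df; under eq_fun do rewrite mulrC.
by apply: decayM df _ _ _ => //; move=> t; exact: cvg_cst.
Qed.

Lemma decayD B C f g : decay B f -> decay C g -> decay (B + C) (fun t => f t + g t).
Proof.
move=> [fR fI fC] [gR gI gC]; split.
- by under eq_fun do rewrite ReD; move=> t; apply: cvgD; [exact: fR|exact: gR].
- by under eq_fun do rewrite ImD; move=> t; apply: cvgD; [exact: fI|exact: gI].
- move=> t; apply: le_trans (ler_wpM2r (ltW (oneDsqr_gt0 t)) (normcD _ _)) _.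
  by rewrite mulrDl lerD.
Qed.

Lemma decay_conjc C f : decay C f -> decay C (fun t => conjc (f t)).
Proof.
move=> [fR fI fC]; split.
- by under eq_fun do rewrite Re_conjc.
- under eq_fun do rewrite Im_conjc.
  by move=> t; apply: (@cvgN _ R^o); exact: fI.
- by move=> t; rewrite normc_conjc.
Qed.

Lemma sbound_decay B f : smooth f -> sbound 2 B f -> decay (2 * B) f.
Proof.
move=> sf h; have := is_cderiv_continuous (smooth_is_cderiv 0 sf).
rewrite cderiven0 => -[fR fI]; split => // t.
have := h 0%N 0%N t isT isT; have := h 2%N 0%N t isT isT.
rewrite cderiven0 expr0 mul1r real_normK ?num_real//.
by rewrite /oneDsqr; lra.
Qed.

Lemma schwartz_decay f : schwartz f -> exists C, decay C f.
Proof.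
move=> /schwartzP[sf /(_ 2)[B h]].
by exists (2 * B); exact: sbound_decay.
Qed.

End Decay.

(** * The exponential [t |-> exp (2 pi i t)] *)

Section Exponential.
Variable R : realType.
Implicit Types (t s c : R).

Definition expi t : R[i] := (cos (2 * pi * t) +i* sin (2 * pi * t))%C.

Lemma expi0 : expi 0 = 1.
Proof. by rewrite /expi mulr0 cos0 sin0. Qed.

Lemma expiD t s : expi (t + s) = expi t * expi s.
Proof.
rewrite /expi mulrDr cosD sinD; apply: complex_eq; rewrite ?ReM ?ImM //=.
by rewrite addrC.
Qed.

Lemma expiN t : expi (- t) = conjc (expi t).
Proof. by rewrite /expi mulrN cosN sinN. Qed.

Lemma normc_expi t : normc (expi t) = 1.
Proof. by rewrite /= cos2Dsin2 sqrtr1. Qed.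

Lemma expi1 : expi 1 = 1.
Proof. by rewrite /expi mulr1 mulr_natl cos2pi sin2pi. Qed.

Lemma expi_nat n : expi n%:R = 1.
Proof. by elim: n => [|n IH]; rewrite ?expi0// -natr1 expiD IH expi1 mulr1. Qed.

(** If [cos (2 pi t) = 1], the duplication formula forces [sin (pi t) = 0], whereas the sine is
    positive strictly between [0] and [pi]. *)
Lemma expi_neq1 t : 0 < t < 1 -> expi t != 1.
Proof.
move=> /andP[t0 t1]; apply/eqP => /(congr1 (@complex.Re R)) /= c1.
have : cos (pi * t + pi * t) = 1 by rewrite -mulr2n -mulr_natl mulrA.
rewrite cosD; have := cos2Dsin2 (pi * t) => cs cd.
have : sin (pi * t) ^+ 2 = 0 by nra.
move=> /eqP; rewrite sqrf_eq0 => /eqP s0.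
have : 0 < sin (pi * t).
  apply: sin_gt0_pi; rewrite mulr_gt0 ?pi_gt0//=.
  by rewrite gtr_pMr ?pi_gt0.
by rewrite s0 ltxx.
Qed.

Lemma is_cderiv_expi c :
  is_cderiv (fun t => expi (c * t)) (fun t => (0 +i* (2 * pi * c))%C * expi (c * t)).
Proof.
move=> t.
have d : is_derive t (1 : R) (fun t => 2 * pi * (c * t)) (2 * pi * c).
  rewrite (_ : (fun t => _) = (2 * pi * c) \*: id).
    by apply: is_derive_eq; rewrite /GRing.scale /= mulr1.
  by apply/funext => s /=; rewrite /GRing.scale /= !mulrA.
split.
  rewrite ReM /=; apply: is_derive_eq (is_derive1_comp (is_derive_cos _) d) _.
  by ring.
rewrite ImM /=; apply: is_derive_eq (is_derive1_comp (is_derive_sin _) d) _.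
by ring.
Qed.

Lemma decay_expi C f c : decay C f -> decay C (fun t => f t * expi (c * t)).
Proof.
move=> df; have [eR eI] := is_cderiv_continuous (is_cderiv_expi c).
by rewrite -[C]mulr1; apply: decayM => // t; rewrite normc_expi.
Qed.

End Exponential.

Section RealIntegrals.
Variable R : realType.

(** Differentiation under the integral sign is local in the parameter. As [G] dominates uniformly,
    any open interval around [a] will do, here that of radius 1. *)
Lemma is_derive_Rintegral (F F' : R -> R -> R) (G : R -> R) (a : R) :
  (forall x, leb.-integrable setT (EFin \o F x)) ->
  (forall x t, is_derive x (1 : R) (F^~ t) (F' x t)) ->
  leb.-integrable setT (EFin \o G) -> (forall x t, `|F' x t| <= G t) ->
  is_derive a (1 : R) (fun x => \int[leb]_t F x t) (\int[leb]_t F' a t).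
Proof.
move=> iF dF iG FG.
have FE x t : partial1of2 F x t = F' x t.
  by rewrite partial1of2E; have [_ ->] := dF x t.
have aI : `]a - 1, a + 1[%classic a by rewrite /= in_itv /= ltrBlDr !ltrDl ltr01.
have G0 t : 0 <= G t by exact: le_trans (normr_ge0 _) (FG a t).
have D x t : `]a - 1, a + 1[%classic x -> setT t -> derivable (F^~ t) x 1.
  by move=> _ _; have [] := dF x t.
have ub x t : `]a - 1, a + 1[%classic x -> setT t -> `|partial1of2 F x t| <= G t.
  by move=> _ _; rewrite FE.
apply: DeriveDef.
  exact: (derivable_under_integral measurableT aI (fun x _ => iF x) D G0 iG ub).
rewrite -derive1E.
rewrite (differentiation_under_integral measurableT aI (fun x _ => iF x) D G0 iG ub).
by apply: eq_Rintegral => t _; rewrite FE.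
Qed.

(** The fundamental theorem of calculus on [[-(n+1), n+1]] leaves only boundary terms, which tend to
    zero; dominated convergence passes to the whole line. *)
Lemma Rintegral_derive0 (u u' : R -> R) (C : R) :
  (forall t, is_derive t (1 : R) u (u' t)) -> continuous u' ->
  leb.-integrable setT (EFin \o u') -> (forall t, `|u t| <= C * weight t) ->
  \int[leb]_t u' t = 0.
Proof.
move=> du cu' iu' uC.
pose I n : set R := `[- n.+1%:R, n.+1%:R]%classic.
have mI n : measurable (I n) by exact: measurable_itv.
pose f_ n := (EFin \o u') \_ (I n).
have mf n : measurable_fun setT (f_ n).
  apply/(measurable_restrictT _ (mI n)).
  by apply: measurable_funS (measurable_int _ iu').
have cf (t : R) : setT t -> f_ n t @[n --> \oo] --> (EFin \o u') t.
  move=> _; apply: cvg_near_cst; exists (Num.truncn `|t|) => // n /= xn.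
  rewrite /f_ patchE ifT// inE /I /= in_itv /= -ler_norml.
  by rewrite ltW// (lt_le_trans (truncnS_gt _))// ler_nat.
have bf : forall x n, setT x -> (`|f_ n x| <= `|(EFin \o u') x|)%E.
  by move=> x n _; rewrite /f_ patchE; case: ifPn => //= _; rewrite normr0 lee_fin.
have cvgI : (\int[leb]_x f_ n x)%E @[n --> \oo] --> (\int[leb]_x (u' x)%:E)%E.
  have h := @dominated_cvg _ _ R leb setT measurableT f_ (EFin \o u')
    (abse \o (EFin \o u')).
  by apply: h => //; [exact: integrable_abse|move=> n x; exact: bf].
have fE n : (\int[leb]_x f_ n x = (u n.+1%:R - u (- n.+1%:R))%:E)%E.
  rewrite /f_ -integral_mkcond (@continuous_FTC2 R u' u)//.
  - by rewrite gtrN.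
  - exact: continuous_subspaceT.
  - have cu x : {for x, continuous u}.
      by apply: differentiable_continuous; apply/derivable1_diffP; case: (du x).
    split; first by move=> x _; case: (du x).
      by apply: cvg_at_right_filter; exact: cu.
    by apply: cvg_at_left_filter; exact: cu.
  - by move=> x _; rewrite derive1E; case: (du x).
have u0 : (u n.+1%:R - u (- n.+1%:R)) @[n --> \oo] --> (0 : R).
  have C0 : 0 <= C.
    have := le_trans (normr_ge0 _) (uC 0).
    by rewrite pmulr_lge0 ?weight_gt0.
  apply: norm_cvg0; apply: (@squeeze_cvgr _ _ _ _ (cst 0)
    (fun n => (2 * C) * harmonic n)).
  - apply: nearW => n; rewrite normr_ge0 /= (le_trans (ler_normB _ _))//.
    rewrite -mulrA mulr_natl mulr2n.
    (* Since [1 + (n+1)^2 >= n+1], the boundary terms are squeezed by the harmonic sequence. *)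
    have h : weight n.+1%:R <= harmonic n :> R.
      rewrite /weight /harmonic lef_pV2 ?posrE ?oneDsqr_gt0//.
      rewrite /oneDsqr -natrX nat1r ler_nat.
      by rewrite leqW// expnS leq_pmulr// expn1.
    rewrite lerD// (le_trans (uC _))//.
      by rewrite ler_wpM2l.
    rewrite ler_wpM2l// /weight /oneDsqr sqrrN//.
  - exact: cvg_cst.
  - rewrite -[X in _ --> X](mulr0 (2 * C)); apply: cvgMr; exact: cvg_harmonic.
move: cvgI; rewrite (_ : (fun n => _) = EFin \o (fun n => u n.+1%:R - u (- n.+1%:R))).
  have {}u0 : (EFin \o (fun n => u n.+1%:R - u (- n.+1%:R))) n @[n --> \oo] --> 0%:E.
    by apply: cvg_EFin => //; exact: nearW.
  by move=> /(cvg_unique (@ereal_hausdorff R) u0) I0; rewrite /Rintegral -I0.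
exact/funext.
Qed.

End RealIntegrals.

Section ComplexFubini.
Variable R : realType.
Local Notation leb2 := (leb \x leb)%E.

(** Fubini's theorem concerns extended real integrals. Integrability of every section keeps the
    inner integrals finite, so that taking their real values loses nothing. *)
Lemma Rintegral_Fubini (u : R * R -> R) :
  (leb \x leb)%E.-integrable setT (EFin \o u) ->
  (forall x, leb.-integrable setT (fun y => (u (x, y))%:E)) ->
  (forall y, leb.-integrable setT (fun x => (u (x, y))%:E)) ->
  \int[leb]_x \int[leb]_y u (x, y) = \int[leb]_y \int[leb]_x u (x, y).
Proof.
move=> iu iu1 iu2; have /(congr1 fine) := Fubini iu.
rewrite /= -!/(Rintegral _ _ _); congr (_ = _).
  congr fine; apply: eq_integral => x _.
  by rewrite /Rintegral fineK//; exact: (integrable_fin_num _ (iu1 x)).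
congr fine; apply: eq_integral => x _.
by rewrite /Rintegral fineK//; exact: (integrable_fin_num _ (iu2 x)).
Qed.

Lemma cintegral_Fubini (f : R * R -> R[i]) :
  cintegrable (leb \x leb)%E f ->
  (forall x, cintegrable leb (fun y => f (x, y))) ->
  (forall y, cintegrable leb (fun x => f (x, y))) ->
  cintegral leb (fun x => cintegral leb (fun y => f (x, y))) =
  cintegral leb (fun y => cintegral leb (fun x => f (x, y))).
Proof.
move=> [fR fI] f1 f2; apply: complex_eq => /=.
  apply: (Rintegral_Fubini (u := fun z => Re (f z))) => //.
    by move=> x; case: (f1 x).
  by move=> x; case: (f2 x).
apply: (Rintegral_Fubini (u := fun z => Im (f z))) => //.
  by move=> x; case: (f1 x).
by move=> x; case: (f2 x).
Qed.

Lemma integrable_weight2 (C : R) : (leb \x leb)%E.-integrable setT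
  (EFin \o (fun z : R * R => C * (weight z.1 * weight z.2))).
Proof.
suff h : (leb \x leb)%E.-integrable setT
    (fun z : R * R => (weight z.1 * weight z.2)%:E).
  exact: (integrableZl measurableT C h).
apply/(integrable12ltyP leb leb).
  apply/measurable_EFinP; apply: measurable_funM.
    by apply: measurableT_comp; first exact: measurable_weight.
  by apply: measurableT_comp; first exact: measurable_weight.
under eq_integral.
  move=> x _; under eq_integral.
    move=> y _.
    rewrite gee0_abs; last by rewrite lee_fin mulr_ge0// ltW// weight_gt0.
    rewrite EFinM /=; over.
  rewrite integralZl//=; last exact: integrable_weight.
  rewrite integral_weight.
  over.
rewrite integralZr//=; last exact: integrable_weight.
by rewrite integral_weight -EFinM ltry.
Qed.

End ComplexFubini.

(** * The Fourier transform on the real line *)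

Section RealFourier.
Variable R : realType.
Implicit Types (f g : R -> R[i]) (B C : R).

Definition FT f (x : R) : R[i] := cintegral leb (fun t => f t * expi (- x * t)).

(** The number [- 2 pi i]: differentiating [expi (- x * t)] in [x] multiplies it by [kap * t], and
    in [t] by [kap * x]. *)
Definition kap : R[i] := (0 +i* (- (2 * pi)))%C.

Lemma FT_cintegrable C f x : decay C f ->
  cintegrable leb (fun t => f t * expi (- x * t)).
Proof. by move=> /(decay_expi (- x)); exact: decay_cintegrable. Qed.

Lemma FTZ C a f x : decay C f -> FT (fun t => a * f t) x = a * FT f x.
Proof.
move=> df; rewrite /FT -(cintegralZ _ (FT_cintegrable x df)).
by congr cintegral; apply/funext => t; rewrite mulrA.
Qed.

Lemma normc_FT C f x : decay C f -> normc (FT f x) <= 2 * (C * pi).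
Proof. by move=> /(decay_expi (- x)); exact: decay_cintegral. Qed.

Lemma FT_is_cderiv B C f : decay B f -> decay C (fun t => t%:C%C * f t) ->
  is_cderiv (FT f) (FT (fun t => kap * (t%:C%C * f t))).
Proof.
move=> df dtf; have dA := decayZ kap dtf.
have dE t : is_cderiv (fun x => f t * expi (- x * t))
    (fun x => kap * (t%:C%C * f t) * expi (- x * t)).
  have := is_cderivZ (f t) (is_cderiv_expi (- t)).
  under eq_fun do rewrite mulNr mulrC -mulNr mulrC.
  congr is_cderiv; apply/funext => x.
    by rewrite mulNr [t * x]mulrC mulNr.
  rewrite (_ : (0 +i* (2 * pi * - t))%C = kap * t%:C%C).
    by rewrite !mulNr [t * x]mulrC; ring.
  by apply: complex_eq; rewrite ?ReM ?ImM /=; ring.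
have bd x t : normc (kap * (t%:C%C * f t) * expi (- x * t)) <=
    C * normc kap * weight t.
  by rewrite Normc.normcM normc_expi mulr1; exact: (decay_weight dA).
move=> x; split.
  apply: (is_derive_Rintegral (F' := fun x t => Re (kap * (t%:C%C * f t) * expi (- x * t)))
    (G := fun t => C * normc kap * weight t)).
  - by move=> y; have [] := FT_cintegrable y df.
  - by move=> y t; have [] := dE t y.
  - exact: integrable_weightZ.
  - by move=> y t; exact: le_trans (Re_le_normc _) (bd y t).
apply: (is_derive_Rintegral (F' := fun x t => Im (kap * (t%:C%C * f t) * expi (- x * t)))
  (G := fun t => C * normc kap * weight t)).
- by move=> y; have [] := FT_cintegrable y df.
- by move=> y t; have [] := dE t y.
- exact: integrable_weightZ.
- by move=> y t; exact: le_trans (Im_le_normc _) (bd y t).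
Qed.

Lemma cintegral_derive0 B C f f' : is_cderiv f f' -> decay B f -> decay C f' ->
  cintegral leb f' = 0.
Proof.
move=> dff df df'; have [iR iI] := decay_cintegrable df'.
case: (df') => cR cI _.
apply: complex_eq => /=.
  apply: (Rintegral_derive0 (u := fun t => Re (f t)) (C := B)) => //.
    by move=> t; case: (dff t).
  by move=> t; exact: le_trans (Re_le_normc _) (decay_weight df t).
apply: (Rintegral_derive0 (u := fun t => Im (f t)) (C := B)) => //.
  by move=> t; case: (dff t).
by move=> t; exact: le_trans (Im_le_normc _) (decay_weight df t).
Qed.

(** Integration by parts, read off from the vanishing integral of the derivative of
    [f t * expi (- x * t)]. *)
Lemma FT_deriv B C f f' x : is_cderiv f f' -> decay B f -> decay C f' ->
  FT f' x = - (kap * x%:C%C) * FT f x.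
Proof.
move=> dff df df'.
have de := is_cderivM dff (is_cderiv_expi (- x)).
have dfe := decay_expi (- x) df; have df'e := decay_expi (- x) df'.
have e1 := decayZ (kap * x%:C%C) dfe.
have E : (fun t => f' t * expi (- x * t) +
      f t * ((0 +i* (2 * pi * - x))%C * expi (- x * t))) =
    (fun t => f' t * expi (- x * t) + kap * x%:C%C * (f t * expi (- x * t))).
  apply/funext => t; rewrite (_ : (0 +i* (2 * pi * - x))%C = kap * x%:C%C).
    by ring.
  by apply: complex_eq; rewrite ?ReM ?ImM /=; ring.
rewrite E in de.
have := cintegral_derive0 de dfe (decayD df'e e1).
rewrite cintegralD; [|exact: decay_cintegrable df'e|exact: decay_cintegrable e1].
rewrite cintegralZ; last exact: decay_cintegrable dfe.
by rewrite -!/(FT _ _) => /eqP; rewrite addr_eq0 mulNr => /eqP.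
Qed.

Let A f : R -> R[i] := fun t => kap * (t%:C%C * f t).

Lemma schwartz_iterA n f : schwartz f -> schwartz (iter n A f).
Proof.
by move=> sf; elim: n => [//|n IH]; apply: schwartzZ; exact: schwartz_mulX.
Qed.

Lemma schwartz_iterD n f : schwartz f -> schwartz (iter n (cderiven 1) f).
Proof. by move=> sf; elim: n => [//|n IH]; exact: schwartz_deriv. Qed.

Lemma FT_smooth f : schwartz f ->
  smooth (FT f) /\ forall n, cderiven n (FT f) = FT (iter n A f).
Proof.
move=> sf; apply: (@smooth_seq _ (fun n => FT (iter n A f))) => n.
have [B dB] := schwartz_decay (schwartz_iterA n sf).
have [C dC] := schwartz_decay (schwartz_mulX (schwartz_iterA n sf)).
exact: FT_is_cderiv dB dC.
Qed.

Lemma FT_iterD n f x : schwartz f ->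
  FT (iter n (cderiven 1) f) x = (- (kap * x%:C%C)) ^+ n * FT f x.
Proof.
move=> sf; elim: n => [|n IH]; first by rewrite mul1r.
have sn := schwartz_iterD n sf.
have [B dB] := schwartz_decay sn.
have [C dC] := schwartz_decay (schwartz_deriv sn).
have d := smooth_is_cderiv 0 sn.1; rewrite cderiven0 in d.
by rewrite iterS (FT_deriv x d dB dC) IH exprS mulrA.
Qed.

Lemma sbound_iterD N n B f : schwartz f -> sbound (N + n) B f ->
  sbound N B (iter n (cderiven 1) f).
Proof.
elim: n f => [|n IH] f sf h; first by rewrite addn0 in h.
rewrite iterSr; apply: IH; first exact: schwartz_deriv.
by apply: sbound_deriv; [case: sf|rewrite -addnS].
Qed.

Lemma sbound_iterA n N : exists2 c : R, 0 <= c & forall f B, schwartz f ->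
  sbound (N + n) B f -> sbound N (c * B) (iter n A f).
Proof.
elim: n => [|n [c c0 IH]].
  by exists 1 => // f B _; rewrite addn0 mul1r.
exists (c * (normc kap * (N + n).+1%:R)).
  by rewrite !mulr_ge0 ?normc_ge0.
move=> f B sf h; rewrite iterSr -!mulrA; apply: IH.
  by apply: schwartzZ; exact: schwartz_mulX.
have sX := schwartz_mulX sf.
by apply: sboundZ; [case: sX|apply: sbound_mulX; [case: sf|rewrite -addnS]].
Qed.

Lemma normc_kap x : normc (- (kap * x%:C%C)) = 2 * pi * `|x|.
Proof.
rewrite normcN Normc.normcM normcR; congr (_ * _).
by rewrite /= expr0n add0r sqrtr_sqr normrN ger0_norm// mulr_ge0// pi_ge0.
Qed.

Lemma normcX (z : R[i]) n : normc (z ^+ n) = normc z ^+ n.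
Proof.
by elim: n => [|n IH]; rewrite ?Normc.normc1// !exprS Normc.normcM IH.
Qed.

(** The transform exchanges derivatives and multiplications: [(- kap x)^m] times the [n]-th
    derivative of [FT f] is the transform of the [m]-th derivative of [iter n A f], hence is bounded
    by an integral. In [2 + N + N], one [N] pays for the multiplications, the other for the
    derivatives, and 2 for the decay that makes the integral converge. *)
Lemma FT_sbound N : exists2 c : R, 0 <= c & forall f B, schwartz f ->
  sbound (2 + N + N) B f -> sbound N (c * B) (FT f).
Proof.
have /choice[c cP] n : exists c : R, 0 <= c /\ forall f B, schwartz f ->
    sbound (2 + N + n) B f -> sbound (2 + N) (c * B) (iter n A f).
  by have [c ? ?] := sbound_iterA n (2 + N); exists c.
exists (\sum_(n < N.+1) 4 * c n * pi).
  by apply: sumr_ge0 => n _; rewrite !mulr_ge0 ?pi_ge0//; case: (cP n).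
move=> f B sf h m n x mN nN.
have sA := schwartz_iterA n sf.
have hn : sbound (2 + m) (c n * B) (iter n A f).
  apply: (@sbound_le _ (2 + N)); first by rewrite leq_add2l.
  apply: (cP n).2 => //; apply: sbound_le h.
  by rewrite leq_add2l.
have hD := sbound_decay (schwartz_iterD m sA).1 (sbound_iterD sA hn).
have := normc_FT x hD; rewrite FT_iterD// -(FT_smooth sf).2.
rewrite Normc.normcM normcX normc_kap => hx.
(* The powers of [2 pi] may be dropped because [2 pi >= 1]. *)
apply: le_trans (_ : (2 * pi * `|x|) ^+ m * normc (cderiven n (FT f) x) <= _).
  rewrite ler_wpM2r ?normc_ge0// lerXn2r ?nnegrE ?mulr_ge0 ?pi_ge0//.
  by rewrite ler_peMl//; have := pi_ge2 R; lra.
apply: le_trans hx _.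
have B0 := sbound_ge0 h.
have cS : 4 * c n * pi <= \sum_(k < N.+1) 4 * c k * pi.
  rewrite -ltnS in nN; rewrite (bigD1 (Ordinal nN))//= lerDl sumr_ge0// => k _.
  by rewrite !mulr_ge0 ?pi_ge0//; case: (cP k).
rewrite (_ : 2 * (2 * (c n * B) * pi) = 4 * c n * pi * B); last by ring.
by rewrite ler_wpM2r.
Qed.

Lemma schwartz_FT f : schwartz f -> schwartz (FT f).
Proof.
move=> sf; apply/schwartzP; split; first by case: (FT_smooth sf).
move=> N; have [c _ cP] := FT_sbound N.
have [_ /(_ (2 + N + N)%N)[B h]] := (schwartzP f).1 sf.
by exists (c * B); exact: cP.
Qed.

(** The kernel [expi (- s t x)] is symmetric in [t] and [x], so both sides are iterated integrals of
    one function, dominated by a product of weights. The parameter [s] later takes the values 1 and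
    -1. *)
Lemma FT_multiplication B C f g (s : R) : decay B f -> decay C g ->
  cintegral leb (fun t => f t * FT g (s * t)) =
  cintegral leb (fun t => FT f (s * t) * g t).
Proof.
move=> df dg.
pose h (z : R * R) := f z.1 * g z.2 * expi (- (s * z.1) * z.2).
have E : cmeasurable (fun z : R * R => expi (- (s * z.1) * z.2)).
  have m : measurable_fun setT (fun z : R * R => 2 * pi * (- (s * z.1) * z.2)).
    apply: measurable_funM => //; apply: measurable_funM => //.
    by apply: measurableT_comp => //; exact: measurable_funM.
  split; apply: measurableT_comp m; apply: continuous_measurable_fun.
    exact: continuous_cos.
  exact: continuous_sin.
have M : cmeasurable h.
  apply: cmeasurableM => //; apply: cmeasurableM.
    have [mR mI] := decay_cmeasurable df.
    by split; [exact: (measurableT_comp mR measurable_fst)|exact: (measurableT_comp mI measurable_fst)].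
  have [mR mI] := decay_cmeasurable dg.
  by split; [exact: (measurableT_comp mR measurable_snd)|exact: (measurableT_comp mI measurable_snd)].
have hi : cintegrable (leb \x leb)%E h.
  refine (cintegrable_le _ (integrable_weight2 (B * C)) _) => [|z].
    exact: M.
  rewrite /h Normc.normcM normc_expi mulr1 Normc.normcM mulrACA.
  rewrite ler_pM ?normc_ge0//; [exact: (decay_weight df)|exact: (decay_weight dg)].
have h1 t : (fun x => h (t, x)) = (fun x => f t * (g x * expi (- (s * t) * x))).
  by apply/funext => x; rewrite /h mulrA.
have h2 x : (fun t => h (t, x)) = (fun t => g x * (f t * expi (- (s * x) * t))).
  apply/funext => t; rewrite /h /= mulrCA mulrA.
  by rewrite (_ : - (s * t) * x = - (s * x) * t)//; ring.
have i1 t : cintegrable leb (fun x => h (t, x)).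
  by rewrite h1; apply: cintegrableZ; exact: FT_cintegrable dg.
have i2 x : cintegrable leb (fun t => h (t, x)).
  by rewrite h2; apply: cintegrableZ; exact: FT_cintegrable df.
have -> : (fun t => f t * FT g (s * t)) = (fun t => cintegral leb (fun x => h (t, x))).
  by apply/funext => t; rewrite h1 cintegralZ//; exact: FT_cintegrable dg.
have -> : (fun t => FT f (s * t) * g t) = (fun x => cintegral leb (fun t => h (t, x))).
  apply/funext => x; rewrite h2 cintegralZ; first exact: mulrC.
  exact: FT_cintegrable df.
exact: cintegral_Fubini.
Qed.

End RealFourier.

(** * Gaussians and their transforms *)

Section Gaussian.
Variable R : realType.
Implicit Types a t : R.

Definition gaussian a t : R[i] := (expR (- (a * t ^+ 2)))%:C%C.

(** The Gaussian is the square of [exp (- a t^2 / 2)], and [1 + u <= exp u] bounds each factor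
    against one [oneDsqr t]. The second [oneDsqr t] leaves room for an extra factor [t]. *)
Lemma gaussian_bound a t : 0 < a ->
  expR (- (a * t ^+ 2)) * oneDsqr t ^+ 2 <= (1 + 2 / a) ^+ 2.
Proof.
move=> a0; set x := expR (- (a / 2 * t ^+ 2)).
have x0 : 0 < x by exact: expR_gt0.
have -> : expR (- (a * t ^+ 2)) = x ^+ 2.
  by rewrite [RHS]expr2 /x -expRD; congr expR; field.
rewrite -exprMn.
have t20 : 0 <= t ^+ 2 by exact: sqr_ge0.
have x1 : x * (1 + a / 2 * t ^+ 2) <= 1.
  rewrite -[leRHS](expRxMexpNx_1 (a / 2 * t ^+ 2)) mulrC ler_wpM2r ?(ltW x0)//.
  exact: expR_ge1Dx.
have h : oneDsqr t <= (1 + 2 / a) * (1 + a / 2 * t ^+ 2).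
  rewrite [leRHS](_ : _ = oneDsqr t + (a / 2 * t ^+ 2 + 2 / a)).
    by rewrite lerDl; apply: addr_ge0; [apply: mulr_ge0 => //|]; rewrite divr_ge0 ?(ltW a0).
  by rewrite /oneDsqr; field; rewrite gt_eqF.
have c0 : 0 <= 1 + 2 / a by rewrite addr_ge0// divr_ge0 ?(ltW a0).
rewrite lerXn2r ?nnegrE//; first exact: ltW (mulr_gt0 x0 (oneDsqr_gt0 t)).
apply: le_trans (ler_wpM2l (ltW x0) h) _.
by rewrite mulrCA -[leRHS]mulr1 ler_wpM2l.
Qed.

Lemma gaussian_is_cderiv a :
  is_cderiv (gaussian a) (fun t => - (2 * a)%:C%C * (t%:C%C * gaussian a t)).
Proof.
have d t : is_derive t (1 : R) (fun t => expR (- (a * t ^+ 2)))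
    (- (2 * a) * (t * expR (- (a * t ^+ 2)))).
  have d2 : is_derive t (1 : R) (fun t => - (a * t ^+ 2)) (- (2 * a) * t).
    rewrite (_ : (fun t => _) = (- a) \*: ((@GRing.exp R)^~ 2)).
      by apply: is_derive_eq; rewrite /GRing.scale /=; ring.
    by apply/funext => s /=; rewrite /GRing.scale /= mulNr.
  apply: is_derive_eq (is_derive1_comp (is_derive_expR _) d2) _.
  by ring.
have := is_cderiv_real d; congr is_cderiv; apply/funext => t.
by rewrite /gaussian !(rmorphM, rmorphN).
Qed.

Lemma gaussian_decay a : 0 < a -> decay ((1 + 2 / a) ^+ 2) (gaussian a) /\
  decay ((1 + 2 / a) ^+ 2) (fun t => t%:C%C * gaussian a t).
Proof.
move=> a0; have d := gaussian_is_cderiv a.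
have [gR gI] := is_cderiv_continuous d.
have [tR tI] := is_cderiv_continuous (is_cderivM (@is_cderiv_id R) d).
split; split => // t.
  rewrite normcR gtr0_norm ?expR_gt0// (le_trans _ (gaussian_bound t a0))//.
  by rewrite ler_wpM2l ?expR_ge0// expr2 ler_peMr ?oneDsqr_ge1.
rewrite Normc.normcM !normcR (gtr0_norm (expR_gt0 _)).
rewrite (le_trans _ (gaussian_bound t a0))// mulrAC mulrC.
rewrite ler_wpM2l ?expR_ge0// expr2 ler_wpM2r ?(ltW (oneDsqr_gt0 t))//.
rewrite /oneDsqr; have : 0 <= (`|t| - 1) ^+ 2 by exact: sqr_ge0.
have : 0 <= t ^+ 2 by exact: sqr_ge0.
have <- : `|t| ^+ 2 = t ^+ 2 by rewrite real_normK ?num_real.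
by lra.
Qed.

(** The derivative of the transform is the transform of [kap t] times the Gaussian. As [t] times the
    Gaussian is proportional to its derivative, [FT_deriv] turns this back into a multiple of [x]
    times the transform, with [kap^2 = - 4 pi^2]. *)
Lemma FT_gaussian_is_cderiv a : 0 < a -> is_cderiv (FT (gaussian a))
  (fun x => - (2 * (pi ^+ 2 / a))%:C%C * (x%:C%C * FT (gaussian a) x)).
Proof.
move=> a0; have [dg dtg] := gaussian_decay a0.
have := FT_is_cderiv dg dtg; congr is_cderiv; apply/funext => x.
have := FT_deriv x (gaussian_is_cderiv a) dg (decayZ (- (2 * a)%:C%C) dtg).
have FE c : FT (fun t => c * (t%:C%C * gaussian a t)) x =
    c * FT (fun t => t%:C%C * gaussian a t) x by exact: FTZ dtg.
rewrite !FE => E.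
have a2 : (2 * a)%:C%C != 0 :> R[i].
  by apply/eqP => /complexI /eqP; rewrite mulf_eq0 pnatr_eq0/= gt_eqF.
apply: (mulfI a2); rewrite mulrCA.
have -> : (2 * a)%:C%C * FT (fun t => t%:C%C * gaussian a t) x =
    kap R * x%:C%C * FT (gaussian a) x.
  by apply: oppr_inj; rewrite -[RHS]mulNr -E mulNr.
have -> : (2 * a)%:C%C * (- (2 * (pi ^+ 2 / a))%:C%C * (x%:C%C * FT (gaussian a) x)) =
    - ((2 * a)%:C%C * (2 * (pi ^+ 2 / a))%:C%C) * (x%:C%C * FT (gaussian a) x).
  by ring.
rewrite -rmorphM; set F := FT _ x.
have -> : kap R * (kap R * x%:C%C * F) = kap R * kap R * (x%:C%C * F) by ring.
congr (_ * _).
apply: complex_eq; rewrite ?ReM ?ImM ?ReN ?ImN /=; last by ring.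
by field; rewrite gt_eqF.
Qed.

Lemma FT_gaussian a x : 0 < a ->
  FT (gaussian a) x = FT (gaussian a) 0 * gaussian (pi ^+ 2 / a) x.
Proof.
move=> a0; set b := pi ^+ 2 / a.
(* Both sides solve the same first order linear differential equation. *)
pose h x := FT (gaussian a) x * gaussian (- b) x.
have dh : is_cderiv h (fun=> 0).
  have := is_cderivM (FT_gaussian_is_cderiv a0) (gaussian_is_cderiv (- b)).
  congr is_cderiv; apply/funext => y; rewrite -/b.
  have -> : (2 * - b)%:C%C = - (2 * b)%:C%C :> R[i] by rewrite mulrN rmorphN.
  by ring.
have hc : h x = h 0.
  apply: complex_eq.
    by apply: (is_derive_0_is_cst (f := fun y => Re (h y))) => y; case: (dh y).
  by apply: (is_derive_0_is_cst (f := fun y => Im (h y))) => y; case: (dh y).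
have g0 : gaussian (- b) 0 = 1 by rewrite /gaussian expr0n mulr0 oppr0 expR0.
have gg : gaussian (- b) x * gaussian b x = 1.
  by rewrite /gaussian -rmorphM -expRD mulNr opprK subrr expR0.
by rewrite -[LHS]mulr1 -gg mulrA -/(h x) hc /h g0 mulr1.
Qed.

Lemma FT_gaussian_pdf (r x : R) : 0 < r ->
  FT (gaussian (2 * pi ^+ 2 * r ^+ 2)) x = (normal_pdf 0 r x)%:C%C.
Proof.
move=> r0; have p0 := pi_gt0 R; set a := 2 * pi ^+ 2 * r ^+ 2.
have a0 : 0 < a by rewrite !mulr_gt0 ?exprn_gt0.
(* With this deviation, [a t^2 = t^2 / (2 tau^2)]: the Gaussian is itself a multiple of a normal
   density, which gives its integral and hence the value of the transform at 0. *)
pose tau := (2 * pi * r)^-1; have tau0 : 0 < tau by rewrite invr_gt0 !mulr_gt0.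
have gE : (fun t => gaussian a t * expi (- 0 * t)) =
    (fun t => ((normal_peak tau)^-1 * normal_pdf 0 tau t)%:C%C).
  apply/funext => t; rewrite oppr0 mul0r expi0 mulr1 normal_pdfE ?gt_eqF//.
  rewrite mulKf ?gt_eqF ?normal_peak_gt0 ?gt_eqF//; congr ((expR _)%:C)%C.
  by rewrite /a /tau subr0; move: (pi : R) p0 => P P0; field; rewrite !gt_eqF.
have F0 : FT (gaussian a) 0 = ((normal_peak tau)^-1)%:C%C.
  rewrite /FT gE; apply: complex_eq => /=; last by rewrite /Rintegral integral0.
  rewrite RintegralZl//; last exact: integrable_normal_pdf.
  by rewrite /Rintegral integral_normal_pdf mulr1.
rewrite FT_gaussian// F0 -rmorphM normal_pdfE ?gt_eqF//.
congr ((_ * expR _)%:C)%C; last first.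
  by rewrite /a subr0; move: (pi : R) p0 => P P0; field; rewrite !gt_eqF.
rewrite /normal_peak invrK -sqrtrV; last first.
  by rewrite mulrn_wge0// mulr_ge0 ?sqr_ge0 ?ltW.
by congr Num.sqrt; rewrite /tau; move: (pi : R) p0 => P P0; field; rewrite !gt_eqF.
Qed.

(** Doubling the deviation absorbs the factor [|t - m|]; the first absolute moment is then at most
    [2 r], without being computed. *)
Lemma normal_pdf_moment (m r t : R) : 0 < r ->
  `|t - m| * normal_pdf m r t <= 2 * r * normal_pdf m (2 * r) t.
Proof.
move=> r0; have r20 : 0 < 2 * r by rewrite mulr_gt0.
rewrite !normal_pdfE ?gt_eqF//.
have pE : 2 * normal_peak (2 * r) = normal_peak r :> R.
  rewrite /normal_peak; move: (pi : R) => P.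
  have -> : (2 * r) ^+ 2 * P *+ 2 = 2 ^+ 2 * (r ^+ 2 * P *+ 2) by ring.
  rewrite sqrtrM ?sqr_ge0// sqrtr_sqr gtr0_norm// invfM mulrA divff ?mul1r//.
rewrite [leRHS](_ : _ = r * ((2 * normal_peak (2 * r)) * normal_fun m (2 * r) t)); last by ring.
rewrite pE mulrCA [leRHS]mulrCA ler_wpM2l ?normal_peak_ge0//.
(* [y <= r (1 + z)] for [z = 3 y^2 / (8 r^2)], and [1 + z <= exp z]. *)
rewrite /normal_fun; set y := (t - m).
set z := 3 * y ^+ 2 / (8 * r ^+ 2).
have -> : - y ^+ 2 / (r ^+ 2 *+ 2) = - z + - y ^+ 2 / ((2 * r) ^+ 2 *+ 2).
  by rewrite /z; field; rewrite gt_eqF.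
rewrite expRD mulrA ler_wpM2r ?expR_ge0//.
rewrite expRN ler_pdivrMr ?expR_gt0//.
apply: le_trans (ler_wpM2l (ltW r0) (expR_ge1Dx z)).
rewrite /z -(real_normK (num_real y)).
rewrite [leRHS](_ : _ = (8 * r ^+ 2 + 3 * `|y| ^+ 2) / (8 * r)).
  rewrite ler_pdivlMr ?mulr_gt0//.
  have : 0 <= (4 * `|y| - 4 * r) ^+ 2 by exact: sqr_ge0.
  have : 0 <= `|y| ^+ 2 by exact: sqr_ge0.
  nra.
by field; rewrite gt_eqF.
Qed.

End Gaussian.

(** * Inversion and Parseval's equality on the real line *)

Section RealInversion.
Variable R : realType.
Implicit Types (f g : R -> R[i]) (s r x t : R).

Lemma Lipschitz_derive (u u' : R -> R) (B x t : R) :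
  (forall t, is_derive t (1 : R) u (u' t)) -> (forall t, `|u' t| <= B) ->
  `|u t - u x| <= B * `|t - x|.
Proof.
move=> du uB.
have cu (I : set R) : {within I, continuous u}.
  apply: continuous_subspaceT => y.
  by apply: differentiable_continuous; apply/derivable1_diffP; case: (du y).
wlog xt : x t / x <= t.
  move=> h; have [|/ltW tx] := leP x t; first exact: h.
  by rewrite distrC [`|t - x|]distrC; exact: h.
have [c _ ->] := MVT_segment xt (fun y _ => du y) (cu _).
by rewrite normrM ler_wpM2r.
Qed.

Lemma schwartz_Lipschitz f : schwartz f ->
  exists2 L : R, 0 <= L & forall x t, normc (f t - f x) <= L * `|t - x|.
Proof.
move=> /schwartzP[sf /(_ 1%N)[B h]].
have B1 t : normc (cderiven 1 f t) <= B.
  by have := h 0%N 1%N t isT isT; rewrite expr0 mul1r.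
have d := smooth_is_cderiv 0 sf; rewrite cderiven0 in d.
exists (B + B); first by rewrite addr_ge0// (sbound_ge0 h).
move=> x t; apply: le_trans (normc_le_ReIm _) _.
rewrite ReD ImD ReN ImN mulrDl lerD//.
  apply: (@Lipschitz_derive (fun t => Re (f t)) (fun t => Re (cderiven 1 f t))).
    by move=> y; case: (d y).
  by move=> y; exact: le_trans (Re_le_normc _) (B1 y).
apply: (@Lipschitz_derive (fun t => Im (f t)) (fun t => Im (cderiven 1 f t))).
  by move=> y; case: (d y).
by move=> y; exact: le_trans (Im_le_normc _) (B1 y).
Qed.

Lemma normr_sqr1 s : s ^+ 2 = 1 -> `|s| = 1.
Proof.
move=> s2; have : `|s| ^+ 2 == 1 by rewrite real_normK ?num_real// s2.
by rewrite sqrf_eq1 => /orP[/eqP//|/eqP s1]; have := normr_ge0 s; rewrite s1; lra.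
Qed.

Lemma decay_sign (C : R) f s : s ^+ 2 = 1 -> decay C f ->
  decay C (fun t => f (s * t)).
Proof.
move=> s1 [fR fI fC]; split => [t|t|t].
- apply: (@continuous_comp _ _ _ ( *%R s) (fun t => Re (f t))); last exact: fR.
  exact: mulrl_continuous.
- apply: (@continuous_comp _ _ _ ( *%R s) (fun t => Im (f t))); last exact: fI.
  exact: mulrl_continuous.
- by have := fC (s * t); rewrite /oneDsqr exprMn s1 mul1r.
Qed.

(** The multiplication formula moves the transform from [f] to the modulated Gaussian, whose
    transform is the normal density translated to [x]; the sign [s] disappears because the density
    is even. *)
Lemma FT_gaussian_mean f s x r : schwartz f -> s ^+ 2 = 1 -> 0 < r ->
  cintegral leb (fun t => FT f (s * t) *
    (gaussian (2 * pi ^+ 2 * r ^+ 2) t * expi (s * x * t))) =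
  cintegral leb (fun t => f t * (normal_pdf x r t)%:C%C).
Proof.
move=> sf s1 r0; have p0 := pi_gt0 R; set a := 2 * pi ^+ 2 * r ^+ 2.
have a0 : 0 < a by rewrite !mulr_gt0 ?exprn_gt0.
have [C df] := schwartz_decay sf.
have [dg _] := gaussian_decay a0.
rewrite -(FT_multiplication s df (decay_expi (s * x) dg)).
congr cintegral; apply/funext => t; congr (_ * _).
have -> : FT (fun t0 => gaussian a t0 * expi (s * x * t0)) (s * t) =
    FT (gaussian a) (s * (t - x)).
  congr cintegral; apply/funext => y; rewrite -mulrA -expiD; congr (_ * expi _).
  by ring.
rewrite FT_gaussian_pdf// !normal_pdfE ?gt_eqF//; congr ((_ * expR _)%:C)%C.
by rewrite subr0 exprMn s1 mul1r.
Qed.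

Lemma cintegral_pdf x r : 0 < r ->
  cintegral leb (fun t => (normal_pdf x r t)%:C%C) = 1.
Proof.
move=> r0; apply: complex_eq => /=; last by rewrite /Rintegral integral0.
by rewrite /Rintegral integral_normal_pdf.
Qed.

(** The density has integral 1, so the difference is the mean of [f t - f x]. A Lipschitz bound on
    [f] and [normal_pdf_moment] make it [O(r)]. *)
Lemma approx_identity f x : schwartz f -> exists2 L : R, 0 <= L &
  forall r, 0 < r ->
  normc (cintegral leb (fun t => f t * (normal_pdf x r t)%:C%C) - f x) <= L * r.
Proof.
move=> sf; have [L L0 fL] := schwartz_Lipschitz sf.
have [C df] := schwartz_decay sf.
exists (4 * L) => [|r r0]; first by rewrite mulr_ge0.
have ip y (q : R) : leb.-integrable setT (EFin \o normal_pdf y q).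
  exact: integrable_normal_pdf.
have cp : cintegrable leb (fun t => (normal_pdf x r t)%:C%C).
  by split; [exact: ip|exact: integrable0].
have cfp : cintegrable leb (fun t => f t * (normal_pdf x r t)%:C%C).
  have iC : leb.-integrable setT (EFin \o (fun t => C * normal_pdf x r t)).
    exact: (integrableZl measurableT _ (ip _ _)).
  refine (cintegrable_le _ iC _) => [|t].
    exact: cmeasurableM (decay_cmeasurable df) (cintegrable_measurable cp).
  rewrite Normc.normcM normcR ger0_norm ?normal_pdf_ge0//.
  rewrite ler_wpM2r ?normal_pdf_ge0//; case: df => _ _ /(_ t); apply: le_trans.
  by rewrite ler_peMr ?normc_ge0// oneDsqr_ge1.
have := cintegrableZ (f x) cp.
move=> cfx; rewrite -[f x]mulr1 -(cintegral_pdf x r0) -cintegralZ// -cintegralB//.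
have iG : leb.-integrable setT (EFin \o (fun t => 2 * r * L * normal_pdf x (2 * r) t)).
  exact: (integrableZl measurableT _ (ip _ _)).
rewrite (_ : 4 * L * r = 2 * \int[leb]_t (2 * r * L * normal_pdf x (2 * r) t)).
  apply: normc_cintegral_le => //; first exact: cintegrableB.
  move=> t; rewrite -mulrBl Normc.normcM normcR ger0_norm ?normal_pdf_ge0//.
  apply: le_trans (ler_wpM2r (normal_pdf_ge0 _ _ _) (fL x t)) _.
  rewrite -[leLHS]mulrA [leRHS](_ : _ = L * (2 * r * normal_pdf x (2 * r) t)); last by ring.
  rewrite ler_wpM2l//.
  exact: normal_pdf_moment.
rewrite RintegralZl//.
have -> : \int[leb]_t normal_pdf x (2 * r) t = 1.
  by rewrite /Rintegral integral_normal_pdf.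
by ring.
Qed.

(** From [0 <= 1 - exp (- u) <= u] with [u = a t^2], removing the Gaussian costs at most a multiple
    of [a] times the integral of [t^2 |FT f|], which is finite since [FT f] is again a Schwartz
    function. *)
Lemma gaussian_cutoff f s x : schwartz f -> s ^+ 2 = 1 -> exists2 L : R, 0 <= L &
  forall r, 0 < r ->
  normc (cintegral leb (fun t => FT f (s * t) *
    (gaussian (2 * pi ^+ 2 * r ^+ 2) t * expi (s * x * t))) -
    cintegral leb (fun t => FT f (s * t) * expi (s * x * t))) <= L * r ^+ 2.
Proof.
move=> sf s1; have sF := schwartz_FT sf.
have [C dF] := schwartz_decay sF.
have [D dX] := schwartz_decay (schwartz_mulX (schwartz_mulX sF)).
have {}dF := decay_sign s1 dF; have {}dX := decay_sign s1 dX.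
have p0 := pi_gt0 R.
exists (2 * (2 * pi ^+ 2 * D * pi)).
  by rewrite !mulr_ge0 ?exprn_ge0 ?(decay_ge0 dX) ?pi_ge0.
move=> r r0; set a := 2 * pi ^+ 2 * r ^+ 2.
have a0 : 0 < a by rewrite !mulr_gt0 ?exprn_gt0.
have g1 t : 0 <= 1 - expR (- (a * t ^+ 2)) <= a * t ^+ 2.
  apply/andP; split.
    by rewrite subr_ge0 -expR0 ler_expR oppr_le0 mulr_ge0 ?sqr_ge0 ?(ltW a0).
  by have := expR_ge1Dx (- (a * t ^+ 2)); lra.
have [gR gI] := is_cderiv_continuous (@gaussian_is_cderiv R a).
have dFg : decay (C * 1) (fun t => FT f (s * t) * gaussian a t).
  apply: decayM => // t; rewrite normcR ger0_norm ?expR_ge0//.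
  by have /andP[] := g1 t; lra.
have dFge := decay_expi (s * x) dFg; have dFe := decay_expi (s * x) dF.
rewrite [X in cintegral _ X - _](_ : _ =
  (fun t => FT f (s * t) * gaussian a t * expi (s * x * t))); last first.
  by apply/funext => t; rewrite mulrA.
have i1 := decay_cintegrable dFge; have i2 := decay_cintegrable dFe.
rewrite -cintegralB//.
rewrite (_ : _ * r ^+ 2 = 2 * \int[leb]_t (a * D * weight t)); last first.
  by rewrite Rintegral_weightZ /a; ring.
apply: normc_cintegral_le; [exact: cintegrableB|exact: integrable_weightZ|].
move=> t; rewrite -mulrBl Normc.normcM normc_expi mulr1.
rewrite -[X in _ - X]mulr1 -mulrBr Normc.normcM.
rewrite (_ : gaussian a t - 1 = - (1 - expR (- (a * t ^+ 2)))%:C%C); last first.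
  by rewrite rmorphB opprB.
have /andP[h1 h2] := g1 t.
rewrite normcN normcR ger0_norm//.
apply: le_trans (ler_wpM2l (normc_ge0 _) h2) _.
rewrite mulrCA -mulrA ler_wpM2l ?(ltW a0)//.
apply: le_trans (decay_weight dX t).
rewrite !Normc.normcM !normcR normrM (normr_sqr1 s1) mul1r mulrA -expr2.
by rewrite real_normK ?num_real// mulrC.
Qed.

Theorem FT_inversion f s x : schwartz f -> s ^+ 2 = 1 ->
  cintegral leb (fun t => FT f (s * t) * expi (s * x * t)) = f x.
Proof.
move=> sf s1; have [L L0 hL] := approx_identity x sf.
have [K K0 hK] := gaussian_cutoff x sf s1.
set J := cintegral _ _.
apply/eqP; rewrite -subr_eq0; apply/eqP/Normc.eq0_normc/eqP.
rewrite eq_le normc_ge0 andbT; apply/ler_addgt0Pr => e e0; rewrite add0r.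
(* The bound by 1 gives [r^2 <= r], which puts the two error terms on the same footing; the added 1
   keeps the denominator positive. *)
pose r := Num.min 1 (e / (L + K + 1)).
have LK : 0 < L + K + 1 by rewrite ltr_wpDl ?addr_ge0.
have r0 : 0 < r by rewrite lt_min ltr01 divr_gt0.
have r1 : r <= 1 by rewrite ge_min lexx.
have re : (L + K + 1) * r <= e.
  by rewrite mulrC -ler_pdivlMr// ge_min lexx orbT.
have := hL r r0; have := hK r r0; rewrite FT_gaussian_mean// -/J.
set I := cintegral _ _ => h1 h2.
have -> : J - f x = - (I - J) + (I - f x) by ring.
apply: le_trans (normcD _ _) _; rewrite normcN.
have : K * r ^+ 2 <= K * r by rewrite ler_wpM2l// expr2 ler_piMr// ltW.
by nra.
Qed.

(** The multiplication formula is applied to [f] and the conjugate of [FT g]; by inversion, the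
    transform of the latter is the conjugate of [g]. *)
Theorem FT_parseval f g : schwartz f -> schwartz g ->
  cintegral leb (fun t => f t * conjc (g t)) =
  cintegral leb (fun t => FT f t * conjc (FT g t)).
Proof.
move=> sf sg; have [C df] := schwartz_decay sf.
have [D dG] := schwartz_decay (schwartz_FT sg).
have := FT_multiplication 1 df (decay_conjc dG).
rewrite [in X in _ = X -> _](_ : (fun t => _) = (fun t => FT f t * conjc (FT g t))).
  move=> <-; congr cintegral; apply/funext => t; congr (_ * _).
  rewrite -(@FT_inversion g 1 t sg) ?expr1n// -cintegral_conjc; last first.
    apply: decay_cintegrable; apply: decay_expi.
    by apply: decay_sign dG; rewrite expr1n.
  congr cintegral; apply/funext => y; rewrite conjcM.
  by rewrite -expiN !mul1r mulNr.
by apply/funext => t; rewrite mul1r.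
Qed.

End RealInversion.

(** * Arithmetic of the finite adeles *)

Section PadicArithmetic.
Variable p : primeN.
Implicit Types (u x y : zpadic p).

Lemma zpadic_nat_neq0 n : (n.+1%:R : zpadic p) != 0.
Proof.
apply/eqP => /(congr1 (fun x => val (residue x n))); rewrite residue_nat.
rewrite [LHS](val_natZ p n.+1 n) [RHS]/= modn_small//.
exact/ltn_expl/primeN_gt1.
Qed.

(** All residues are then prime to [p], hence invertible, and uniqueness of inverses makes the
    family of inverses compatible. *)
Lemma zpadic_unit_residue u : residue u 0 != 0 -> u \is a GRing.unit.
Proof.
move=> u0; have p_pr := Defs.primeP p.
have cop k : coprime (p ^ k.+1) (residue u k).
  rewrite coprime_pexpl// prime_coprime//.
  apply: contra (residue_neq0 u0) => h.
  by rewrite /dvdn -(@residue_le p u 0 k)// (expn1 p).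
pose v k : 'Z_(p ^ k.+1) := (residue u k)^-1.
have uv k : residue u k * v k = 1.
  by apply: divrr; rewrite -[residue u k]natr_Zp unitZpE ?modulus_gt1.
have uvn j k : (j <= k)%N -> (residue u k * v k = 1 %[mod p ^ j.+1])%N.
  move=> jk; rewrite -(mod_mulZ _ _ jk) uv.
  by congr (_ %% _)%N; exact: val_oneZ.
have vP : compatible v.
  move=> k.
  have h : (residue u k * v k.+1 = 1 %[mod p ^ k.+1])%N.
    by rewrite -modnMml -(residueP u k) modnMml; exact: uvn.
  rewrite -[in LHS](mul1n (v k.+1)) -modnMml -(uvn k k)// modnMml mulnAC.
  by rewrite -modnMml h modnMml mul1n.
apply/unitrP; exists (Zpadic vP).
have E : u * Zpadic vP = 1.
  by apply: zpadicP => k; rewrite residueM /= uv.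
by rewrite mulrC E.
Qed.

(** As long as the residue modulo [p] is zero, a factor [p] is taken out. This lowers the index of a
    nonzero residue, so the process stops. *)
Lemma zpadic_decomp x : x != 0 ->
  exists k, exists2 u, u \is a GRing.unit & x = p%:R ^+ k * u.
Proof.
move=> x0.
have [k xk] : exists k, residue x k != 0.
  apply/not_existsP => h; move/eqP: x0; apply; apply: zpadicP => k.
  by move: (h k) => /negP; rewrite negbK => /eqP.
elim: k x x0 xk => [|k IH] x x0 xk.
  by exists 0%N, x; rewrite ?mul1r//; exact: zpadic_unit_residue.
have [r0|r0] := eqVneq (residue x 0) 0; last first.
  by exists 0%N, x; rewrite ?mul1r//; exact: zpadic_unit_residue.
have [y xE] := zpadic_divp r0; rewrite expr1 in xE.
have y0 : y != 0 by apply: contra x0 => /eqP y0; rewrite xE y0 mulr0.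
have yk : residue y k != 0.
  apply: contra xk => /eqP /zpadic_divp[z yE].
  rewrite xE yE mulrA -exprS residueM.
  rewrite [X in X * _](_ : _ = 0) ?mul0r//.
  apply: val_inj; rewrite -natrX residue_nat [LHS](val_natZ p _ k.+1) modnn.
  by [].
have [j [u uu yE]] := IH y y0 yk.
by exists j.+1, u => //; rewrite xE yE exprS mulrA.
Qed.

Lemma zpadic_dvd_ppow x : x != 0 -> exists k y, p%:R ^+ k = x * y.
Proof.
move=> /zpadic_decomp[k [u uu ->]]; exists k, u^-1.
by rewrite -mulrA divrr// mulr1.
Qed.

Lemma zpadic_nat_unit n : ~~ (p %| n)%N -> (n%:R : zpadic p) \is a GRing.unit.
Proof.
move=> pn; apply: zpadic_unit_residue; apply: contra pn => /eqP.
rewrite residue_nat => /(congr1 val); rewrite [LHS](val_natZ p n 0) expn1 /=.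
by move=> /eqP.
Qed.

End PadicArithmetic.

Section Fractions.
Import generic_quotient.

Lemma fraction_numden (T : idomainType) (x : {fraction T}) :
  exists n d : T, d != 0 /\ x * tofrac d = tofrac n.
Proof.
elim/quotW: x => y; exists (frac y).1, (frac y).2.
split; first exact: denom_ratioP.
rewrite /tofrac; unlock FracField.tofrac.
apply/eqP; rewrite -[_ * _]/(FracField.mul _ _) !piE.
rewrite FracField.equivfE /FracField.mulf !numden_Ratio ?mulf_neq0 ?oner_neq0 ?denom_ratioP//.
by rewrite !mulr1 mulrC.
Qed.

End Fractions.

Section PadicField.
Variable p : primeN.
Implicit Types (x y : padic p).

Lemma padic_nat n : n%:R = tofrac n%:R :> padic p.
Proof. by rewrite rmorph_nat. Qed.

Lemma padic_int_nat n : padic_int (n%:R : padic p).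
Proof. by exists n%:R => //; rewrite padic_nat. Qed.

Lemma padic_nat_neq0 n : (0 < n)%N -> (n%:R : padic p) != 0.
Proof.
by case: n => // n _; rewrite padic_nat tofrac_eq0 zpadic_nat_neq0.
Qed.

Lemma padic_intV_nat n : ~~ (p %| n)%N -> padic_int (n%:R^-1 : padic p).
Proof.
move=> pn; have n0 : (0 < n)%N by case: n pn; rewrite ?dvdn0.
exists n%:R^-1 => //; apply: (mulfI (padic_nat_neq0 n0)).
rewrite divff ?padic_nat_neq0// padic_nat -tofracM divrr ?tofrac1//.
exact: zpadic_nat_unit.
Qed.

Lemma padic_int_ppow x : exists k, padic_int (p%:R ^+ k * x).
Proof.
have [n [d [d0 xE]]] := fraction_numden x.
have [k [y kE]] := zpadic_dvd_ppow d0.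
exists k; exists (n * y) => //.
by rewrite tofracM -xE -mulrA -tofracM -kE -natrX -padic_nat natrX mulrC.
Qed.

Lemma padic_ballP x k y :
  padic_ball x k y <-> exists2 z, padic_int z & y = x + p%:R ^+ k * z.
Proof.
have E z : tofrac (p%:R ^+ k * z) = p%:R ^+ k * tofrac z :> padic p.
  by rewrite tofracM -natrX -padic_nat natrX.
split=> [[z _ <-]|[_ [z _ <-] ->]].
  by exists (tofrac z); [exists z|rewrite E].
by exists z => //; rewrite E.
Qed.

Lemma padic_int_dvdn (m n : nat) z k : padic_int z ->
  n%:R * z = m%:R :> padic p -> (p ^ k %| n)%N -> (p ^ k %| m)%N.
Proof.
case: k => [|k]; first by rewrite !expn0 !dvd1n.
move=> [w _ <-]; rewrite !padic_nat -tofracM => /(@tofrac_inj p) E pn.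
have := congr1 (fun x : zpadic p => val (residue x k)) E; rewrite residueM !residue_nat.
rewrite (_ : (n%:R : 'Z_(p ^ k.+1)) = 0); last first.
  by apply: val_inj; rewrite [LHS](val_natZ p n k); apply/eqP.
by rewrite mul0r [X in _ = X -> _](val_natZ p m k) => /esym/eqP.
Qed.

End PadicField.

Section FiniteAdeleArithmetic.
Implicit Types (x y z : finadele) (n m j : nat) (p q : primeN).

Lemma component_nat n p : (n%:R : finadele) p = n%:R.
Proof. by elim: n => [//|n IH]; rewrite -!natr1 componentD IH. Qed.

Lemma ZhatD x y : Zhat x -> Zhat y -> Zhat (x + y).
Proof. by move=> Zx Zy p; exact: padic_intD. Qed.
Lemma ZhatN x : Zhat x -> Zhat (- x).
Proof. by move=> Zx p; exact: padic_intN. Qed.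
Lemma ZhatM x y : Zhat x -> Zhat y -> Zhat (x * y).
Proof. by move=> Zx Zy p; exact: padic_intM. Qed.
Lemma Zhat_nat n : Zhat n%:R.
Proof. by move=> p; rewrite component_nat; exact: padic_int_nat. Qed.

(** The subgroups [n Zhat] and, below it, [n^-1 Zhat], the latter described without inverting [n].
    The product of their elements lies in [Zhat]. *)
Definition UZ n : set finadele := [set x | exists2 z, Zhat z & x = n%:R * z].
Definition VZ n : set finadele := [set x | Zhat (n%:R * x)].

Lemma primeN_inj p q : (p : nat) = q -> p = q.
Proof. exact: (@val_inj _ _ primeN). Qed.

Lemma finite_primes_dvd n : (0 < n)%N -> finite_set [set p : primeN | (p %| n)%N].
Proof.
move=> n0; apply: (@sub_finite_set _ _ ((fun p : primeN => p : nat) @^-1` `I_n.+1)).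
  by move=> p /= pn; rewrite ltnS dvdn_leq.
by apply: finite_preimage => // p q _ _; exact: primeN_inj.
Qed.

Lemma finadele_nat_unit n : (0 < n)%N -> exists y, n%:R * y = 1.
Proof.
move=> n0.
have fi : finite_set [set p : primeN | ~ padic_int (n%:R^-1 : padic p)].
  apply: sub_finite_set (finite_primes_dvd n0) => p /= np.
  by apply/negPn/negP => /padic_intV_nat.
exists (FinAdele fi); apply: finadele_eq => p.
by rewrite componentM component_nat /= divff// padic_nat_neq0.
Qed.

(** The inverse of [n] in the ring of finite adeles; the default value 0 is reached only for
    [n = 0]. *)
Definition finv n : finadele := xget 0 [set y | n%:R * y = 1].

Lemma finvP n : (0 < n)%N -> n%:R * finv n = 1.
Proof. by move=> /finadele_nat_unit /(xgetPex 0). Qed.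

Lemma finvK n x : (0 < n)%N -> n%:R * (finv n * x) = x.
Proof. by move=> /finvP h; rewrite mulrA h mul1r. Qed.

Lemma natK_finv n x : (0 < n)%N -> finv n * (n%:R * x) = x.
Proof. by move=> /finvP h; rewrite mulrA [finv n * _]mulrC h mul1r. Qed.

Lemma finv_component n p : (0 < n)%N -> finv n p = n%:R^-1.
Proof.
move=> n0; apply: (mulfI (padic_nat_neq0 p n0)).
by rewrite divff ?padic_nat_neq0// -component_nat -componentM finvP.
Qed.

Lemma finadele_natI n : (0 < n)%N -> injective (fun x => n%:R * x).
Proof. by move=> n0 x y /= /(congr1 ( *%R (finv n))); rewrite !natK_finv. Qed.

Lemma ppow_common_multiple (A : set primeN) (k : primeN -> nat) : finite_set A ->
  exists2 n, (0 < n)%N & forall p, A p -> (p ^ k p %| n)%N.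
Proof.
move=> /finite_seqP[s ->]; exists (\prod_(p <- s) p ^ k p)%N.
  by apply: prodn_gt0 => p; rewrite expn_gt0 prime_gt0// Defs.primeP.
by move=> p /= ps; rewrite (big_rem p)//= dvdn_mulr.
Qed.

Lemma finadele_den x : exists2 n, (0 < n)%N & VZ n x.
Proof.
have /choice[k kx] p : exists k, padic_int (p%:R ^+ k * x p : padic p).
  exact: padic_int_ppow.
have [n n0 nP] := ppow_common_multiple k (finadeleP x).
exists n => // p; rewrite componentM component_nat.
have [xp|/nP/dvdnP[m ->]] := pselect (padic_int (x p)).
  by apply: padic_intM => //; exact: padic_int_nat.
rewrite natrM natrX -mulrA; apply: padic_intM => //; exact: padic_int_nat.
Qed.

(** Only the component at [p] constrains the digit [i]: at any other prime, [p] is a unit and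
    division by it preserves integrality. *)
Lemma Zhat_residue_prime p z : Zhat z -> exists2 i, (i < p)%N & UZ p (z - i%:R).
Proof.
move=> Zz; have [w _ zE] := Zz p; pose i := residue w 0.
have p0 : (0 < p)%N by rewrite prime_gt0// Defs.primeP.
exists (i : nat); first by rewrite -[X in (_ < X)%N](expn1 p); exact: ltn_modulus.
exists (finv p * (z - (i : nat)%:R)); last by rewrite finvK.
move=> q; have [->|qp] := eqVneq q p.
  have r0 : residue (w - (i : nat)%:R) 0 = 0.
    by rewrite residueD residueN residue_nat natr_Zp subrr.
  have [y yE] := zpadic_divp r0.
  exists y => //; apply: (mulfI (padic_nat_neq0 p p0)).
  rewrite -component_nat -componentM finvK// componentD componentN !component_nat.
  by rewrite -zE !padic_nat -tofracB -tofracM yE expr1.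
have qp' : ~~ (q %| p)%N.
  apply: contra qp => /(prime_nt_dvdP (Defs.primeP p)) h.
  by apply/eqP/primeN_inj/h; rewrite gtn_eqF// primeN_gt1.
rewrite componentM finv_component//; apply: padic_intM.
  exact: padic_intV_nat.
by apply: padic_intD => //; apply: padic_intN; rewrite component_nat; exact: padic_int_nat.
Qed.

(** Density of the integers in [Zhat], by induction on [n = m p]: if [y = j + m z] and
    [z = i + p w], then [y = (j + m i) + n w]. *)
Lemma Zhat_residue n y : (0 < n)%N -> Zhat y ->
  exists2 j, (j < n)%N & UZ n (y - j%:R).
Proof.
elim/ltn_ind: n y => n IH y n0 Zy.
have [n1|n1] := leqP n 1.
  have -> : n = 1%N by case: n n0 n1 {IH} => [|[]].
  by exists 0%N => //; exists y; rewrite // subr0 mul1r.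
have pr := pdiv_prime n1; pose p := PrimeN pr.
have [m nE] := dvdnP (pdiv_dvd n).
have m0 : (0 < m)%N by case: m nE n0 => // ->.
have mn : (m < n)%N by rewrite nE ltn_Pmulr// prime_gt1.
have [j jm [z Zz zE]] := IH m mn y m0 Zy.
have [i ip [w Zw wE]] := Zhat_residue_prime p Zz.
exists (j + m * i)%N.
  rewrite nE; apply: leq_trans (_ : m + m * i <= _)%N; first by rewrite ltn_add2r.
  by rewrite -mulnS leq_mul2l ip orbT.
exists w => //; rewrite nE natrM -mulrA -[(pdiv n)%:R * w]wE mulrBr -zE.
by rewrite natrD natrM opprD addrA.
Qed.

Lemma UZ_nat n m : (0 < n)%N -> UZ n m%:R -> (n %| m)%N.
Proof.
move=> n0 [z Zz zE]; apply/dvdn_partP => // p.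
rewrite mem_primes => /and3P[pr _ _]; rewrite p_part.
apply: (@padic_int_dvdn (PrimeN pr) m n (z (PrimeN pr))).
- exact: Zz.
- by rewrite -!component_nat -componentM zE.
- exact: pfactor_dvdnn.
Qed.

Lemma UZD n x y : UZ n x -> UZ n y -> UZ n (x + y).
Proof.
by move=> [a Za ->] [b Zb ->]; exists (a + b); [exact: ZhatD|rewrite mulrDr].
Qed.

Lemma UZN n x : UZ n x -> UZ n (- x).
Proof. by move=> [a Za ->]; exists (- a); [exact: ZhatN|rewrite mulrN]. Qed.

Lemma UZB n x y : UZ n x -> UZ n y -> UZ n (x - y).
Proof. by move=> Ux /UZN; exact: UZD. Qed.

Lemma UZ0 n : UZ n 0.
Proof. by exists 0; rewrite ?mulr0//; exact: (Zhat_nat 0). Qed.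

Lemma UZ_Zhat n x : UZ n x -> Zhat x.
Proof. by move=> [z Zz ->]; apply: ZhatM => //; exact: Zhat_nat. Qed.

Lemma UZP n x : (0 < n)%N -> UZ n x <-> Zhat (finv n * x).
Proof.
move=> n0; split=> [[y Zy ->]|Zx]; first by rewrite natK_finv.
by exists (finv n * x); rewrite // finvK.
Qed.

(* The cosets of [n Zhat] in [n^-1 Zhat] are represented by the [j / n]. *)
Definition coset n j : set finadele := [set x | UZ n (x - j%:R * finv n)].

(** Multiplication by [n] carries the quotient of [n^-1 Zhat] by [n Zhat] to that of [Zhat] by
    [n^2 Zhat], where [Zhat_residue] applies. *)
Lemma VZ_coset n x : (0 < n)%N -> VZ n x ->
  exists2 j, (j < n ^ 2)%N & coset n j x.
Proof.
move=> n0 Vx; have n20 : (0 < n ^ 2)%N by rewrite expn_gt0 n0.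
have [j jn [z Zz zE]] := Zhat_residue n20 Vx.
exists j => //; exists z => //; apply: (finadele_natI n0).
by rewrite mulrBr [j%:R * _]mulrC finvK// zE natrX expr2 mulrA.
Qed.

Lemma UZ_residue_inj n x i j : (i < n)%N -> (j < n)%N ->
  UZ n (x - i%:R) -> UZ n (x - j%:R) -> i = j.
Proof.
wlog ij : i j / (i <= j)%N.
  move=> h i2 j2 ci cj; have [ij|/ltnW ji] := leqP i j; first exact: h ij i2 j2 ci cj.
  by apply/esym; apply: h.
move=> i2 j2 ci cj; have n0 := leq_ltn_trans (leq0n i) i2.
have : UZ n (j - i)%:R.
  rewrite natrB// (_ : _ - _ = (x - i%:R) - (x - j%:R)); last by ring.
  exact: UZB.
move=> /(UZ_nat n0) /dvdn_leq h; apply/eqP; rewrite eqn_leq ij /= leqNgt.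
apply/negP => ji; have := h; rewrite subn_gt0 => /(_ ji).
by rewrite leqNgt (leq_ltn_trans (leq_subr _ _) j2).
Qed.

Lemma coset_mul n j x : (0 < n)%N -> coset n j x ->
  UZ (n ^ 2) (n%:R * x - j%:R).
Proof.
move=> n0 [z Zz zE]; exists z => //.
rewrite natrX expr2 -mulrA -zE mulrBr; congr (_ - _).
by rewrite mulrCA finvP// mulr1.
Qed.

Lemma coset_VZ n j x : (0 < n)%N -> coset n j x -> VZ n x.
Proof.
move=> n0 /(coset_mul n0)/UZ_Zhat h; rewrite /VZ /= -[_ * x](subrK j%:R).
by apply: ZhatD => //; exact: Zhat_nat.
Qed.

Lemma coset_inj n x i j : (0 < n)%N -> (i < n ^ 2)%N -> (j < n ^ 2)%N ->
  coset n i x -> coset n j x -> i = j.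
Proof.
move=> n0 i2 j2 /(coset_mul n0) ci /(coset_mul n0) cj.
exact: UZ_residue_inj i2 j2 ci cj.
Qed.

End FiniteAdeleArithmetic.

(** * Cofinality of the subgroups [n Zhat] and [n^-1 Zhat] *)

Section FiniteAdeleTopology.
Implicit Types (x y z c d : finadele) (n m : nat) (H K : set finadele).

Lemma finadele_mul_continuous c : continuous (fun x => c * x).
Proof.
move=> x U /= /nbhs_finadele[k fk kU].
(* The exponent clears the denominator of [c] at [p]; being zero at almost all primes, it gives a
   basic neighbourhood. *)
have /choice[e eP] p : exists e, (padic_int (c p) -> e = 0%N) /\
    padic_int (p%:R ^+ e * c p).
  have [cp|cp] := pselect (padic_int (c p)).
    by exists 0%N; rewrite mul1r.
  by have [e ep] := padic_int_ppow (c p); exists e.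
apply/nbhs_finadele; exists (fun p => k p + e p)%N.
  have : finite_set ([set p | k p <> 0%N] `|` [set p | ~ padic_int (c p)]).
    by rewrite finite_setU; split => //; exact: finadeleP.
  apply: sub_finite_set => p /= h; apply/not_andP => -[k0 cp]; apply: h.
  by rewrite k0 (eP p).1.
move=> y xy; apply: kU => p; have /padic_ballP[z Zz yE] := xy p.
apply/padic_ballP; exists (p%:R ^+ e p * c p * z).
  by apply: padic_intM => //; exact: (eP p).2.
by rewrite !componentM yE exprD; ring.
Qed.

(** Seen as the image of [Zhat] under [c], the set is compact; seen as its preimage under [d], it is
    open. *)
Lemma scaled_Zhat_subgroup c d : c * d = 1 ->
  compact_open_subgroup [set x | Zhat (d * x)].
Proof.
move=> cd; split.
- rewrite (_ : [set x | Zhat (d * x)] = (fun x => c * x) @` Zhat).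
    apply: continuous_compact; last exact: Zhat_compact.
    by apply: continuous_subspaceT; exact: finadele_mul_continuous.
  apply/seteqP; split => [x Zx|_ [z Zz <-]] /=.
    by exists (d * x) => //; rewrite mulrA cd mul1r.
  by rewrite mulrA [d * c]mulrC cd mul1r.
- apply: (open_comp (fun x _ => @finadele_mul_continuous d x)).
  exact: Zhat_open.
- by rewrite /= mulr0; exact: (Zhat_nat 0).
- by move=> x y /= Zx Zy; rewrite mulrBr; apply: ZhatD => //; exact: ZhatN.
Qed.

Lemma VZ_subgroup n : (0 < n)%N -> compact_open_subgroup (VZ n).
Proof.
by move=> /finvP h; apply: (scaled_Zhat_subgroup (c := finv n)); rewrite mulrC.
Qed.

Lemma UZ_subgroup n : (0 < n)%N -> compact_open_subgroup (UZ n).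
Proof.
move=> n0; have := scaled_Zhat_subgroup (finvP n0); congr compact_open_subgroup.
by apply/seteqP; split => x /(UZP x n0).
Qed.

Lemma UZ_VZ n : UZ n `<=` VZ n.
Proof. by move=> x /UZ_Zhat Zx; apply: ZhatM => //; exact: Zhat_nat. Qed.

Lemma bs_indexZ n : (0 < n)%N -> bs_index (VZ n) (UZ n).
Proof.
by move=> n0; split; [exact: VZ_subgroup|exact: UZ_subgroup|exact: UZ_VZ].
Qed.

Lemma UZ_dvd n m : (n %| m)%N -> UZ m `<=` UZ n.
Proof.
move=> /dvdnP[q ->] _ [z Zz ->]; exists (q%:R * z).
  by apply: ZhatM => //; exact: Zhat_nat.
by rewrite natrM mulrCA mulrA.
Qed.

Lemma VZ_dvd n m : (n %| m)%N -> VZ n `<=` VZ m.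
Proof.
move=> /dvdnP[q ->] x Zx; rewrite /VZ /= natrM -mulrA.
by apply: ZhatM => //; exact: Zhat_nat.
Qed.

Lemma open_UZ K : open K -> K 0 -> exists2 n, (0 < n)%N & UZ n `<=` K.
Proof.
move=> oK K0; have /nbhs_finadele[k fk kK] : nbhs 0 K by exact: open_nbhs_nbhs.
have [n n0 nP] := ppow_common_multiple k fk; exists n => // _ [z Zz ->].
apply: kK => p; apply/padic_ballP.
have [k0|/nP/dvdnP[m nE]] := pselect (k p = 0%N).
  exists (n%:R * z p).
    by apply: padic_intM => //; exact: padic_int_nat.
  by rewrite k0 mul1r add0r componentM component_nat.
exists (m%:R * z p).
  by apply: padic_intM => //; exact: padic_int_nat.
by rewrite add0r componentM component_nat nE natrM natrX mulrCA mulrA.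
Qed.

Lemma compact_VZ H : compact H -> exists2 n, (0 < n)%N & H `<=` VZ n.
Proof.
rewrite compact_cover => cH.
have [D _ DH] : finite_subset_cover [set: nat] (fun n => VZ n.+1) H.
  apply: cH => [n _|x _]; first by case: (VZ_subgroup (ltn0Sn n)).
  by have [n n0 Vx] := finadele_den x; exists n.-1; rewrite // prednK.
exists (\prod_(i <- finmap.enum_fset D) i.+1)%N; first exact: prodn_gt0.
move=> x /DH[n /= nD]; apply: VZ_dvd.
by rewrite (big_rem n nD)//= dvdn_mulr.
Qed.

(** Compactness bounds the denominators in [H], and openness puts some [m Zhat] inside [K]; the
    product of the two integers serves both purposes. *)
Lemma bs_level H K : bs_index H K -> exists2 n, (0 < n)%N &
  H `<=` VZ n /\ UZ n `<=` K.
Proof.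
move=> [[cH _ _ _] [_ oK K0 _] _].
have [n n0 nH] := compact_VZ cH; have [m m0 mK] := open_UZ oK K0.
exists (n * m)%N; first by rewrite muln_gt0 n0.
split; first by apply: subset_trans nH _; apply: VZ_dvd; exact: dvdn_mulr.
by apply: subset_trans mK; apply: UZ_dvd; exact: dvdn_mull.
Qed.

End FiniteAdeleTopology.

(** * The character of the finite adeles *)

Section FiniteCharacter.
Variable R : realType.
Implicit Types (x y z : finadele) (a b c d n m : nat).

(* [x] and the rational number [a / b] differ by an element of [Zhat]. *)
Definition frep x a b := (0 < b)%N /\ UZ b (b%:R * x - a%:R).

Lemma frep_exists x : exists j n, (j < n)%N /\ frep x j n.
Proof.
have [n n0 Vx] := finadele_den x.
by have [j jn h] := Zhat_residue n0 Vx; exists j, n.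
Qed.

Lemma intr_abs (F : pzRingType) (k : int) : 0 <= k -> k%:~R = `|k|%N%:R :> F.
Proof. by case: k. Qed.

Lemma padic_ratr p (q : rat) : (denq q)%:~R * ratr q = (numq q)%:~R :> padic p.
Proof.
rewrite /ratr mulrC divfK// intr_abs ?ltW ?denq_gt0//.
by apply: padic_nat_neq0; rewrite absz_gt0 gt_eqF.
Qed.

Lemma padic_ratr_frac p (j n : nat) : (0 < n)%N ->
  n%:R * ratr (j%:Q / n%:Q) = j%:R :> padic p.
Proof.
move=> n0; set q := _ / _.
have d0 : (`|denq q|%N%:R : padic p) != 0.
  by apply: padic_nat_neq0; rewrite absz_gt0 gt_eqF.
have dE : (denq q)%:~R = `|denq q|%N%:R :> padic p.
  by rewrite intr_abs// ltW ?denq_gt0.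
have E : (n%:Z * numq q = j%:Z * denq q)%R.
  apply: (@intr_inj rat); rewrite !intrM.
  have nq : n%:Z%:~R * q = j%:Z%:~R by rewrite /q mulrC divfK// pnatr_eq0 -lt0n.
  by rewrite numqE mulrA nq.
apply: (mulfI d0); rewrite mulrCA -dE padic_ratr.
by have := congr1 (fun k : int => k%:~R : padic p) E; rewrite !intrM [RHS]mulrC.
Qed.

Lemma frac_partP x : 0 <= frac_part x < 1 /\
  forall p, padic_int (x p - ratr (frac_part x)).
Proof.
apply: (xgetPex 0 (P := [set q : rat | 0 <= q < 1 /\ forall p, padic_int (x p - ratr q)])).
have [j [n [jn [n0 [z Zz zE]]]]] := frep_exists x.
exists (j%:Q / n%:Q); split.
  rewrite divr_ge0 ?ler0n//= ltr_pdivrMr ?mul1r ?ltr_int// ltr0z.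
  exact: n0.
move=> p; have -> : x p - ratr (j%:Q / n%:Q) = z p.
  apply: (mulfI (padic_nat_neq0 p n0)).
  rewrite mulrBr padic_ratr_frac// -!component_nat -!componentM -zE.
  by rewrite componentD componentN.
exact: Zz.
Qed.

Lemma frep_frac_part x :
  frep x `|numq (frac_part x)|%N `|denq (frac_part x)|%N.
Proof.
have [/andP[q0 _] h] := frac_partP x; set q := frac_part x in q0 h *.
split; first by rewrite absz_gt0 gt_eqF.
have fz : finite_set [set p | ~ padic_int (x p - ratr q)] by exact: finadele_finZ.
exists (FinAdele fz) => //; apply: finadele_eq => p.
rewrite !componentM componentD componentN componentM !component_nat /= mulrBr.
congr (_ - _); have := padic_ratr p q.
have nq : 0 <= numq q by rewrite numq_ge0.
by rewrite (intr_abs _ (ltW (denq_gt0 q))) (intr_abs _ nq).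
Qed.

(** The two fractions differ by a rational number lying in [Zhat], that is, by an integer, as
    [UZ_nat] shows. *)
Lemma frep_expi x a b c d : frep x a b -> frep x c d ->
  expi (a%:R / b%:R : R) = expi (c%:R / d%:R).
Proof.
wlog le_cross : a b c d / (c * b <= a * d)%N.
  move=> h xab xcd; have [le|/ltnW le] := leqP (c * b) (a * d); first exact: h.
  by apply/esym; apply: h.
move=> [b0 [z Zz zE]] [d0 [w Zw wE]].
have : UZ (b * d) (a * d - c * b)%:R.
  exists (w - z); first by apply: ZhatD => //; exact: ZhatN.
  rewrite natrB// !natrM.
  have -> : b%:R * d%:R * (w - z) = b%:R * (d%:R * w) - d%:R * (b%:R * z) by ring.
  by rewrite -zE -wE; ring.
move=> /UZ_nat; rewrite muln_gt0 b0 d0 => /(_ isT)/dvdnP[k kE].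
have -> : a%:R / b%:R = c%:R / d%:R + k%:R :> R.
  have : (a * d)%:R = (k * (b * d) + c * b)%:R :> R by rewrite -kE subnK.
  have bn0 : (b%:R : R) != 0 by rewrite pnatr_eq0 -lt0n.
  have dn0 : (d%:R : R) != 0 by rewrite pnatr_eq0 -lt0n.
  rewrite natrD !natrM => h.
  apply: (mulIf bn0); apply: (mulIf dn0); rewrite divfK// h.
  by field; rewrite dn0.
by rewrite expiD expi_nat mulr1.
Qed.

Definition chif x : R[i] := expi (ratr (frac_part x)).

Lemma chiE (x : adele R) : chi x = expi (- x.1) * chif x.2.
Proof. by rewrite -expiD. Qed.

Lemma chifE x a b : frep x a b -> chif x = expi (a%:R / b%:R).
Proof.
move=> xab; rewrite -(frep_expi (frep_frac_part x) xab) /chif; congr expi.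
have [/andP[q0 _] _] := frac_partP x; set q := frac_part x in q0 *.
have nq : 0 <= numq q by rewrite numq_ge0.
by rewrite /ratr (intr_abs _ (ltW (denq_gt0 q))) (intr_abs _ nq).
Qed.

(** The fractional part is not additive, but [chif] may be computed from any rational
    representative, and the sum of representatives of [x] and [y] represents [x + y]. *)
Lemma chifD x y : chif (x + y) = chif x * chif y.
Proof.
have xf := frep_frac_part x; have yf := frep_frac_part y.
move: xf yf; set a := absz _; set b := absz _; set c := absz _; set d := absz _.
move=> xab ycd; rewrite (chifE xab) (chifE ycd) -expiD.
case: (xab) => b0 [z Zz zE]; case: (ycd) => d0 [w Zw wE].
have h : frep (x + y) (a * d + c * b) (b * d).
  split; first by rewrite muln_gt0 b0.
  exists (z + w); first exact: ZhatD.
  rewrite natrD !natrM.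
  have -> : b%:R * d%:R * (z + w) = d%:R * (b%:R * z) + b%:R * (d%:R * w) by ring.
  by rewrite -zE -wE; ring.
rewrite (chifE h) natrD !natrM; congr expi.
by field; rewrite !pnatr_eq0 -!lt0n d0.
Qed.

Lemma chif_Zhat x : Zhat x -> chif x = 1.
Proof.
move=> Zx; rewrite (@chifE x 0 1) ?mul0r ?expi0//; split => //.
by exists x => //; rewrite mul1r subr0.
Qed.

(** Modulo [Zhat], [x] is a fraction in [[0, 1)], where [expi] takes the value 1 only at 0. Both the
    support of transforms and the orthogonality of characters depend on this. *)
Lemma chif_eq1 x : chif x = 1 -> Zhat x.
Proof.
have [j [n [jn xjn]]] := frep_exists x; rewrite (chifE xjn) => e1.
have [n0 [z Zz zE]] := xjn; have [j0|j0] := posnP j.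
  by rewrite (finadele_natI n0 (x1 := x) (x2 := z))// -zE j0 subr0.
suff /expi_neq1/eqP : 0 < (j%:R / n%:R : R) < 1 by [].
by rewrite divr_gt0 ?ltr0n//= ltr_pdivrMr ?ltr0n// mul1r ltr_nat.
Qed.

End FiniteCharacter.

(** * Integration over the adeles *)

Section ProductIndicator.
Context d (T : measurableType d) (R : realType).
Variable m : {sigma_finite_measure set T -> \bar R}.
Variables (A : set T) (c : R).
Hypotheses (mA : measurable A) (mAc : m A = c%:E).

Lemma integral_indic_fin : (\int[m]_y (\1_A y)%:E)%E = c%:E.
Proof. by rewrite integral_indic// setIT; exact: mAc. Qed.

Lemma integrable_indic_fin : m.-integrable setT (fun y => (\1_A y)%:E).
Proof.
apply/integrableP; split; first exact/measurable_EFinP.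
under eq_integral do rewrite gee0_abs ?lee_fin//.
by rewrite integral_indic_fin ltry.
Qed.

Lemma integral_indicZ (r : R) : (\int[m]_y (r * \1_A y)%:E)%E = (c * r)%:E.
Proof.
under eq_integral do rewrite EFinM.
rewrite integralZl//; last exact: integrable_indic_fin.
by rewrite integral_indic_fin -EFinM mulrC.
Qed.

Lemma integrable_prod_indic (u : R -> R) :
  leb.-integrable setT (EFin \o u) ->
  (leb \x m)%E.-integrable setT (fun x : R * T => (u x.1 * \1_A x.2)%:E) /\
  (\int[leb \x m]_x (u x.1 * \1_A x.2)%:E)%E = (c * \int[leb]_t u t)%:E.
Proof.
move=> iu.
have I : (leb \x m)%E.-integrable setT (fun x : R * T => (u x.1 * \1_A x.2)%:E).
  apply/(integrable12ltyP leb m).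
    apply/measurable_EFinP; apply: measurable_funM.
      apply: measurableT_comp => //.
      by apply/measurable_EFinP; exact: measurable_int iu.
    by apply: measurableT_comp => //; exact: measurable_indic.
  under eq_integral.
    move=> x _; under eq_integral.
      move=> y _; rewrite /= normrM [`|\1_A y|]ger0_norm//; over.
    rewrite integral_indicZ EFinM.
    over.
  rewrite /= integralZl//; last exact: integrable_norm iu.
  apply: lte_mul_pinfty; rewrite ?lee_fin//.
    by rewrite -lee_fin -mAc measure_ge0.
  by have /integrableP[_] := iu.
split => //; rewrite -(integral12_prod_meas1 I) /fubini_F.
under eq_integral do rewrite /= integral_indicZ EFinM.
rewrite integralZl// EFinM /Rintegral fineK//.
exact: integrable_fin_num iu.
Qed.

Lemma cintegral_prod_indic (f : R -> R[i]) : cintegrable leb f ->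
  cintegrable (leb \x m)%E (fun x : R * T => f x.1 * (\1_A x.2)%:C%C) /\
  cintegral (leb \x m)%E (fun x : R * T => f x.1 * (\1_A x.2)%:C%C) =
    c%:C%C * cintegral leb f.
Proof.
move=> [fR fI].
have [iR eR] := integrable_prod_indic fR.
have [iI eI] := integrable_prod_indic fI.
have RE (x : R * T) : Re (f x.1 * (\1_A x.2)%:C%C) = Re (f x.1) * \1_A x.2.
  by rewrite ReM /= mulr0 subr0.
have IE (x : R * T) : Im (f x.1 * (\1_A x.2)%:C%C) = Im (f x.1) * \1_A x.2.
  by rewrite ImM /= mulr0 add0r.
split.
  by split; [under eq_fun do rewrite RE|under eq_fun do rewrite IE].
apply: complex_eq; rewrite ?ReM ?ImM /= mul0r ?subr0 ?addr0.
  by under eq_Rintegral do rewrite RE; rewrite /Rintegral eR.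
by under eq_Rintegral do rewrite IE; rewrite /Rintegral eI.
Qed.

End ProductIndicator.

Section AdeleIntegral.
Variables (R : realType) (mu : {sigma_finite_measure set finadele -> \bar R}).
Hypothesis mu_haar : normalized_haar mu.
Implicit Types (n j : nat) (x : adele R).

Lemma open_measurable_finadele (A : set finadele) : open A -> measurable A.
Proof. by move=> oA; exact: sub_sigma_algebra. Qed.

Lemma measurable_UZ n : (0 < n)%N -> measurable (UZ n).
Proof.
by move=> n0; apply: open_measurable_finadele; case: (UZ_subgroup n0).
Qed.

Lemma measurable_shift y (A : set finadele) : open A ->
  measurable [set x : finadele | A (x - y)].
Proof.
move=> oA; apply: open_measurable_finadele.
apply: (@open_comp _ _ (fun x : finadele => x - y) A) => // x _.
exact: finadele_shift_continuous.
Qed.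

Lemma haar_shift y (A : set finadele) : measurable A ->
  mu [set x : finadele | A (x - y)] = mu A.
Proof.
move=> mA; rewrite -(mu_haar.1 y _ mA); congr (mu _).
apply/seteqP; split => [x Ax|_ [z Az <-]] /=.
  by exists (x - y) => //; rewrite addrC subrK.
by rewrite [y + z]addrC addrK.
Qed.

(** [Zhat] has mass one and is the disjoint union of [n] translates of [n Zhat]. *)
Lemma mu_UZ n : (0 < n)%N -> mu (UZ n) = (n%:R^-1)%:E.
Proof.
move=> n0; have oU : open (UZ n) by case: (UZ_subgroup n0).
pose F (j : nat) : set finadele := [set x | UZ n (x - j%:R)].
have mF j : measurable (F j) by exact: measurable_shift.
have ZF : Zhat = \big[setU/set0]_(j < n) F j.
  rewrite -bigcup_mkord; apply/seteqP; split => [x Zx|x [j _]].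
    by have [j jn h] := Zhat_residue n0 Zx; exists j.
  move=> /UZ_Zhat h; rewrite -[x](subrK (j%:R)); apply: ZhatD => //.
  exact: Zhat_nat.
have tF : trivIset setT (fun j : 'I_n => F j).
  apply/trivIsetP => i j _ _ ij; apply/seteqP; split => // x [xi xj].
  move/eqP: ij; apply; apply: val_inj.
  exact: UZ_residue_inj (ltn_ord i) (ltn_ord j) xi xj.
have Ufin : mu (UZ n) \is a fin_num.
  rewrite ge0_fin_numE//; apply: le_lt_trans (ltry 1).
  rewrite -mu_haar.2 le_measure ?inE//; first exact: measurable_UZ.
    exact: open_measurable_finadele Zhat_open.
  exact: UZ_Zhat.
have := mu_haar.2; rewrite ZF measure_semi_additive_ord//; last first.
  by rewrite -ZF; exact: open_measurable_finadele Zhat_open.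
rewrite (eq_bigr (fun=> (fine (mu (UZ n)))%:E)); last first.
  by move=> j _; rewrite fineK//; apply: haar_shift; exact: measurable_UZ.
rewrite sumEFin sumr_const card_ord => -[] h; rewrite -(fineK Ufin); congr EFin.
have nn0 : (n%:R : R) != 0 by rewrite pnatr_eq0 -lt0n.
by apply: (mulIf nn0); rewrite mulVf// mulr_natr.
Qed.

Lemma mu_coset n j : (0 < n)%N -> mu (coset n j) = (n%:R^-1)%:E.
Proof.
by move=> n0; rewrite -mu_UZ//; apply: haar_shift; exact: measurable_UZ.
Qed.

Lemma measurable_coset n j : (0 < n)%N -> measurable (coset n j).
Proof. by move=> n0; apply: measurable_shift; case: (UZ_subgroup n0). Qed.

(* As a function of its second variable, [g] takes n^2 values, each on a set  *)
(* of measure 1 / n.                                                          *)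
Lemma cintegral_adele n (g : adele R -> R[i]) : (0 < n)%N ->
  (forall x, ~ VZ n x.2 -> g x = 0) ->
  (forall x k, UZ n k -> g (x + (0, k)) = g x) ->
  (forall a, cintegrable leb (fun t => g (t, a))) ->
  cintegrable (adele_haar mu) g /\
  cintegral (adele_haar mu) g =
    n%:R^-1 * \sum_(j < n ^ 2) cintegral leb (fun t => g (t, j%:R * finv n)).
Proof.
move=> n0 g0 gU ig.
pose G (j : 'I_(n ^ 2)) x := g (x.1, j%:R * finv n) * (\1_(coset n j) x.2)%:C%C.
have gE : g = (fun x => \sum_(j < n ^ 2) G j x).
  apply/funext => x; have [Vx|Vx] := pselect (VZ n x.2); last first.
    rewrite g0// big1// => j _; rewrite /G indicE memNset ?mulr0//.
    by move=> /(coset_VZ n0).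
  have [j jn xj] := VZ_coset n0 Vx.
  rewrite (bigD1 (Ordinal jn))//= big1 => [|i ij].
    (* Invariance under [UZ n] moves the finite component from its representative [j / n] to
       [x.2]. *)
    rewrite addr0 /G indicE mem_set// mulr1 -[RHS](gU _ _ xj); congr g.
    by case: x {Vx xj} => s y /=; congr pair; rewrite ?addr0// addrC subrK.
  rewrite /G indicE memNset ?mulr0// => xi.
  move/eqP: ij; apply; apply: val_inj => /=.
  exact: coset_inj (ltn_ord i) jn xi xj.
have GI j := cintegral_prod_indic (measurable_coset j n0) (mu_coset j n0) (ig (j%:R * finv n)).
rewrite [X in cintegrable _ X]gE [X in cintegral (adele_haar mu) X]gE; split.
  by apply: cintegrable_sum => j; case: (GI j).
rewrite cintegral_sum; last by move=> j; case: (GI j).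
rewrite mulr_sumr; apply: eq_bigr => j _; have [_ ->] := GI j.
rewrite fmorphV rmorph_nat.
by [].
Qed.

End AdeleIntegral.

(** * The Fourier transform on the adeles *)

Section FiniteSums.
Variable R : realType.
Implicit Types (x y z : finadele) (n j k : nat).
Local Notation chif := (@chif R).

Lemma sum_periodic (V : zmodType) (N s : nat) (c : nat -> V) :
  (forall j, c (j + N)%N = c j) -> \sum_(j < N) c (j + s)%N = \sum_(j < N) c j.
Proof.
move=> cN; elim: s => [|s IH]; first by apply: eq_bigr => j _; rewrite addn0.
case: N cN IH => [|N] cN IH; first by rewrite !big_ord0.
rewrite -IH big_ord_recr big_ord_recl /= addrC; congr (_ + _).
  by rewrite add0n -[RHS]cN addnC addSnnS.
by apply: eq_bigr => j _; rewrite /bump /= add1n addSnnS.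
Qed.

Lemma chifM_nat k y : chif (k%:R * y) = chif y ^+ k.
Proof.
elim: k => [|k IH]; first by rewrite mul0r chif_Zhat//; exact: (Zhat_nat 0).
by rewrite -natr1 mulrDl mul1r chifD IH exprSr.
Qed.

Lemma normc_chif x : normc (chif x) = 1.
Proof. exact: normc_expi. Qed.

Lemma chif_neq0 x : chif x != 0.
Proof.
apply/eqP => h; have := normc_chif x; rewrite h Normc.normc0 => /eqP.
by rewrite eq_sym oner_eq0.
Qed.

Lemma chifN x : chif (- x) = conjc (chif x).
Proof.
apply: (mulIf (chif_neq0 x)); rewrite -chifD addNr.
rewrite chif_Zhat; last exact: (Zhat_nat 0).
by rewrite -expiN -expiD addNr expi0.
Qed.

Lemma chif_periodic x y : Zhat y -> chif (x + y) = chif x.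
Proof. by move=> Zy; rewrite chifD [chif y]chif_Zhat// mulr1. Qed.

(** A geometric sum: multiplied by [chif y - 1], it becomes [chif (N y) - 1 = 0], and the multiplier
    is nonzero unless [y] lies in [Zhat]. *)
Lemma sum_chif N y : Zhat (N%:R * y) ->
  \sum_(k < N) chif (k%:R * y) = if `[< Zhat y >] then N%:R else 0.
Proof.
move=> ZNy; case: asboolP => Zy.
  rewrite (eq_bigr (fun=> 1)); first by rewrite sumr_const card_ord.
  by move=> k _; apply: chif_Zhat; apply: ZhatM => //; exact: Zhat_nat.
under eq_bigr do rewrite chifM_nat.
have y1 : chif y - 1 != 0.
  by rewrite subr_eq0; apply/eqP => /chif_eq1.
apply: (mulfI y1); rewrite mulr0.
have := subrX1 (chif y) N => <-.
by rewrite -chifM_nat chif_Zhat// subrr.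
Qed.

End FiniteSums.

Section AdelicFourier.
Variables (R : realType) (mu : {sigma_finite_measure set finadele -> \bar R}).
Hypothesis mu_haar : normalized_haar mu.
Implicit Types (n m j : nat) (x xi : adele R) (phi psi : adele R -> R[i]^o).
Local Notation chif := (@chif R).
Local Notation point n j := (j%:R * finv n).

Definition bs_levelZ n := @bs_step R (VZ n) (UZ n).

Lemma bs_section phi n a : bs_levelZ n phi -> schwartz (fun t => phi (t, a)).
Proof.
move=> [phi0 _ phiS]; have [Va|Va] := pselect (VZ n a); first exact: phiS.
rewrite (_ : (fun t => _) = (fun=> 0)); first exact: schwartz0.
by apply/funext => t; exact: phi0.
Qed.

Lemma bs_levelZ_dvd n m : (n %| m)%N -> bs_levelZ n `<=` bs_levelZ m.
Proof.
by move=> nm; apply: bs_step_mono; [exact: VZ_dvd|exact: UZ_dvd].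
Qed.

Lemma pair_shift (t : R) (a k : finadele) : (t, a) + (0, k) = (t, a + k) :> adele R.
Proof. by apply: injective_projections => //=; rewrite addr0. Qed.

Lemma chi_pair xi (t : R) a :
  chi (xi * (t, a)) = expi (- xi.1 * t) * chif (xi.2 * a).
Proof. by rewrite chiE mulNr. Qed.

Lemma VZ_UZ n y z : VZ n y -> UZ n z -> Zhat (y * z).
Proof. by move=> Vy [w Zw ->]; rewrite mulrA [y * _]mulrC; exact: ZhatM. Qed.

Lemma chi_shift n xi x k : VZ n xi.2 -> UZ n k ->
  chi (xi * (x + (0, k))) = chi (xi * x).
Proof.
move=> Vxi Uk; rewrite !chiE /= addr0; congr (_ * _).
by rewrite mulrDr; apply: chif_periodic; exact: VZ_UZ Uk.
Qed.

Lemma section_twist phi n a xi : bs_levelZ n phi ->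
  cintegrable leb (fun t => phi (t, a) * chi (xi * (t, a))) /\
  cintegral leb (fun t => phi (t, a) * chi (xi * (t, a))) =
    chif (xi.2 * a) * FT (fun t => phi (t, a)) xi.1.
Proof.
move=> phin; have [C dC] := schwartz_decay (bs_section a phin).
have E : (fun t => phi (t, a) * chi (xi * (t, a))) =
    (fun t => chif (xi.2 * a) * (phi (t, a) * expi (- xi.1 * t))).
  by apply/funext => t; rewrite chi_pair mulrA mulrC.
have I := FT_cintegrable xi.1 dC.
by rewrite E; split; [exact: cintegrableZ|rewrite cintegralZ].
Qed.

(** For [xi.2] in [VZ n], the character is invariant under [UZ n], so the whole integrand stays at
    level [n]. *)
Lemma fourier_levelE phi n xi : (0 < n)%N -> bs_levelZ n phi -> VZ n xi.2 ->
  cintegrable (adele_haar mu) (fun x => phi x * chi (xi * x)) /\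
  fourier mu phi xi = n%:R^-1 * \sum_(j < n ^ 2)
    chif (xi.2 * point n j) * FT (fun t => phi (t, point n j)) xi.1.
Proof.
move=> n0 phin Vxi; case: (phin) => phi0 phiU _.
have [|||I E] := @cintegral_adele R mu mu_haar n (fun x => phi x * chi (xi * x)) n0.
- by move=> x /phi0 ->; rewrite mul0r.
- by move=> x k Uk; rewrite phiU// (chi_shift _ Vxi Uk).
- by move=> a; case: (section_twist a xi phin).
split => //; rewrite /fourier E; congr (_ * _); apply: eq_bigr => j _.
by have [_ ->] := section_twist (point n j) xi phin.
Qed.

Lemma fourier_eq0 phi n xi : (0 < n)%N -> bs_levelZ n phi -> ~ VZ n xi.2 ->
  cintegrable (adele_haar mu) (fun x => phi x * chi (xi * x)) /\
  fourier mu phi xi = 0.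
Proof.
move=> n0 phin nVxi; have [d d0 Vd] := finadele_den xi.2.
(* The level is raised until [VZ m] contains [xi.2], so that the finite formula [fourier_levelE]
   becomes available. *)
pose m := (n * d)%N; have m0 : (0 < m)%N by rewrite muln_gt0 n0.
have nm : (n %| m)%N by exact: dvdn_mulr.
have Vxi : VZ m xi.2 by apply: VZ_dvd Vd; exact: dvdn_mull.
have [I ->] := fourier_levelE m0 (bs_levelZ_dvd nm phin) Vxi.
split => //; set S := (X in _ * X); suff -> : S = 0 by rewrite mulr0.
(* Translating the sum by [n] multiplies it by [chif (n xi)], which is not 1. *)
pose c j := chif (xi.2 * point m j) * FT (fun t => phi (t, point m j)) xi.1.
have [_ phiU _] := phin.
have pD j k : point m (j + k * m) = point m j + k%:R.
  by rewrite natrD mulrDl natrM -mulrA finvP// mulr1.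
have pk j k : (n %| k)%N ->
    (fun t => phi (t, point m j + k%:R)) = (fun t => phi (t, point m j)).
  move=> nk; apply/funext => t; rewrite -pair_shift phiU//.
  by have /dvdnP[q ->] := nk; exists q%:R; rewrite -?natrM 1?mulnC//; exact: Zhat_nat.
have cD j k : (n %| k)%N -> c (j + k * m)%N = chif (xi.2 * k%:R) * c j.
  by move=> nk; rewrite /c pD (pk _ _ nk) mulrDr chifD [X in X * _ = _]mulrC -mulrA.
have nu : chif (xi.2 * n%:R) - 1 != 0.
  by rewrite subr_eq0; apply/eqP => /chif_eq1; rewrite mulrC.
apply: (mulfI nu); rewrite mulr0 mulrBl mul1r mulr_sumr.
rewrite (eq_bigr (fun j : 'I_(m ^ 2) => c (j + n * m)%N)); last first.
  by move=> j _; rewrite cD.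
rewrite (@sum_periodic _ _ _ c) ?subrr// => j.
(* The period [m^2] is the shift by [m] times [m]; the character is trivial there because [m] times
   [xi.2] lies in [Zhat]. *)
rewrite expnS expn1 cD// chif_Zhat ?mul1r//.
by rewrite mulrC.
Qed.

Lemma fourier_cintegrable phi n xi : (0 < n)%N -> bs_levelZ n phi ->
  cintegrable (adele_haar mu) (fun x => phi x * chi (xi * x)).
Proof.
move=> n0 phin; have [Vxi|Vxi] := pselect (VZ n xi.2).
  by have [] := fourier_levelE n0 phin Vxi.
by have [] := fourier_eq0 n0 phin Vxi.
Qed.

Lemma fourier_sectionE phi n a : (0 < n)%N -> bs_levelZ n phi -> VZ n a ->
  (fun t => fourier mu phi (t, a)) = (fun t => n%:R^-1 * \sum_(j < n ^ 2)
    chif (a * point n j) * FT (fun s => phi (s, point n j)) t).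
Proof.
by move=> n0 phin Va; apply/funext => t; have [_ ->] := fourier_levelE n0 phin (xi := (t, a)) Va.
Qed.

(** Support and invariance exchange roles: invariance of [phi] bounds the support of the transform,
    while the points [j / n] of the sum lie in [VZ n] and therefore make it invariant under
    [UZ n]. *)
Lemma fourier_bs_levelZ phi n : (0 < n)%N -> bs_levelZ n phi ->
  bs_levelZ n (fourier mu phi).
Proof.
move=> n0 phin; have [_ _ VD VB] := VZ_subgroup n0; split.
- by move=> xi Vxi; have [_ ->] := fourier_eq0 n0 phin Vxi.
- move=> xi k Uk; have Vk := UZ_VZ Uk.
  have [Vxi|Vxi] := pselect (VZ n xi.2).
    have Vxik : VZ n (xi + (0, k)).2.
      by exact: compact_open_subgroupD (VZ_subgroup n0) Vxi Vk.
    have [_ ->] := fourier_levelE n0 phin Vxi.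
    have [_ ->] := fourier_levelE n0 phin Vxik.
    congr (_ * _); apply: eq_bigr => j _; rewrite /= addr0; congr (_ * _).
    rewrite mulrDl; apply: chif_periodic; rewrite mulrC.
    apply: VZ_UZ Uk; rewrite /VZ /= mulrCA finvP// mulr1; exact: Zhat_nat.
  have Vxik : ~ VZ n (xi + (0, k)).2.
    by move=> h; apply: Vxi; rewrite -[xi.2](addrK k); exact: VB.
  have [_ ->] := fourier_eq0 n0 phin Vxi.
  by have [_ ->] := fourier_eq0 n0 phin Vxik.
- move=> a Va; rewrite (fourier_sectionE n0 phin Va).
  apply: schwartzZ; apply: schwartz_sum => j; apply: schwartzZ.
  exact/schwartz_FT/(bs_section _ phin).
Qed.

(** Each section is a sum of [n^2] real transforms with coefficients of modulus one, up to the
    factor [1 / n]; the constant therefore depends neither on [phi] nor on [a]. *)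
Lemma fourier_sbound n N : (0 < n)%N -> exists2 c : R, 0 <= c &
  forall phi B, bs_levelZ n phi ->
  (forall a, VZ n a -> sbound (2 + N + N) B (fun t => phi (t, a))) ->
  forall a, VZ n a -> sbound N (c * B) (fun t => fourier mu phi (t, a)).
Proof.
move=> n0; have [c c0 cP] := FT_sbound R N.
exists (normc (n%:R^-1 : R[i]) * (\sum_(j < n ^ 2) c)).
  by rewrite mulr_ge0 ?normc_ge0// sumr_ge0.
move=> phi B phin hB a Va; rewrite (fourier_sectionE n0 phin Va).
have Vp j : VZ n (point n j).
  rewrite /VZ /= mulrCA finvP// mulr1; exact: Zhat_nat.
have sF j := schwartz_FT (bs_section (point n j) phin).
have sC j := schwartzZ (chif (a * point n j)) (sF j).
rewrite -mulrA mulr_suml; apply: sboundZ.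
  by case: (schwartz_sum (index_enum 'I_(n ^ 2)) (fun j : 'I__ => sC j)).
apply: sbound_sum => [j|j]; first exact: sC.
rewrite -[c * B]mul1r -(normc_chif R (a * point n j)).
apply: sboundZ; first by case: (sF j).
apply: cP; first exact: bs_section phin.
exact: hB.
Qed.

End AdelicFourier.

(** * Inversion and Parseval's equality at a fixed level *)

Section AdelicInversion.
Variables (R : realType) (mu : {sigma_finite_measure set finadele -> \bar R}).
Hypothesis mu_haar : normalized_haar mu.
Implicit Types (n m j : nat) (b : bool) (x xi : adele R).
Implicit Types (phi psi : adele R -> R[i]^o).
Local Notation chif := (@chif R).
Local Notation point n j := (j%:R * finv n).
Local Notation level := (@bs_levelZ R).

Lemma decayMM (C D : R) (f g : R -> R[i]) : decay C f -> decay D g ->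
  decay (C * D) (fun t => f t * g t).
Proof.
move=> df [gR gI gD]; apply: decayM => // t; apply: le_trans (gD t).
by rewrite ler_peMr ?normc_ge0// oneDsqr_ge1.
Qed.

Lemma adele_sign1 b xi : ((-1) ^+ b * xi).1 = (-1) ^+ b * xi.1.
Proof. by case: b; rewrite ?expr0 ?expr1 ?mul1r ?mulN1r. Qed.

Lemma adele_sign2 b xi : ((-1) ^+ b * xi).2 = (-1) ^+ b * xi.2.
Proof. by case: b; rewrite ?expr0 ?expr1 ?mul1r ?mulN1r. Qed.

Lemma Zhat_sign b y : Zhat y -> Zhat ((-1) ^+ b * y).
Proof. by case: b => Zy; rewrite ?expr0 ?expr1 ?mul1r ?mulN1r//; exact: ZhatN. Qed.

Lemma VZ_sign b n y : VZ n ((-1) ^+ b * y) <-> VZ n y.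
Proof.
have h z : VZ n z -> VZ n ((-1) ^+ b * z).
  by rewrite /VZ /= mulrCA; exact: Zhat_sign.
by split=> [/h|]; [rewrite signrMK|exact: h].
Qed.

Lemma UZ_sign b n y : UZ n y -> UZ n ((-1) ^+ b * y).
Proof. by case: b => Uy; rewrite ?expr0 ?expr1 ?mul1r ?mulN1r//; exact: UZN. Qed.

Lemma VZ_point n j : (0 < n)%N -> VZ n (point n j).
Proof. by move=> n0; rewrite /VZ /= mulrCA finvP// mulr1; exact: Zhat_nat. Qed.

(* The inner sums are discrete Fourier transforms on [Z / n^2]. *)
Lemma fourier_inversion_level phi n b x : (0 < n)%N -> level n phi -> VZ n x.2 ->
  cintegrable (adele_haar mu)
    (fun xi => fourier mu phi ((-1) ^+ b * xi) * chi (xi * x)) /\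
  cintegral (adele_haar mu)
    (fun xi => fourier mu phi ((-1) ^+ b * xi) * chi (xi * x)) =
  phi (- ((-1) ^+ b * x)).
Proof.
move=> n0 phin Vx; have Fn := fourier_bs_levelZ mu_haar n0 phin.
(* The sign -1 gives the inversion formula, and the sign 1 the square of the transform. *)
case: (Fn) => F0 FU _; set s : R := (-1) ^+ b.
have s1 : s ^+ 2 = 1 by exact: sqrr_sign.
have sec (a : finadele) :
    (fun t => fourier mu phi ((-1) ^+ b * ((t, a) : adele R)) * chi ((t, a) * x)) =
    (fun t => chif (a * x.2) *
      (fourier mu phi (s * t, (-1) ^+ b * a) * expi (- x.1 * t))).
  apply/funext => t.
  rewrite [(-1) ^+ b * _]surjective_pairing adele_sign1 adele_sign2 /=.
  by rewrite [_ * x]mulrC chi_pair [a * _]mulrC mulrA [LHS]mulrC.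
have secI (a : finadele) : cintegrable leb
    (fun t => fourier mu phi (s * t, (-1) ^+ b * a) * expi (- x.1 * t)).
  have [C dC] := schwartz_decay (bs_section ((-1) ^+ b * a) Fn).
  by have := decay_expi (- x.1) (decay_sign s1 dC); exact: decay_cintegrable.
have [|||I E] := @cintegral_adele R mu mu_haar n
    (fun xi => fourier mu phi ((-1) ^+ b * xi) * chi (xi * x)) n0.
- by move=> xi Vxi; rewrite F0 ?mul0r// adele_sign2 => /VZ_sign.
- move=> xi k Uk; rewrite [(xi + _) * x]mulrC (chi_shift _ Vx Uk) [x * xi]mulrC.
  rewrite mulrDr (_ : (-1) ^+ b * ((0, k) : adele R) = (0, (-1) ^+ b * k)).
    by rewrite FU//; exact: UZ_sign.
  by rewrite [LHS]surjective_pairing adele_sign1 adele_sign2 /= mulr0.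
- by move=> a; rewrite sec; exact: cintegrableZ.
split => //; rewrite {}E.
(* At the [k]-th point, the character of the transform and that of the outer integral combine into
   [chif (k y_j)]. By orthogonality only the [j] with [y j] in [Zhat] survives: the index of the
   coset containing the finite part of the argument of [phi]. *)
pose y j := finv n * ((-1) ^+ b * point n j + x.2).
pose f j := phi (- s * x.1, point n j).
have kE k : cintegral leb (fun t => fourier mu phi ((-1) ^+ b * ((t, point n k) : adele R)) *
      chi ((t, point n k) * x)) =
    n%:R^-1 * \sum_(j < n ^ 2) chif (k%:R * y j) * f j.
  rewrite sec cintegralZ// .
  have Vk : VZ n ((-1) ^+ b * point n k) by apply/VZ_sign; exact: VZ_point.
  have FE t := congr1 (@^~ (s * t)) (fourier_sectionE mu_haar n0 phin Vk).
  have sF j := schwartz_FT (bs_section (point n j) phin).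
  have jI j : cintegrable leb
      (fun t => FT (fun s => phi (s, point n j)) (s * t) * expi (- x.1 * t)).
    have [C dC] := schwartz_decay (sF j).
    by have := decay_expi (- x.1) (decay_sign s1 dC); exact: decay_cintegrable.
  have jE j : cintegral leb
      (fun t => FT (fun s => phi (s, point n j)) (s * t) * expi (- x.1 * t)) = f j.
    rewrite /f -(FT_inversion (- s * x.1) (bs_section (point n j) phin) s1).
    congr cintegral; apply/funext => t.
    by rewrite [s * (- s * _)]mulrA mulrN -expr2 s1 mulN1r.
  have -> : (fun t => fourier mu phi (s * t, (-1) ^+ b * point n k) * expi (- x.1 * t)) =
      (fun t => n%:R^-1 * \sum_(j < n ^ 2) chif ((-1) ^+ b * point n k * point n j) *
        (FT (fun s => phi (s, point n j)) (s * t) * expi (- x.1 * t))).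
    apply/funext => t; rewrite (FE t) -mulrA mulr_suml; congr (_ * _).
    by apply: eq_bigr => j _; rewrite [RHS]mulrA.
  have jIZ (j : 'I_(n ^ 2)) := cintegrableZ (chif ((-1) ^+ b * point n k * point n j)) (jI j).
  rewrite cintegralZ; last exact: cintegrable_sum.
  rewrite cintegral_sum// mulrCA; congr (_ * _); rewrite mulr_sumr.
  apply: eq_bigr => j _; rewrite cintegralZ// jE mulrA -chifD; congr (chif _ * _).
  by rewrite /y; ring.
rewrite (eq_bigr _ (fun (k : 'I_(n ^ 2)) _ => kE k)) -mulr_sumr exchange_big /=.
have Vmx : VZ n (- ((-1) ^+ b * x.2)).
  by rewrite -mulrN; apply/VZ_sign; rewrite /VZ /= mulrN; exact: ZhatN.
have [i i2 xi] := VZ_coset n0 Vmx.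
have yE j : Zhat (y j) <-> coset n j (- ((-1) ^+ b * x.2)).
  rewrite /y -UZP//; split => [/(UZ_sign b) /UZN|/(UZ_sign b) /UZN].
    by rewrite /coset /= mulrDr signrMK opprD addrC.
  rewrite mulrBr mulrN signrMK -opprD opprK addrC; exact.
have ny j : Zhat ((n ^ 2)%:R * y j).
  rewrite /y natrX expr2 -mulrA finvK// mulrDr.
  apply: ZhatD; last exact: Vx.
  by apply/VZ_sign; exact: VZ_point.
have sumE (j : 'I_(n ^ 2)) : \sum_(k < n ^ 2) chif (k%:R * y j) * f j =
    if j == Ordinal i2 then (n ^ 2)%:R * f j else 0.
  rewrite -mulr_suml sum_chif//; case: asboolP => [/yE xj|nxj].
    by rewrite ifT//; apply/eqP/val_inj; apply: coset_inj xj xi.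
  rewrite ifF ?mul0r//; apply/eqP => ji; apply: nxj; apply/yE.
  by rewrite ji.
rewrite (eq_bigr _ (fun (j : 'I_(n ^ 2)) _ => sumE j)) -big_mkcond big_pred1_eq /=.
have n0' : (n%:R : R[i]) != 0 by rewrite pnatr_eq0 -lt0n.
(* The factor [n^2] of the orthogonality relation cancels the two factors [1 / n], one from each
   integration. *)
rewrite natrX expr2 -mulrA mulKf// mulKf// /f.
have [_ phiU _] := phin; rewrite -(phiU _ _ xi) pair_shift; congr phi.
rewrite [RHS]surjective_pairing; congr pair.
  by rewrite -[RHS]/(- ((-1) ^+ b * x).1) adele_sign1 mulNr.
by rewrite -[RHS]/(- ((-1) ^+ b * x).2) adele_sign2 addrC subrK.
Qed.

(** The product of the two transforms is a double sum over indices [j] and [l]. Summing over the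
    points [k / n] leaves only [l = j], and each diagonal term is an instance of [FT_parseval]. *)
Lemma parseval_level phi psi n : (0 < n)%N -> level n phi -> level n psi ->
  [/\ cintegrable (adele_haar mu) (fun x => phi x * conjc (psi x)),
      cintegrable (adele_haar mu)
        (fun xi => fourier mu phi xi * conjc (fourier mu psi xi)) &
      cintegral (adele_haar mu) (fun x => phi x * conjc (psi x)) =
      cintegral (adele_haar mu)
        (fun xi => fourier mu phi xi * conjc (fourier mu psi xi))].
Proof.
move=> n0.
have key f g : level n f -> level n g ->
    cintegrable (adele_haar mu) (fun x => f x * conjc (g x)) /\
    cintegral (adele_haar mu) (fun x => f x * conjc (g x)) = n%:R^-1 *
      \sum_(j < n ^ 2) cintegral leb (fun t => f (t, point n j) * conjc (g (t, point n j))).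
  move=> fn gn; apply: (cintegral_adele mu_haar) => //.
  - by move=> x Vx; case: fn => -> //; rewrite mul0r.
  - by move=> x k Uk; case: fn gn => _ fU _ [_ gU _]; rewrite fU// gU.
  - move=> a; have [C dC] := schwartz_decay (bs_section a fn).
    have [D dD] := schwartz_decay (bs_section a gn).
    exact: decay_cintegrable (decayMM dC (decay_conjc dD)).
move=> phin psin.
have Fphi := fourier_bs_levelZ mu_haar n0 phin.
have Fpsi := fourier_bs_levelZ mu_haar n0 psin.
have [I1 ->] := key _ _ phin psin; have [I2 ->] := key _ _ Fphi Fpsi.
split => //; congr (_ * _).
pose P j l := cintegral leb (fun t => FT (fun s => phi (s, point n j)) t *
  conjc (FT (fun s => psi (s, point n l)) t)).
have PI (j l : 'I_(n ^ 2)) : cintegrable leb (fun t => FT (fun s => phi (s, point n j)) t *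
    conjc (FT (fun s => psi (s, point n l)) t)).
  have [C dC] := schwartz_decay (schwartz_FT (bs_section (point n j) phin)).
  have [D dD] := schwartz_decay (schwartz_FT (bs_section (point n l) psin)).
  exact: decay_cintegrable (decayMM dC (decay_conjc dD)).
pose y j l := finv n * (point n j - point n l).
have kE k : cintegral leb (fun t => fourier mu phi (t, point n k) *
      conjc (fourier mu psi (t, point n k))) =
    n%:R^-1 ^+ 2 * \sum_(j < n ^ 2) \sum_(l < n ^ 2) chif (k%:R * y j l) * P j l.
  have Vk := VZ_point k n0.
  have E1 t := congr1 (@^~ t) (fourier_sectionE mu_haar n0 phin Vk).
  have E2 t := congr1 (@^~ t) (fourier_sectionE mu_haar n0 psin Vk).
  have -> : (fun t => fourier mu phi (t, point n k) *
      conjc (fourier mu psi (t, point n k))) = (fun t => n%:R^-1 ^+ 2 *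
      \sum_(j < n ^ 2) \sum_(l < n ^ 2) chif (k%:R * y j l) *
       (FT (fun s => phi (s, point n j)) t * conjc (FT (fun s => psi (s, point n l)) t))).
    apply/funext => t; rewrite (E1 t) (E2 t) conjcM mulrACA.
    rewrite conjc_natV -expr2; congr (_ * _); rewrite mulr_suml.
    apply: eq_bigr => j _; rewrite conjc_sum mulr_sumr; apply: eq_bigr => l _.
    rewrite conjcM mulrACA; congr (_ * _).
    by rewrite -chifN -chifD; congr chif; rewrite /y; ring.
  have I3 (j l : 'I_(n ^ 2)) := cintegrableZ (chif (k%:R * y j l)) (PI j l).
  have I4 (j : 'I_(n ^ 2)) := cintegrable_sum (index_enum 'I_(n ^ 2)) (I3 j).
  rewrite cintegralZ; last exact: cintegrable_sum.
  congr (_ * _); rewrite cintegral_sum//; apply: eq_bigr => j _.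
  by rewrite cintegral_sum//; apply: eq_bigr => l _; rewrite cintegralZ.
rewrite (eq_bigr _ (fun (k : 'I_(n ^ 2)) _ => kE k)) -mulr_sumr exchange_big /=.
rewrite mulr_sumr; apply: eq_bigr => j _; rewrite exchange_big /=.
have ny (l : nat) : Zhat ((n ^ 2)%:R * y j l).
  rewrite /y natrX expr2 -mulrA finvK// mulrBr.
  by apply: ZhatD; [|apply: ZhatN]; exact: VZ_point.
have sumE (l : 'I_(n ^ 2)) : \sum_(k < n ^ 2) chif (k%:R * y j l) * P j l =
    if l == j then (n ^ 2)%:R * P j l else 0.
  rewrite -mulr_suml sum_chif//; case: asboolP => [Zy|Zy].
    rewrite ifT//; apply/eqP/val_inj.
    have cl : coset n l (point n j) by apply/UZP.
    have cj : coset n j (point n j) by rewrite /coset /= subrr; exact: UZ0.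
    exact: coset_inj n0 (ltn_ord l) (ltn_ord j) cl cj.
  rewrite ifF ?mul0r//; apply/eqP => lj; apply: Zy.
  by rewrite /y lj subrr mulr0; exact: (Zhat_nat 0).
rewrite (eq_bigr _ (fun (l : 'I_(n ^ 2)) _ => sumE l)) -big_mkcond big_pred1_eq.
have n0' : (n%:R : R[i]) != 0 by rewrite pnatr_eq0 -lt0n.
rewrite natrX mulrA -exprMn mulVf// expr1n mul1r.
exact: FT_parseval (bs_section _ phin) (bs_section _ psin).
Qed.

End AdelicInversion.

(** * The transform on the Bruhat-Schwartz space *)

Section BruhatSchwartzFourier.
Variables (R : realType) (mu : {sigma_finite_measure set finadele -> \bar R}).
Hypothesis mu_haar : normalized_haar mu.
Implicit Types (phi psi : bsfun R) (n : nat) (x : adele R).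

Lemma bsfun_level phi : exists2 n, (0 < n)%N & bs_levelZ n phi.
Proof.
have /asboolP[H [K [HK phiHK]]] := bs_valP phi.
by have [n n0 [Hn nK]] := bs_level HK; exists n => //; exact: bs_step_mono phiHK.
Qed.

Lemma bsfun_level2 phi psi (y : finadele) :
  exists2 n, (0 < n)%N & [/\ bs_levelZ n phi, bs_levelZ n psi & VZ n y].
Proof.
have [n n0 phin] := bsfun_level phi; have [m m0 psim] := bsfun_level psi.
have [d d0 Vy] := finadele_den y.
exists (n * (m * d))%N; first by rewrite !muln_gt0 n0 m0.
split.
- by apply: bs_levelZ_dvd phin; exact: dvdn_mulr.
- by apply: bs_levelZ_dvd psim; rewrite dvdn_mull// dvdn_mulr.
- by apply: VZ_dvd Vy; rewrite !dvdn_mull.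
Qed.

Lemma fourier_bruhat_schwartz phi : fourier mu phi \in @bruhat_schwartz R.
Proof.
have [n n0 phin] := bsfun_level phi; apply/asboolP.
exists (VZ n), (UZ n); split; first exact: bs_indexZ.
exact: fourier_bs_levelZ.
Qed.

Definition bsfourier phi : bsfun R := BSFun (fourier_bruhat_schwartz phi).

Lemma bsfourier_cintegrable phi x :
  cintegrable (adele_haar mu) (fun y => (phi y : R[i]) * chi (x * y)).
Proof.
by have [n n0 phin] := bsfun_level phi; exact: fourier_cintegrable phin.
Qed.

Lemma bsfourier_linear : linear bsfourier.
Proof.
move=> a phi psi; apply: val_inj; apply/funext => x /=.
rewrite -[RHS]/(a * fourier mu phi x + fourier mu psi x) /fourier.
have I1 := bsfourier_cintegrable phi x; have I2 := bsfourier_cintegrable psi x.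
rewrite -(cintegralZ a I1); apply: etrans (cintegralD (cintegrableZ a I1) I2).
by congr cintegral; apply/funext => y; rewrite mulrA -mulrDl.
Qed.

Lemma bs_openE (W : set (bsfun R)) : open W <-> bs_open W.
Proof. by []. Qed.

(** By linearity, the preimage of an absolutely convex neighbourhood of zero is absolutely convex.
    Each step of the limit lies in some level [n], so estimates within the levels are enough. *)
Lemma bs_continuous (F : {linear bsfun R -> bsfun R}) :
  (forall n, (0 < n)%N -> (forall phi, bs_levelZ n phi -> bs_levelZ n (F phi)) /\
    forall N, exists M, exists2 c : R, 0 <= c & forall phi B, bs_levelZ n phi ->
      (forall a, VZ n a -> sbound M B (fun t => phi (t, a))) ->
      forall a, VZ n a -> sbound N (c * B) (fun t => F phi (t, a))) ->
  continuous F.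
Proof.
move=> Fn; apply/continuousP => W /bs_openE oW; apply/bs_openE.
move=> phi /= /oW[U [cU nU] UW].
exists (F @^-1` U); last by move=> psi /= /UW; rewrite linearD.
split=> [a b f g ab /= Uf Ug|H K HK].
  by rewrite /= linearD !linearZ; exact: cU.
have [n n0 [Hn nK]] := bs_level HK; have [FL FB] := Fn n n0.
have [N [e [e0 NU]]] := nU _ _ (bs_indexZ n0).
have [M [c c0 cP]] := FB N.
have c1 : 0 < c + 1 by rewrite ltr_wpDl.
(* The denominator [c + 1] makes [c e / (c + 1) < e] strict and is positive even when [c = 0]. *)
exists M, (e / (c + 1)); split; first by rewrite divr_gt0.
move=> psi [psiHK psiB]; apply: NU.
have psin : bs_levelZ n psi by exact: bs_step_mono psiHK.
have Fpsi := FL _ psin; split => // a m k Va mN kN.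
have B : forall a, VZ n a -> sbound M (e / (c + 1)) (fun t => psi (t, a)).
  move=> y Vy; have [Hy|Hy] := pselect (H y).
    move=> i j t iM jM; apply: le_trans (seminorm_ub i j t (bs_section y psin)) _.
    exact/ltW/psiB.
  rewrite (_ : (fun t => _) = (fun=> 0)).
    by apply: sbound0; rewrite divr_ge0 ?ltW.
  by apply/funext => t; case: psiHK => ->.
apply: le_lt_trans (seminorm_le (cP _ _ psin B a Va) mN kN) _.
by rewrite mulrA ltr_pdivrMr// mulrC ltr_pM2l// ltrDl.
Qed.

Lemma fourier_fourier phi x : bsfourier (bsfourier phi) x = phi (- x).
Proof.
have [n n0 [phin _ Vx]] := bsfun_level2 phi phi x.2.
have [_] := fourier_inversion_level mu_haar false n0 phin Vx.
rewrite expr0 mul1r => <-; congr cintegral; apply/funext => y.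
by rewrite mul1r [y * x]mulrC.
Qed.

End BruhatSchwartzFourier.

Theorem theorem5p4 (R : realType)
    (mu : {sigma_finite_measure set finadele -> \bar R})
    (mu_haar : normalized_haar mu) :
  [/\ exists F : {linear bsfun R -> bsfun R},
        [/\ forall (phi : bsfun R) (xi : adele R),
              cintegrable (adele_haar mu)
                (fun x : adele R => (phi x : R[i]) * chi (xi * x)) /\
              F phi xi = fourier mu phi xi,
            continuous F
          & exists G : bsfun R -> bsfun R,
              [/\ cancel F G, cancel G F & continuous G]],
      forall (phi : bsfun R) (x : adele R),
        cintegrable (adele_haar mu)
          (fun xi : adele R => fourier mu phi (- xi) * chi (xi * x)) /\
        phi x = cintegral (adele_haar mu)
          (fun xi : adele R => fourier mu phi (- xi) * chi (xi * x))
    & forall phi psi : bsfun R,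
        [/\ cintegrable (adele_haar mu)
              (fun x : adele R => (phi x : R[i]) * conjc (psi x)),
            cintegrable (adele_haar mu)
              (fun xi : adele R => fourier mu phi xi * conjc (fourier mu psi xi))
          & cintegral (adele_haar mu)
              (fun x : adele R => (phi x : R[i]) * conjc (psi x)) =
            cintegral (adele_haar mu)
              (fun xi : adele R => fourier mu phi xi * conjc (fourier mu psi xi))]].
Proof.
split.
- pose F : {linear bsfun R -> bsfun R} := HB.pack (bsfourier mu_haar)
    (GRing.isLinear.Build _ _ _ _ _ (bsfourier_linear mu_haar)).
  have FE phi x : F (F phi) x = phi (- x) by exact: fourier_fourier.
  (* Two transforms reflect the argument, so the fourth power is the identity: the cube of [F] is a
     two-sided inverse, continuous as a composite. *)
  have F4 : cancel F (F \o F \o F).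
    move=> phi; apply: val_inj; apply/funext => x.
    by rewrite -[LHS]/(F (F (F (F phi))) x) !FE opprK.
  have cF : continuous F.
    apply: bs_continuous => n n0; split=> [phi phin|N].
      by have := fourier_bs_levelZ mu_haar n0 phin.
    have [c c0 cP] := fourier_sbound mu_haar N n0.
    exists (2 + N + N)%N; exists c => // phi B phin h a Va.
    by have := cP _ _ phin h a Va.
  exists F; split => //.
    by move=> phi xi; split => //; exact: bsfourier_cintegrable.
  exists (F \o F \o F); split => // phi.
  apply: (@continuous_comp _ _ _ F (F \o F)); first exact: cF.
  by apply: (@continuous_comp _ _ _ F F); exact: cF.
- move=> phi x; have [n n0 [phin _ Vx]] := bsfun_level2 phi phi x.2.
  have E : (fun xi : adele R => fourier mu phi ((-1) ^+ true * xi) * chi (xi * x)) =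
      (fun xi => fourier mu phi (- xi) * chi (xi * x)).
    by apply/funext => xi; rewrite expr1 mulN1r.
  have [I J] := fourier_inversion_level mu_haar true n0 phin Vx.
  split; first exact: (eq_ind _ (cintegrable (adele_haar mu)) I _ E).
  apply: etrans (congr1 (cintegral (adele_haar mu)) E).
  by apply: etrans (esym J); rewrite expr1 mulN1r opprK.
- move=> phi psi; have [n n0 [phin psin _]] := bsfun_level2 phi psi 0.
  exact: (parseval_level mu_haar n0 phin psin).
Qed.
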